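(* For a non-negative Borel measure $\mu$ on the unit circle $\mathbb{T}$, the non-tangential jump behavior of the normalized Cauchy transform $\mathcal{C}_{\bar\xi\mu}$ across $\mathbb{T}$ is given by $$[[\mathcal{C}_{\bar\xi\mu}]](\xi)=\frac{1}{\xi\,(K^+\mu(\xi))\,(K^-\mu(\xi))}\,\frac{d\mu}{dm}(\xi)\qquad\text{for } m\text{-a.e. }\xi\in\mathbb{T}.$$
   Context: Standing setting: $\mu$ is the spectral measure of a unitary operator with respect to a cyclic unit vector, so that $\mu(\mathbb{T})=1$. $m$ is (normalized) Lebesgue measure on $\mathbb{T}$, and $\frac{d\mu}{dm}$ is the density of the absolutely continuous part of $\mu$. For $f\in L^1(\mu)$ the Cauchy transform is $K(f\mu)(z)=\int_{\mathbb{T}}\frac{f(\xi)\,d\mu(\xi)}{1-\bar\xi z}$, $z\in\mathbb{C}\setminus\mathbb{T}$, with $K\mu=K(1\cdot\mu)$, and the normalized Cauchy transform is $\mathcal{C}_{f\mu}(z)=K(f\mu)(z)/K\mu(z)$, $z\in\mathbb{C}\setminus\mathbb{T}$; in $\mathcal{C}_{\bar\xi\mu}$ the function $f$ is $f(\xi)=\bar\xi$. For $\xi\in\mathbb{T}$, $K^+\mu(\xi)$ and $\mathcal{C}^+_{f\mu}(\xi)$ denote the non-tangential limits of $K\mu(z)$ and $\mathcal{C}_{f\mu}(z)$ as $z\to\xi$ with $|z|>1$ (from outside), and $K^-\mu(\xi)$ and $\mathcal{C}^-_{f\mu}(\xi)$ those with $|z|<1$ (from inside). The jump is $[[\mathcal{C}_{f\mu}]](\xi)=\mathcal{C}^-_{f\mu}(\xi)-\mathcal{C}^+_{f\mu}(\xi)$.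 *)

(* Defs.v *)
From HB Require Import structures.
From mathcomp Require Import all_boot all_order all_algebra.
From mathcomp Require Import complex.
From mathcomp Require Import all_classical all_reals all_analysis.
From mathcomp Require Import measurable_realfun.

Set Implicit Arguments.
Unset Strict Implicit.
Unset Printing Implicit Defensive.
Import Order.TTheory GRing.Theory Num.Theory.
Import numFieldNormedType.Exports.
Local Open Scope classical_set_scope.
Local Open Scope ring_scope.
Local Open Scope complex_scope.

(* The norm topology of the numClosedFieldType R[i]; beware that the norm `|z|
   takes its values in R[i] (it is real there), not in R. *)
HB.instance Definition _ (R : realType) :=
  PseudoPointedMetric.copy R[i] R[i]^o.
HB.instance Definition _ (R : realType) := NormedModule.copy R[i] R[i]^o.

Definition circle (R : realType) : Type :=
  set_type [set z : R[i] | `|z| = 1].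

HB.instance Definition _ (R : realType) := Topological.on (circle R).

Definition circle_val (R : realType) (xi : circle R) : R[i] := \val xi.
Coercion circle_val : circle >-> complex.

Lemma circle_expi_subproof (R : realType) (t : R) :
  (cos t +i* sin t) \in [set z : R[i] | `|z| = 1].
Proof. by apply/mem_set => /=; rewrite normc_def/= cos2Dsin2 sqrtr1. Qed.

Definition circle_expi (R : realType) (t : measurableTypeR R) : circle R :=
  exist _ (cos t +i* sin t) (circle_expi_subproof t).

HB.instance Definition _ (R : realType) :=
  isPointed.Build (circle R) (circle_expi 0).

HB.instance Definition _ (R : realType) :=
  Measurable.copy (circle R) (g_sigma_algebraType (@open (circle R))).

Lemma continuous_real_complex (R : realType) :
  continuous (fun x : R => x%:C : R[i]).
Proof.
move=> x; apply/cvgrPdist_lt => e; rewrite ltcE /= => /andP[/eqP Ime Ree].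
near=> y; rewrite -rmorphB normc_def/= expr0n addr0 sqrtr_sqr ltcE/= Ime eqxx/=.
near: y; by apply: (cvgrPdist_lt _ _).1 Ree; exact: cvg_id.
Unshelve. all: by end_near. Qed.

Lemma continuous_circle_expi (R : realType) : continuous (@circle_expi R).
Proof.
apply/continuous_comp_initial => t /=.
have -> : set_val \o @circle_expi R = fun t => (cos t)%:C + 'i * (sin t)%:C.
  by apply/funext => u; rewrite /= mulrC; simpc.
apply: cvgD; last apply: cvgMl_tmp.
  by apply: continuous_comp; [exact: continuous_cos|exact: continuous_real_complex].
by apply: continuous_comp; [exact: continuous_sin|exact: continuous_real_complex].
Qed.

Lemma measurable_circle_expi (R : realType) :
  measurable_fun setT (@circle_expi R).
Proof.
apply: (@measurability _ _ _ _ _ _ (@open (circle R))) => //.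
move=> _ [U oU <-]; rewrite setTI; apply: open_measurable.
by move/continuousP : (@continuous_circle_expi R); exact.
Qed.

HB.instance Definition _ (R : realType) :=
  isMeasurableFun.Build _ _ _ _ (@circle_expi R) (@measurable_circle_expi R).

Lemma pi2_gt0 (R : realType) : 0 < 2 * pi :> R.
Proof. by rewrite mulr_gt0// pi_gt0. Qed.

(* Lebesgue measure normalized to total mass 1. *)
Definition circle_lebesgue (R : realType) : probability (circle R) R :=
  distribution (uniform_prob (pi2_gt0 R)) (@circle_expi R).

Definition mutually_singular d (T : measurableType d) (R : realType)
    (nu1 nu2 : {measure set T -> \bar R}) : Prop :=
  exists N : set T, [/\ measurable N, nu1 (~` N) = 0%E & nu2 N = 0%E].

(* h is (a version of) the density dmu/dm of the absolutely continuous part of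
   the Lebesgue decomposition mu = h m + nu with nu singular to m. *)
Definition is_ac_density (R : realType)
    (mu : {measure set (circle R) -> \bar R}) (h : circle R -> R) : Prop :=
  [/\ forall xi, 0 <= h xi,
      (circle_lebesgue R).-integrable [set: circle R] (EFin \o h) &
      exists2 nu : {measure set (circle R) -> \bar R},
        mutually_singular nu (circle_lebesgue R) &
        forall A : set (circle R), measurable A ->
          mu A = (\int[circle_lebesgue R]_(xi in A) (h xi)%:E + nu A)%E].

(* Integral of a complex-valued function, meaningful when the real and
   imaginary parts are integrable. *)
Definition cintegral d (T : measurableType d) (R : realType)
    (mu : {measure set T -> \bar R}) (f : T -> R[i]) : R[i] :=
  (\int[mu]_x complex.Re (f x)) +i* (\int[mu]_x complex.Im (f x)).

Definition cauchy_transform (R : realType)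
    (mu : {measure set (circle R) -> \bar R}) (f : circle R -> R[i])
    (z : R[i]) : R[i] :=
  cintegral mu (fun xi : circle R => f xi / (1 - (xi : R[i])^*%C * z)).

(* At a zero of K mu the value is 0 by the convention x / 0 = 0.  For a
   probability measure mu, Re K mu > 1/2 inside the circle, so zeros occur only
   outside, where they are isolated unless K mu vanishes identically there,
   which happens only when mu is the normalized Lebesgue measure.  Apart from
   that case, at a point where K mu tends to 0 from outside, the transform of
   f(xi) = xi^* , equal to (1 - 1 / K mu z) / z off the zeros, has no finite
   limit. *)
Definition normalized_cauchy_transform (R : realType)
    (mu : {measure set (circle R) -> \bar R}) (f : circle R -> R[i])
    (z : R[i]) : R[i] :=
  cauchy_transform mu f z / cauchy_transform mu (fun=> 1) z.

Definition disc (R : realType) : set R[i] := [set z | `|z| < 1].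
Definition exterior (R : realType) : set R[i] := [set z | 1 < `|z|].

(* Stolz region of aperture a at xi, on both sides of the circle. *)
Definition stolz (R : realType) (xi : circle R) (a : R) : set R[i] :=
  [set z : R[i] | `|z - (xi : R[i])| < a%:C * `|1 - `|z| |].

Definition nontangential_limit (R : realType) (D : set R[i])
    (F : R[i] -> R[i]) (xi : circle R) (l : R[i]) : Prop :=
  forall a : R, 1 < a ->
    F z @[z --> within (D `&` stolz xi a) (nbhs (xi : R[i]))] --> l.

(* Main.v *)
(* Write K for the Cauchy transform of mu. Since mu has mass 1, Re K >= 1/2 in the
   disc and K(z) = 1 - conj(K(1 / conj z)) outside, so K^+ = 1 - conj(K^-); moreover
   the transform of conj(xi) is (K(z) - 1) / z. The jump is therefore
   (K^- - K^+) / (xi K^+ K^-), with K^- - K^+ = 2 Re K^- - 1 the boundary value of the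
   Poisson integral of mu.
   Existence of K^-: 1/K is bounded and holomorphic in the disc, its dilates are Cauchy
   in L2, hence it is the Poisson integral of a bounded function and converges
   nontangentially at the Lebesgue points of that function.
   Nonvanishing: a bounded holomorphic u with u(0) <> 0 cannot have boundary value 0 on
   a non-null compact set. Applied to 1/K it makes K^- finite; applied to 1 - 1/K,
   divided by the largest possible power of z, it gives K^+ <> 0 a.e. unless K = 1
   identically in the disc; then K = 0 outside, and both sides of the formula vanish
   by the convention x / 0 = 0.
   Density: integrating the Poisson integral over a compact set C and exchanging the
   order of integration bounds the limit from above by h, while the Poisson integrals
   of min(h, T) bound it from below. *)

Require Import Defs.
From HB Require Import structures.
From mathcomp Require Import all_boot all_order all_algebra.
From mathcomp Require Import complex.
From mathcomp Require Import all_classical all_reals all_analysis.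
From mathcomp Require Import measurable_realfun.
From mathcomp Require Import ring lra.

Set Implicit Arguments.
Unset Strict Implicit.
Unset Printing Implicit Defensive.
Import Order.TTheory GRing.Theory Num.Theory.
Import numFieldNormedType.Exports.
Local Open Scope classical_set_scope.
Local Open Scope ring_scope.
Local Open Scope complex_scope.

(** * The modulus and nontangential limits *)

(** K itself need not be bounded, nor its dilates bounded in L2 (a point mass gives 1 / (1 - z) up
    to rotation). Passing to 1/K, of modulus at most 2, makes quadratic means available; the price
    is to exclude the boundary values 0 and 1 of 1/K. Such a uniqueness statement usually rests on
    the integrability of log |u|; here it comes from powers of a multiplier that exceeds 1 at the
    centre but, in the limit, not on the boundary off the given compact set. All function theory
    reduces to one computation, the vanishing of the nonzero moments of Lebesgue measure, carried to
    holomorphic functions by uniform approximation with polynomials. The Poisson integral of mu is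
    never treated by differentiating mu: its limit is already known to exist almost everywhere
    through K^-, so identifying it with h takes only integral inequalities along one sequence of
    radii, and the differentiation theorem is applied to bounded functions alone. *)

(* The library norm of R[i] takes its values in R[i]; this one is real-valued. *)
Definition cmod (R : realType) (z : R[i]) : R :=
  Num.sqrt (complex.Re z ^+ 2 + complex.Im z ^+ 2).

Lemma normrCE (R : realType) (z : R[i]) : `|z| = (cmod z)%:C.
Proof. exact: normc_def. Qed.

Lemma cmod_ge0 (R : realType) (z : R[i]) : 0 <= cmod z.
Proof. exact: sqrtr_ge0. Qed.

Lemma cmodM (R : realType) (x y : R[i]) : cmod (x * y) = cmod x * cmod y.
Proof. by apply: (@complexI R); rewrite rmorphM /= -!normrCE normrM. Qed.

Lemma cmodV (R : realType) (x : R[i]) : cmod x^-1 = (cmod x)^-1.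
Proof. by apply: (@complexI R); rewrite fmorphV /= -!normrCE normfV. Qed.

Lemma cmodX (R : realType) (x : R[i]) n : cmod (x ^+ n) = cmod x ^+ n.
Proof. by apply: (@complexI R); rewrite rmorphXn /= -!normrCE normrX. Qed.

Lemma cmodN (R : realType) (x : R[i]) : cmod (- x) = cmod x.
Proof. by apply: (@complexI R); rewrite -!normrCE normrN. Qed.

Lemma cmodC (R : realType) (x y : R[i]) : cmod (x - y) = cmod (y - x).
Proof. by rewrite -cmodN opprB. Qed.

Lemma cmodD (R : realType) (x y : R[i]) : cmod (x + y) <= cmod x + cmod y.
Proof. by rewrite -lecR rmorphD/= -!normrCE ler_normD. Qed.

Lemma cmodB (R : realType) (x y : R[i]) : cmod (x - y) <= cmod x + cmod y.
Proof. by rewrite -(cmodN y) cmodD. Qed.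

Lemma cmod_dist (R : realType) (x y : R[i]) : cmod x - cmod y <= cmod (x - y).
Proof. by rewrite lerBlDr (le_trans _ (cmodD _ _))// subrK. Qed.

Lemma cmodJ (R : realType) (x : R[i]) : cmod x^*%C = cmod x.
Proof. by apply: (@complexI R); rewrite -!normrCE normcJ. Qed.

Lemma cmod_real (R : realType) (x : R) : cmod x%:C = `|x|.
Proof. by rewrite /cmod/= expr0n addr0 sqrtr_sqr. Qed.

Lemma cmod0 (R : realType) : cmod (0 : R[i]) = 0.
Proof. by rewrite (cmod_real 0) normr0. Qed.

Lemma cmod1 (R : realType) : cmod (1 : R[i]) = 1.
Proof. by rewrite (cmod_real 1) normr1. Qed.

Lemma cmod_eq0 (R : realType) (z : R[i]) : (cmod z == 0) = (z == 0).
Proof.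
by rewrite -[RHS](@normr_eq0 _ R[i]) normrCE -(inj_eq (@complexI R)).
Qed.

Lemma cmod_gt0 (R : realType) (z : R[i]) : (0 < cmod z) = (z != 0).
Proof. by rewrite lt_neqAle eq_sym cmod_eq0 cmod_ge0 andbT. Qed.

Lemma sqr_cmod (R : realType) (z : R[i]) :
  cmod z ^+ 2 = complex.Re z ^+ 2 + complex.Im z ^+ 2.
Proof. by rewrite sqr_sqrtr// addr_ge0 ?sqr_ge0. Qed.

Lemma ReD (R : realType) (x y : R[i]) :
  complex.Re (x + y) = complex.Re x + complex.Re y.
Proof. by case: x y => ? ? []. Qed.

Lemma ImD (R : realType) (x y : R[i]) :
  complex.Im (x + y) = complex.Im x + complex.Im y.
Proof. by case: x y => ? ? []. Qed.

Lemma ReN (R : realType) (x : R[i]) : complex.Re (- x) = - complex.Re x.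
Proof. by case: x. Qed.

Lemma ImN (R : realType) (x : R[i]) : complex.Im (- x) = - complex.Im x.
Proof. by case: x. Qed.

Lemma ReM (R : realType) (x y : R[i]) : complex.Re (x * y) =
  complex.Re x * complex.Re y - complex.Im x * complex.Im y.
Proof. by case: x y => ? ? []. Qed.

Lemma ImM (R : realType) (x y : R[i]) : complex.Im (x * y) =
  complex.Re x * complex.Im y + complex.Im x * complex.Re y.
Proof. by case: x y => ? ? []. Qed.

Lemma ReJ (R : realType) (x : R[i]) : complex.Re x^*%C = complex.Re x.
Proof. by case: x. Qed.

Lemma ImJ (R : realType) (x : R[i]) : complex.Im x^*%C = - complex.Im x.
Proof. by case: x. Qed.

Lemma ReV (R : realType) (x : R[i]) :
  complex.Re x^-1 = complex.Re x / cmod x ^+ 2.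
Proof. by rewrite sqr_cmod; case: x. Qed.

Lemma ImV (R : realType) (x : R[i]) :
  complex.Im x^-1 = - (complex.Im x / cmod x ^+ 2).
Proof. by rewrite sqr_cmod; case: x. Qed.

Definition reimE := (ReD, ImD, ReN, ImN, ReM, ImM, ReJ, ImJ, ReV, ImV).

Lemma eq_reim (R : realType) (x y : R[i]) :
  complex.Re x = complex.Re y -> complex.Im x = complex.Im y -> x = y.
Proof. by case: x y => ? ? [] ? ? /= -> ->. Qed.

Lemma mulJc (R : realType) (z : R[i]) : z * z^*%C = (cmod z ^+ 2)%:C.
Proof.
by apply: eq_reim; rewrite !reimE sqr_cmod/= ?expr2; ring.
Qed.

Lemma Re_le_cmod (R : realType) (z : R[i]) : `|complex.Re z| <= cmod z.
Proof. by rewrite -sqrtr_sqr ler_wsqrtr// lerDl sqr_ge0. Qed.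

Lemma Im_le_cmod (R : realType) (z : R[i]) : `|complex.Im z| <= cmod z.
Proof. by rewrite -sqrtr_sqr ler_wsqrtr// lerDr sqr_ge0. Qed.

Lemma cmod_le_reim (R : realType) (z : R[i]) :
  cmod z <= `|complex.Re z| + `|complex.Im z|.
Proof.
rewrite {1}[z]complexE (le_trans (cmodD _ _))// cmodM !cmod_real.
by rewrite lerD2l /cmod/= expr0n add0r expr1n sqrtr1 mul1r.
Qed.

Lemma cmod_circle (R : realType) (xi : circle R) : cmod (xi : R[i]) = 1.
Proof.
have /set_mem /= := valP xi.
by rewrite normrCE => /(congr1 (@complex.Re R)).
Qed.

Lemma conj_circle (R : realType) (xi : circle R) :
  (xi : R[i]) * (xi : R[i])^*%C = 1.
Proof. by rewrite mulJc cmod_circle expr1n. Qed.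

Lemma nbhs_cmodP (R : realType) (z0 : R[i]) (A : set R[i]) :
  nbhs z0 A <-> exists2 e : R, 0 < e & forall z, cmod (z - z0) < e -> A z.
Proof.
split.
  move=> /nbhs_normP[e /= + eA]; rewrite ltcE/= => /andP[/eqP Ie e0].
  exists (complex.Re e) => // z zz0; apply: eA => /=.
  by rewrite normrCE ltcE/= Ie eqxx/= cmodC.
move=> [e e0 eA]; apply/nbhs_normP; exists e%:C => /=; first by rewrite ltcR.
by move=> z /=; rewrite normrCE ltcR cmodC => /eA.
Qed.

Lemma cvg_cmodP (R : realType) (T : Type) (F : set_system T) (FF : Filter F)
    (f : T -> R[i]) (l : R[i]) :
  f @ F --> l <-> forall e : R, 0 < e -> \forall x \near F, cmod (f x - l) < e.
Proof.
split=> [fl e e0|fl].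
  by apply: (fl [set y | cmod (y - l) < e]); apply/nbhs_cmodP; exists e.
move=> A /nbhs_cmodP[e e0 eA]; apply: filterS (fl _ e0) => x /= xe.
exact: eA.
Qed.

Lemma nontangential_limitP (R : realType) (D : set R[i]) (F : R[i] -> R[i])
    (xi : circle R) (l : R[i]) :
  nontangential_limit D F xi l <->
  forall a : R, 1 < a -> forall e : R, 0 < e -> exists2 d : R, 0 < d &
    forall z, D z -> cmod (z - (xi : R[i])) < a * `|1 - cmod z| ->
      cmod (z - (xi : R[i])) < d -> cmod (F z - l) < e.
Proof.
have stP a z : (stolz xi a) z = (cmod (z - (xi : R[i])) < a * `|1 - cmod z|) :> Prop.
  rewrite /stolz/= !normrCE (_ : 1 - (cmod z)%:C = (1 - cmod z)%:C).
    by rewrite cmod_real -rmorphM ltcR.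
  by rewrite rmorphB.
split.
  move=> h a a1 e e0; have /cvg_cmodP/(_ e e0) := h a a1.
  rewrite near_withinE => /nbhs_cmodP[d d0 dh]; exists d => // z Dz zxi zd.
  by apply: dh => //; split => //; rewrite stP.
move=> h a a1; apply/cvg_cmodP => e e0; rewrite near_withinE.
have [d d0 dh] := h a a1 e e0; apply/nbhs_cmodP; exists d => // z zd.
by move=> [Dz]; rewrite stP => zxi; exact: dh.
Qed.

Lemma discP (R : realType) (z : R[i]) : disc z <-> cmod z < 1.
Proof. by rewrite /disc/= normrCE -[1]/(1%:C) ltcR. Qed.

Lemma exteriorP (R : realType) (z : R[i]) : exterior z <-> 1 < cmod z.
Proof. by rewrite /exterior/= normrCE -[1]/(1%:C) ltcR. Qed.

(** * Integrals of bounded functions *)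

(** Boundedness holds everywhere and not merely almost everywhere, so that one function is
    integrable against every probability measure: the kernels below are integrated against both
    Lebesgue measure and [mu]. *)
Definition bmeas d (T : measurableType d) (R : realType) (f : T -> R) :=
  measurable_fun setT f /\ exists M, forall x, `|f x| <= M.

Lemma bmeas_cst d (T : measurableType d) (R : realType) (c : R) :
  bmeas (fun _ : T => c).
Proof. by split; [exact: measurable_cst|exists `|c|]. Qed.

Lemma bmeasD d (T : measurableType d) (R : realType) (f g : T -> R) :
  bmeas f -> bmeas g -> bmeas (fun x => f x + g x).
Proof.
move=> [mf [M fM]] [mg [N gN]]; split; first exact: measurable_funD.
by exists (M + N) => x; rewrite (le_trans (ler_normD _ _))// lerD.
Qed.

Lemma bmeasM d (T : measurableType d) (R : realType) (f g : T -> R) :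
  bmeas f -> bmeas g -> bmeas (fun x => f x * g x).
Proof.
move=> [mf [M fM]] [mg [N gN]]; split; first exact: measurable_funM.
by exists (M * N) => x; rewrite normrM ler_pM.
Qed.

Lemma bmeasN d (T : measurableType d) (R : realType) (f : T -> R) :
  bmeas f -> bmeas (fun x => - f x).
Proof.
move=> [mf [M fM]]; split; first exact: measurable_funN.
by exists M => x; rewrite normrN.
Qed.

Lemma bmeasB d (T : measurableType d) (R : realType) (f g : T -> R) :
  bmeas f -> bmeas g -> bmeas (fun x => f x - g x).
Proof. by move=> bf bg; apply: bmeasD => //; exact: bmeasN. Qed.

Lemma bmeas_norm d (T : measurableType d) (R : realType) (f : T -> R) :
  bmeas f -> bmeas (fun x => `|f x|).
Proof.
move=> [mf [M fM]]; split; first exact: measurableT_comp.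
by exists M => x; rewrite normr_id.
Qed.

Lemma bmeasX d (T : measurableType d) (R : realType) (f : T -> R) n :
  bmeas f -> bmeas (fun x => f x ^+ n).
Proof.
move=> bf; elim: n => [|n IH]; first exact: bmeas_cst.
by under [X in bmeas X]eq_fun do rewrite exprS; exact: bmeasM.
Qed.

Lemma bmeas_sum d (T : measurableType d) (R : realType) (I : Type) (r : seq I)
    (f : I -> T -> R) :
  (forall i, bmeas (f i)) -> bmeas (fun x => \sum_(i <- r) f i x).
Proof.
move=> bf; elim: r => [|i r IH].
  by under [X in bmeas X]eq_fun do rewrite big_nil; exact: bmeas_cst.
by under [X in bmeas X]eq_fun do rewrite big_cons; exact: bmeasD.
Qed.

Lemma bmeas_indic d (T : measurableType d) (R : realType) (A : set T) :
  measurable A -> bmeas (\1_A : T -> R).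
Proof.
move=> mA; split; first exact: measurable_indic.
by exists 1 => x; rewrite indicE; case: (_ \in _); rewrite ?normr1 ?normr0.
Qed.

(** Nonnegativity allows reading the inverse as a power of exponent -1, which is measurable and
    respects the convention 1 / 0 = 0, so that f may vanish. *)
Lemma measurable_fun_inv_ge0 d (T : measurableType d) (R : realType)
    (f : T -> R) : (forall x, 0 <= f x) ->
  measurable_fun setT f -> measurable_fun setT (fun x => (f x)^-1).
Proof.
move=> f0 mf; under [X in measurable_fun _ X]eq_fun => x
  do rewrite -(powR_inv1 (f0 x)).
exact: (measurableT_comp (measurable_powR (-1))).
Qed.

Lemma bmeas_inv d (T : measurableType d) (R : realType) (f : T -> R) (c : R) :
  0 < c -> (forall x, c <= f x) -> measurable_fun setT f ->
  bmeas (fun x => (f x)^-1).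
Proof.
move=> c0 cf mf; have f0 x : 0 < f x := lt_le_trans c0 (cf x).
split; first by apply: measurable_fun_inv_ge0 => // x; exact: ltW.
by exists c^-1 => x; rewrite ger0_norm ?invr_ge0 ?(ltW (f0 x))// lef_pV2 ?posrE.
Qed.

Lemma bmeas_integrable d (T : measurableType d) (R : realType)
    (P : probability T R) (D : set T) (f : T -> R) :
  measurable D -> bmeas f -> P.-integrable D (EFin \o f).
Proof.
move=> mD [mf [M fM]]; apply: measurable_bounded_integrable => //.
- by rewrite (le_lt_trans (probability_le1 _ _))// ltry.
- exact: measurable_funTS.
- exists M; split; first exact: num_real.
  by move=> x Mx y _ /=; exact: le_trans (fM y) (ltW Mx).
Qed.

Lemma bmeas_int d (T : measurableType d) (R : realType)
    (P : probability T R) (f : T -> R) :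
  bmeas f -> P.-integrable setT (EFin \o f).
Proof. exact: bmeas_integrable. Qed.

Lemma rintD d (T : measurableType d) (R : realType) (P : probability T R)
    (f g : T -> R) : bmeas f -> bmeas g ->
  \int[P]_x (f x + g x) = \int[P]_x f x + \int[P]_x g x.
Proof. by move=> bf bg; rewrite RintegralD//; exact: bmeas_int. Qed.

Lemma rintB d (T : measurableType d) (R : realType) (P : probability T R)
    (f g : T -> R) : bmeas f -> bmeas g ->
  \int[P]_x (f x - g x) = \int[P]_x f x - \int[P]_x g x.
Proof. by move=> bf bg; rewrite RintegralB//; exact: bmeas_int. Qed.

Lemma rintZ d (T : measurableType d) (R : realType) (P : probability T R)
    (c : R) (f : T -> R) : bmeas f -> \int[P]_x (c * f x) = c * \int[P]_x f x.
Proof. by move=> bf; rewrite RintegralZl//; exact: bmeas_int. Qed.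

Lemma rintN d (T : measurableType d) (R : realType) (P : probability T R)
    (f : T -> R) : bmeas f -> \int[P]_x (- f x) = - \int[P]_x f x.
Proof.
move=> bf; rewrite -mulN1r -rintZ//.
by apply: eq_Rintegral => x _; rewrite mulN1r.
Qed.

Lemma rint_cst d (T : measurableType d) (R : realType) (P : probability T R)
    (c : R) : \int[P]_x c = c.
Proof. by rewrite Rintegral_cst// [X in fine X](@probability_setT _ _ _ P) mulr1. Qed.

Lemma rint_le d (T : measurableType d) (R : realType) (P : probability T R)
    (f g : T -> R) : bmeas f -> bmeas g -> (forall x, f x <= g x) ->
  \int[P]_x f x <= \int[P]_x g x.
Proof. by move=> bf bg fg; apply: le_Rintegral => //; exact: bmeas_int. Qed.

Lemma rint_abs d (T : measurableType d) (R : realType) (P : probability T R)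
    (f : T -> R) : bmeas f -> `|\int[P]_x f x| <= \int[P]_x `|f x|.
Proof. by move=> bf; apply: le_normr_Rintegral => //; exact: bmeas_int. Qed.

Lemma rint_bound d (T : measurableType d) (R : realType) (P : probability T R)
    (f : T -> R) M : bmeas f -> (forall x, f x <= M) -> \int[P]_x f x <= M.
Proof.
by move=> bf fM; rewrite -[leRHS](rint_cst P) rint_le//; exact: bmeas_cst.
Qed.

Lemma rint_indic d (T : measurableType d) (R : realType) (P : probability T R)
    (A : set T) : measurable A -> \int[P]_x \1_A x = fine (P A).
Proof. by move=> mA; rewrite /Rintegral integral_indic// setIT. Qed.

Lemma EFin_rint d (T : measurableType d) (R : realType) (P : probability T R)
    (f : T -> R) : bmeas f -> (\int[P]_x f x)%:E = (\int[P]_x (f x)%:E)%E.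
Proof. by move=> bf; rewrite fineK//; exact/integrable_fin_num/bmeas_int. Qed.

Lemma rint_dominated d (T : measurableType d) (R : realType)
    (P : probability T R) (f_ : nat -> T -> R) (f : T -> R) (M : R) :
  (forall n, measurable_fun setT (f_ n)) -> measurable_fun setT f ->
  (forall n x, `|f_ n x| <= M) -> (\forall x \ae P, f_ n x @[n --> \oo] --> f x) ->
  \int[P]_x f_ n x @[n --> \oo] --> \int[P]_x f x.
Proof.
move=> mf_ mf fM cf.
have [||||| i1 _ i2] := @dominated_convergence _ T R P setT measurableT
  (fun n => EFin \o f_ n) (EFin \o f) (cst M%:E).
- by move=> n; apply/measurable_EFinP.
- exact/measurable_EFinP.
- by apply: filterS cf => x cx _; apply: cvg_EFin => //; exact: nearW.
- by apply: finite_measure_integrable_cst.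
- by apply: aeW => x n _ /=; rewrite lee_fin.
apply: fine_cvg; rewrite fineK//; exact: integrable_fin_num.
Qed.

(** * Bounded complex-valued integrands *)

Definition bmeasC d (T : measurableType d) (R : realType) (f : T -> R[i]) :=
  bmeas (fun x => complex.Re (f x)) /\ bmeas (fun x => complex.Im (f x)).

Lemma bmeasC_cst d (T : measurableType d) (R : realType) (c : R[i]) :
  bmeasC (fun _ : T => c).
Proof. by split; exact: bmeas_cst. Qed.

Lemma bmeasCD d (T : measurableType d) (R : realType) (f g : T -> R[i]) :
  bmeasC f -> bmeasC g -> bmeasC (fun x => f x + g x).
Proof.
move=> [? ?] [? ?]; split; under [X in bmeas X]eq_fun do rewrite reimE.
  exact: bmeasD.
exact: bmeasD.
Qed.

Lemma bmeasCN d (T : measurableType d) (R : realType) (f : T -> R[i]) :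
  bmeasC f -> bmeasC (fun x => - f x).
Proof.
move=> [? ?]; split; under [X in bmeas X]eq_fun do rewrite reimE.
  exact: bmeasN.
exact: bmeasN.
Qed.

Lemma bmeasCB d (T : measurableType d) (R : realType) (f g : T -> R[i]) :
  bmeasC f -> bmeasC g -> bmeasC (fun x => f x - g x).
Proof. by move=> bf bg; apply: bmeasCD => //; exact: bmeasCN. Qed.

Lemma bmeasCM d (T : measurableType d) (R : realType) (f g : T -> R[i]) :
  bmeasC f -> bmeasC g -> bmeasC (fun x => f x * g x).
Proof.
move=> [? ?] [? ?]; split; under [X in bmeas X]eq_fun do rewrite reimE.
  by apply: bmeasB; exact: bmeasM.
by apply: bmeasD; exact: bmeasM.
Qed.

Lemma bmeasCJ d (T : measurableType d) (R : realType) (f : T -> R[i]) :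
  bmeasC f -> bmeasC (fun x => (f x)^*%C).
Proof.
move=> [? ?]; split; under [X in bmeas X]eq_fun do rewrite reimE.
  by [].
exact: bmeasN.
Qed.

Lemma bmeasC_real d (T : measurableType d) (R : realType) (f : T -> R) :
  bmeas f -> bmeasC (fun x => (f x)%:C).
Proof. by split => //=; exact: bmeas_cst. Qed.

Lemma bmeasCX d (T : measurableType d) (R : realType) (f : T -> R[i]) n :
  bmeasC f -> bmeasC (fun x => f x ^+ n).
Proof.
move=> bf; elim: n => [|n IH]; first exact: bmeasC_cst.
by under [X in bmeasC X]eq_fun do rewrite exprS; exact: bmeasCM.
Qed.

Lemma bmeasC_sum d (T : measurableType d) (R : realType) (I : Type) (r : seq I)
    (f : I -> T -> R[i]) :
  (forall i, bmeasC (f i)) -> bmeasC (fun x => \sum_(i <- r) f i x).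
Proof.
move=> bf; elim: r => [|i r IH].
  by under [X in bmeasC X]eq_fun do rewrite big_nil; exact: bmeasC_cst.
by under [X in bmeasC X]eq_fun do rewrite big_cons; exact: bmeasCD.
Qed.

Lemma bmeas_sqr_cmod d (T : measurableType d) (R : realType) (f : T -> R[i]) :
  bmeasC f -> bmeas (fun x => cmod (f x) ^+ 2).
Proof.
move=> [? ?]; under [X in bmeas X]eq_fun do rewrite sqr_cmod.
by apply: bmeasD; exact: bmeasX.
Qed.

Lemma bmeas_cmod d (T : measurableType d) (R : realType) (f : T -> R[i]) :
  bmeasC f -> bmeas (fun x => cmod (f x)).
Proof.
move=> [[mr [M rM]] [mi [N iN]]]; split.
  apply: (measurableT_comp (f := @Num.sqrt R)).
    by apply: continuous_measurable_fun => x; exact: sqrt_continuous.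
  by apply: measurable_funD; exact: measurable_funX.
exists (M + N) => x; rewrite ger0_norm ?cmod_ge0//.
by rewrite (le_trans (cmod_le_reim _))// lerD.
Qed.

Lemma bmeasC_inv d (T : measurableType d) (R : realType) (f : T -> R[i])
    (c : R) : 0 < c -> (forall x, c <= cmod (f x)) -> bmeasC f ->
  bmeasC (fun x => (f x)^-1).
Proof.
move=> c0 cf bf; have bi : bmeas (fun x => (cmod (f x) ^+ 2)^-1).
  apply: (@bmeas_inv _ _ _ _ (c ^+ 2)); first by rewrite exprn_gt0.
    by move=> x; rewrite ler_pXn2r ?nnegrE ?cmod_ge0 ?(ltW c0).
  by have [] := bmeas_sqr_cmod bf.
split; under [X in bmeas X]eq_fun do rewrite reimE.
  by apply: bmeasM => //; case: bf.
by apply: bmeasN; apply: bmeasM => //; case: bf.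
Qed.

Lemma cintD d (T : measurableType d) (R : realType) (P : probability T R)
    (f g : T -> R[i]) : bmeasC f -> bmeasC g ->
  cintegral P (fun x => f x + g x) = cintegral P f + cintegral P g.
Proof.
move=> [? ?] [? ?]; apply: eq_reim; rewrite /cintegral/= -rintD//;
  by apply: eq_Rintegral => x _; rewrite reimE.
Qed.

Lemma cintZ d (T : measurableType d) (R : realType) (P : probability T R)
    (c : R[i]) (f : T -> R[i]) : bmeasC f ->
  cintegral P (fun x => c * f x) = c * cintegral P f.
Proof.
move=> [? ?]; have h (a : R) (g : T -> R) : bmeas g -> bmeas (fun x => a * g x).
  by move=> bg; apply: bmeasM => //; exact: bmeas_cst.
apply: eq_reim; rewrite reimE /cintegral/= -!rintZ// -?rintB -?rintD//;
  do ?[exact: h]; by apply: eq_Rintegral => x _; rewrite reimE.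
Qed.

Lemma cint_cst d (T : measurableType d) (R : realType) (P : probability T R)
    (c : R[i]) : cintegral P (fun=> c) = c.
Proof. by apply: eq_reim; rewrite /cintegral/= rint_cst. Qed.

Lemma cintB d (T : measurableType d) (R : realType) (P : probability T R)
    (f g : T -> R[i]) : bmeasC f -> bmeasC g ->
  cintegral P (fun x => f x - g x) = cintegral P f - cintegral P g.
Proof.
move=> bf bg; rewrite -mulN1r -cintZ// -cintD//; last first.
  by apply: bmeasCM => //; exact: bmeasC_cst.
by congr cintegral; apply/funext => x; rewrite mulN1r.
Qed.

Lemma cintJ d (T : measurableType d) (R : realType) (P : probability T R)
    (f : T -> R[i]) : bmeasC f ->
  cintegral P (fun x => (f x)^*%C) = (cintegral P f)^*%C.
Proof.
move=> [? ?]; apply: eq_reim; rewrite reimE /cintegral/= -?rintN//;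
  by apply: eq_Rintegral => x _; rewrite reimE.
Qed.

Lemma cint_real d (T : measurableType d) (R : realType) (P : probability T R)
    (f : T -> R) : cintegral P (fun x => (f x)%:C) = (\int[P]_x f x)%:C.
Proof. by apply: eq_reim; rewrite /cintegral/= ?rint_cst. Qed.

Lemma cint_sum d (T : measurableType d) (R : realType) (P : probability T R)
    (I : Type) (r : seq I) (f : I -> T -> R[i]) : (forall i, bmeasC (f i)) ->
  cintegral P (fun x => \sum_(i <- r) f i x) = \sum_(i <- r) cintegral P (f i).
Proof.
move=> bf; elim: r => [|i r IH].
  rewrite big_nil -[RHS](cint_cst P); congr cintegral.
  by apply/funext => x; rewrite big_nil.
rewrite big_cons -IH -cintD//; last exact: bmeasC_sum.
by congr cintegral; apply/funext => x; rewrite big_cons.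
Qed.

(** Multiplying f by the conjugate of its integral w turns |w|^2 into the integral of a real part,
    which is at most the integral of |w| |f|; dividing by |w| gives the bound. *)
Lemma cint_cmod_le d (T : measurableType d) (R : realType)
    (P : probability T R) (f : T -> R[i]) : bmeasC f ->
  cmod (cintegral P f) <= \int[P]_x cmod (f x).
Proof.
move=> bf; set w := cintegral P f.
have [->|w0] := eqVneq w 0.
  by rewrite cmod0; apply: Rintegral_ge0 => x _; exact: cmod_ge0.
have cw : 0 < cmod w by rewrite cmod_gt0.
rewrite -(ler_pM2l cw) -expr2 -(_ : complex.Re (w^*%C * w) = cmod w ^+ 2); last first.
  by rewrite mulrC mulJc.
rewrite /w -cintZ// -/w -rintZ; last exact: bmeas_cmod.
have bg : bmeasC (fun x => w^*%C * f x) by apply: bmeasCM => //; exact: bmeasC_cst.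
apply: rint_le; first by case: bg.
  by apply: bmeasM; [exact: bmeas_cst|exact: bmeas_cmod].
move=> x; rewrite -(cmodJ w) -cmodM.
exact: le_trans (ler_norm _) (Re_le_cmod _).
Qed.

Lemma cint_cmod_bound d (T : measurableType d) (R : realType)
    (P : probability T R) (f : T -> R[i]) M : bmeasC f ->
  (forall x, cmod (f x) <= M) -> cmod (cintegral P f) <= M.
Proof.
move=> bf fM; rewrite (le_trans (cint_cmod_le _ bf))// rint_bound//.
exact: bmeas_cmod.
Qed.

(** * The unit circle and its Lebesgue measure *)

Lemma circle_nbhsP (R : realType) (xi : circle R) (A : set (circle R)) :
  nbhs xi A <-> exists2 e : R, 0 < e &
    forall zeta : circle R, cmod ((zeta : R[i]) - (xi : R[i])) < e -> A zeta.
Proof.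
split.
  move=> [U [[V oV VU] Uxi UA]].
  have : nbhs (xi : R[i]) V by apply: open_nbhs_nbhs; split => //; rewrite -VU in Uxi.
  move=> /nbhs_cmodP[e e0 eV]; exists e => // zeta h; apply: UA.
  by rewrite -VU; exact: eV.
move=> [e e0 eA].
have : nbhs (xi : R[i]) [set z | cmod (z - (xi : R[i])) < e].
  by apply/nbhs_cmodP; exists e.
move/(@initial_continuous _ _ (@set_val _ _) xi) => h.
have {}h : nbhs xi
  [set zeta : circle R | cmod ((zeta : R[i]) - (xi : R[i])) < e] := h.
by apply: filterS h => zeta /= /eA.
Qed.

Lemma circle_continuous (R : realType) (f : circle R -> R) :
  (forall (x : circle R) (e : R), 0 < e -> exists2 d : R, 0 < d & forall y : circle R,
    cmod ((y : R[i]) - (x : R[i])) < d -> `|f y - f x| < e) -> continuous f.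
Proof.
move=> h x A /nbhs_ballP[e /= e0 eA]; apply/circle_nbhsP.
have [d d0 dh] := h x e e0; exists d => // y /dh yd; apply: eA.
by rewrite /ball/= distrC.
Qed.

Lemma measurable_circle_open (R : realType) (U : set (circle R)) :
  open U -> measurable U.
Proof. by move=> oU; exact: sub_sigma_algebra. Qed.

Lemma measurable_circle_continuous (R : realType) (f : circle R -> R) :
  continuous f -> measurable_fun setT f.
Proof.
move=> cf; apply: (measurability _ (RGenOInfty.measurableE R)) => //.
move=> _ [_ [x ->] <-]; rewrite setTI; apply: measurable_circle_open.
by apply: open_comp => [t _|]; [exact: cf|exact: interval_open].
Qed.

Lemma bmeasC_circle (R : realType) :
  bmeasC (fun zeta : circle R => (zeta : R[i])).
Proof.
split; split.
- apply: measurable_circle_continuous; apply: circle_continuous => x e e0.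
  exists e => // y; apply: le_lt_trans.
  by rewrite -ReN -ReD Re_le_cmod.
- by exists 1 => x; rewrite (le_trans (Re_le_cmod _))// cmod_circle.
- apply: measurable_circle_continuous; apply: circle_continuous => x e e0.
  exists e => // y; apply: le_lt_trans.
  by rewrite -ImN -ImD Im_le_cmod.
- by exists 1 => x; rewrite (le_trans (Im_le_cmod _))// cmod_circle.
Qed.

Lemma hausdorff_circle (R : realType) : hausdorff_space (circle R).
Proof.
move=> x y; apply: contraPP => xy.
have xy0 : 0 < cmod (circle_val x - circle_val y) / 2.
  by rewrite divr_gt0// cmod_gt0 subr_eq0; apply/eqP => /val_inj.
set e := _ / 2 in xy0; move=> /(_ [set z : circle R | cmod (circle_val z - circle_val x) < e]
  [set z : circle R | cmod (circle_val z - circle_val y) < e]).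
case; [by apply/circle_nbhsP; exists e|by apply/circle_nbhsP; exists e|].
move=> z /= [zx zy]; have := cmodB (circle_val z - circle_val y) (circle_val z - circle_val x).
rewrite (_ : _ - _ - _ = circle_val x - circle_val y); last by ring.
by rewrite leNgt => /negP; apply; rewrite /e in zx zy *; lra.
Qed.

Lemma compact_circle_dist (R : realType) (C : set (circle R)) (xi : circle R) :
  compact C -> ~ C xi -> exists2 e : R, 0 < e &
    forall zeta : circle R, C zeta -> e <= cmod ((zeta : R[i]) - (xi : R[i])).
Proof.
move=> /(compact_closed (@hausdorff_circle R)) cC Cxi.
have /circle_nbhsP[e e0 eC] : nbhs xi (~` C).
  by apply: open_nbhs_nbhs; split => //; rewrite openC.
exists e => // zeta Czeta; rewrite leNgt; apply/negP => /eC.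
exact.
Qed.

Lemma compact_circle_measurable (R : realType) (C : set (circle R)) :
  compact C -> measurable C.
Proof.
move=> /(compact_closed (@hausdorff_circle R)) cC.
rewrite -(setCK C); apply: measurableC; apply: measurable_circle_open.
by rewrite openC.
Qed.

Lemma integral_circleE (R : realType) (f : circle R -> \bar R) :
  measurable_fun setT f -> (forall x, 0 <= f x)%E ->
  (\int[circle_lebesgue R]_x f x = ((2 * pi)^-1)%:E *
    \int[lebesgue_measure]_(t in `[0%R, (2 * pi)%R]) f (@circle_expi R t))%E.
Proof.
move=> mf f0; rewrite /circle_lebesgue ge0_integral_distribution//.
rewrite integral_uniform ?subr0//.
  by apply: measurableT_comp => //; exact: measurable_circle_expi.
by move=> x; exact: f0.
Qed.

Lemma circle_expiX (R : realType) (t : R) n :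
  (circle_expi t : R[i]) ^+ n = cos (t *+ n) +i* sin (t *+ n).
Proof.
elim: n => [|n IH]; first by rewrite mulr0n cos0 sin0.
rewrite exprS IH mulrS cosD sinD; apply: eq_reim; rewrite reimE/=; ring.
Qed.

Lemma continuous_natmul (R : realType) n : continuous (fun t : R => t *+ n).
Proof.
rewrite (_ : (fun t : R => t *+ n) = (fun t : R => t * n%:R)).
  by move=> t; apply: cvgMl; exact: cvg_id.
by apply/funext => t; rewrite mulr_natr.
Qed.

(** The summand 1 keeps the integrand nonnegative, as the change of variables [integral_circleE]
    requires; [circle_moment] takes it away again. *)
Lemma integral_1cos (R : realType) n : (0 < n)%N ->
  (\int[lebesgue_measure]_(t in `[0%R, (2 * pi : R)%R]) (1 + cos (t *+ n))%:E =
   (2 * pi)%:E)%E.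
Proof.
move=> n0; have n0' : n%:R != 0 :> R by rewrite pnatr_eq0 -lt0n.
pose F (t : R) : R := t + sin (t * n%:R) / n%:R.
have dF (t : R) : is_derive t 1 F (1 + cos (t *+ n)).
  rewrite /F; apply: is_derive_eq.
  by rewrite /GRing.scale/= !mulr0 -(mulr_natr t); field.
have cF : continuous F.
  by move=> t; apply: differentiable_continuous; apply/derivable1_diffP.
rewrite (@continuous_FTC2 _ _ F)//; last 4 first.
- exact: pi2_gt0.
- apply: continuous_subspaceT => t; apply: continuousD; first exact: cvg_cst.
  apply: continuous_comp; last exact: continuous_cos.
  exact: continuous_natmul.
- split => //.
  + exact/cvg_at_right_filter/cF.
  + exact/cvg_at_left_filter/cF.
- by move=> t _; rewrite derive1E; apply: derive_val.
rewrite /F mul0r sin0 mul0r addr0 sube0 (mulr_natr (2 * pi)).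
suff -> : sin ((2 * pi : R) *+ n) = 0 by rewrite mul0r addr0.
elim: n {n0 n0' F dF cF} => [|n IH]; first by rewrite mulr0n sin0.
by rewrite mulrS addrC [X in _ + X]mulr_natl sinD2pi.
Qed.

Lemma integral_1sin (R : realType) n : (0 < n)%N ->
  (\int[lebesgue_measure]_(t in `[0%R, (2 * pi : R)%R]) (1 + sin (t *+ n))%:E =
   (2 * pi)%:E)%E.
Proof.
move=> n0; have n0' : n%:R != 0 :> R by rewrite pnatr_eq0 -lt0n.
pose F (t : R) : R := t - cos (t * n%:R) / n%:R.
have dF (t : R) : is_derive t 1 F (1 + sin (t *+ n)).
  rewrite /F; apply: is_derive_eq.
  by rewrite /GRing.scale/= !mulr0 -(mulr_natr t); field.
have cF : continuous F.
  by move=> t; apply: differentiable_continuous; apply/derivable1_diffP.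
rewrite (@continuous_FTC2 _ _ F)//; last 4 first.
- exact: pi2_gt0.
- apply: continuous_subspaceT => t; apply: continuousD; first exact: cvg_cst.
  apply: continuous_comp; last exact: continuous_sin.
  exact: continuous_natmul.
- split => //.
  + exact/cvg_at_right_filter/cF.
  + exact/cvg_at_left_filter/cF.
- by move=> t _; rewrite derive1E; apply: derive_val.
rewrite /F mul0r cos0 (mulr_natr (2 * pi)).
suff -> : cos ((2 * pi : R) *+ n) = 1 by rewrite -EFinB; congr EFin; field.
elim: n {n0 n0' F dF cF} => [|n IH]; first by rewrite mulr0n cos0.
by rewrite mulrS addrC [X in _ + X]mulr_natl cosD2pi.
Qed.

Lemma circle_moment (R : realType) n : (0 < n)%N ->
  cintegral (circle_lebesgue R) (fun xi : circle R => (xi : R[i]) ^+ n) = 0.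
Proof.
move=> n0; have [b1 b2] := bmeasCX n (@bmeasC_circle R).
suff h (f : circle R -> R) (g : R -> R) : bmeas f -> (forall x, `|f x| <= 1) ->
    (forall t, f (circle_expi t) = g (t *+ n)) ->
    (\int[lebesgue_measure]_(t in `[0%R, (2 * pi : R)%R]) (1 + g (t *+ n))%:E =
     (2 * pi)%:E)%E -> \int[circle_lebesgue R]_x f x = 0.
  have n1 (xi : circle R) : cmod ((xi : R[i]) ^+ n) <= 1.
    by rewrite cmodX cmod_circle expr1n.
  apply: eq_reim; rewrite /cintegral/=.
    apply: (h _ cos) => //; last exact: integral_1cos.
      by move=> x; exact: le_trans (Re_le_cmod _) (n1 _).
    by move=> t; rewrite circle_expiX.
  apply: (h _ sin) => //; last exact: integral_1sin.
    by move=> x; exact: le_trans (Im_le_cmod _) (n1 _).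
  by move=> t; rewrite circle_expiX.
move=> bf f1 fg ig; apply: (addrI 1).
rewrite addr0 -[X in X + _](rint_cst (circle_lebesgue R)) -rintD//; last exact: bmeas_cst.
rewrite /Rintegral integral_circleE.
- under eq_integral do rewrite fg.
  by rewrite ig/= mulVf// gt_eqF// pi2_gt0.
- apply/measurable_EFinP; apply: measurable_funD => //; by case: bf.
- move=> x; rewrite lee_fin; have := f1 x; rewrite ler_norml => /andP[h _].
  by lra.
Qed.

(** * Cauchy transforms *)

Lemma expr_small (R : realType) (s e : R) : 0 <= s -> s < 1 -> 0 < e ->
  exists N, s ^+ N < e.
Proof.
move=> s0 s1 e0; have /cvgrPdist_lt/(_ e e0) : (s ^+ n) @[n --> \oo] --> (0 : R).
  by apply: cvg_expr; rewrite ger0_norm.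
move=> [N _ /(_ N (leqnn _))]/=; rewrite sub0r normrN ger0_norm ?exprn_ge0//.
by exists N.
Qed.

Lemma le0_expr (R : realType) (x s B : R) : 0 <= s -> s < 1 ->
  (forall k, x <= s ^+ k * B) -> x <= 0.
Proof.
move=> s0 s1 h; rewrite leNgt; apply/negP => x0.
have B0 : 0 < B by have := lt_le_trans x0 (h 0%N); rewrite expr0 mul1r.
have [N] := expr_small s0 s1 (divr_gt0 x0 B0).
by rewrite ltr_pdivlMr// ltNge h.
Qed.

Lemma circle_kernel_ge (R : realType) (z : R[i]) (zeta : circle R) :
  `|1 - cmod z| <= cmod (1 - (zeta : R[i])^*%C * z).
Proof.
have h : cmod ((zeta : R[i])^*%C * z) = cmod z.
  by rewrite cmodM cmodJ cmod_circle mul1r.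
rewrite ler_norml; apply/andP; split.
  by rewrite lerNl opprB -{1}h -(cmod1 R) cmodC cmod_dist.
by rewrite -{1}h -(cmod1 R) cmod_dist.
Qed.

Lemma circle_kernel_neq0 (R : realType) (z : R[i]) (zeta : circle R) :
  cmod z != 1 -> 1 - (zeta : R[i])^*%C * z != 0.
Proof.
move=> z1; rewrite -cmod_gt0; apply: lt_le_trans (circle_kernel_ge _ _).
by rewrite normr_gt0 subr_eq0 eq_sym.
Qed.

Lemma bmeasC_kernel (R : realType) (z : R[i]) : cmod z != 1 ->
  bmeasC (fun zeta : circle R => (1 - (zeta : R[i])^*%C * z)^-1).
Proof.
move=> z1; apply: (@bmeasC_inv _ _ _ _ `|1 - cmod z|).
- by rewrite normr_gt0 subr_eq0 eq_sym.
- by move=> x; exact: circle_kernel_ge.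
- apply: bmeasCB; first exact: bmeasC_cst.
  by apply: bmeasCM; [apply: bmeasCJ; exact: bmeasC_circle|exact: bmeasC_cst].
Qed.

Lemma bmeasC_cauchy (R : realType) (f : circle R -> R[i]) (z : R[i]) :
  bmeasC f -> cmod z != 1 ->
  bmeasC (fun zeta : circle R => f zeta / (1 - (zeta : R[i])^*%C * z)).
Proof. by move=> bf z1; apply: bmeasCM => //; exact: bmeasC_kernel. Qed.

Lemma bmeasC_conj (R : realType) :
  bmeasC (fun zeta : circle R => (zeta : R[i])^*%C).
Proof. by apply: bmeasCJ; exact: bmeasC_circle. Qed.

(** The geometric series one term at a time: 1 / (1 - w) = 1 + w / (1 - w) with w = conj(zeta) z.
    Iterated, it yields a Taylor polynomial with an exact remainder. *)
Lemma cauchy_step (R : realType) (P : probability (circle R) R)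
    (f : circle R -> R[i]) (z : R[i]) : bmeasC f -> cmod z != 1 ->
  cauchy_transform P f z = cintegral P f +
    z * cauchy_transform P (fun zeta => (zeta : R[i])^*%C * f zeta) z.
Proof.
move=> bf z1; have bf' : bmeasC (fun zeta : circle R => (zeta : R[i])^*%C * f zeta).
  by apply: bmeasCM => //; exact: bmeasC_conj.
rewrite /cauchy_transform -cintZ; last exact: bmeasC_cauchy.
rewrite -cintD//; last first.
  by apply: bmeasCM; [exact: bmeasC_cst|exact: bmeasC_cauchy].
congr cintegral; apply/funext => zeta.
by have := circle_kernel_neq0 zeta z1 => k0; field.
Qed.

Lemma cauchy_bound (R : realType) (P : probability (circle R) R)
    (f : circle R -> R[i]) (z : R[i]) M : bmeasC f -> cmod z < 1 ->
  (forall x, cmod (f x) <= M) -> cmod (cauchy_transform P f z) <= M / (1 - cmod z).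
Proof.
move=> bf z1 fM; apply: cint_cmod_bound.
  by apply: bmeasC_cauchy => //; rewrite lt_eqF.
move=> x; rewrite cmodM cmodV ler_pM ?invr_ge0 ?cmod_ge0//.
have z1' : 0 < 1 - cmod z by rewrite subr_gt0.
have := circle_kernel_ge z x; rewrite ger0_norm ?(ltW z1')// => h.
by rewrite lef_pV2 ?posrE//; exact: lt_le_trans h.
Qed.

Lemma cauchy_iter (R : realType) (P : probability (circle R) R) N
    (f : circle R -> R[i]) : bmeasC f ->
  exists p : {poly R[i]}, forall z, cmod z != 1 ->
    cauchy_transform P f z = p.[z] + z ^+ N *
      cauchy_transform P (fun zeta => (zeta : R[i])^*%C ^+ N * f zeta) z.
Proof.
elim: N f => [|N IH] f bf.
  exists 0 => z _; rewrite horner0 add0r expr0 mul1r; congr cauchy_transform.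
  by apply/funext => x; rewrite expr0 mul1r.
have bf' : bmeasC (fun zeta : circle R => (zeta : R[i])^*%C * f zeta).
  by apply: bmeasCM => //; exact: bmeasC_conj.
have [p hp] := IH _ bf'; exists ((cintegral P f)%:P + 'X * p) => z z1.
have E : (fun zeta : circle R => (zeta : R[i])^*%C ^+ N.+1 * f zeta) =
    fun zeta : circle R => (zeta : R[i])^*%C ^+ N * ((zeta : R[i])^*%C * f zeta).
  by apply/funext => x; rewrite exprSr mulrA.
by rewrite cauchy_step// hp// !hornerE -addrA mulrDr mulrA -exprS E.
Qed.

Lemma circle_moment_conj (R : realType) n : (0 < n)%N ->
  cintegral (circle_lebesgue R) (fun xi : circle R => (xi : R[i])^*%C ^+ n) = 0.
Proof.
move=> n0; rewrite -(conjc0 R) -(circle_moment R n0) -cintJ; last first.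
  by apply: bmeasCX; exact: bmeasC_circle.
by congr cintegral; apply/funext => x; rewrite rmorphXn.
Qed.

(* The moments vanish, so iterating [cauchy_step] makes the transform divisible by
   every power of z. *)
Lemma cauchy_conj_pow (R : realType) n (z : R[i]) : cmod z < 1 -> (0 < n)%N ->
  cauchy_transform (circle_lebesgue R)
    (fun xi : circle R => (xi : R[i])^*%C ^+ n) z = 0.
Proof.
move=> z1 n0; have z1' : cmod z != 1 by rewrite lt_eqF.
set m := circle_lebesgue R.
have bc k : bmeasC (fun xi : circle R => (xi : R[i])^*%C ^+ k).
  by apply: bmeasCX; exact: bmeasC_conj.
have h k : cauchy_transform m (fun xi : circle R => (xi : R[i])^*%C ^+ n) z =
    z ^+ k * cauchy_transform m (fun xi : circle R => (xi : R[i])^*%C ^+ (n + k)) z.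
  elim: k => [|k ->]; first by rewrite addn0 expr0 mul1r.
  rewrite cauchy_step// circle_moment_conj ?addn_gt0 ?n0// add0r mulrA -exprSr.
  rewrite addnS; suff -> : (fun xi : circle R => (xi : R[i])^*%C ^+ (n + k).+1) =
    fun xi : circle R => (xi : R[i])^*%C * (xi : R[i])^*%C ^+ (n + k) by [].
  by apply/funext => x; rewrite exprS.
apply/eqP; rewrite -cmod_eq0 eq_le cmod_ge0 andbT.
apply: (@le0_expr _ _ (cmod z) (1 - cmod z)^-1) => // [|k]; first exact: cmod_ge0.
rewrite (h k) cmodM cmodX ler_wpM2l ?exprn_ge0 ?cmod_ge0//.
rewrite -[leRHS]mul1r; apply: cauchy_bound => // x.
by rewrite cmodX cmodJ cmod_circle expr1n.
Qed.

Lemma cauchy_conj_powE (R : realType) n (z : R[i]) : cmod z < 1 ->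
  cauchy_transform (circle_lebesgue R)
    (fun xi : circle R => (xi : R[i])^*%C ^+ n) z =
  cintegral (circle_lebesgue R) (fun xi : circle R => (xi : R[i])^*%C ^+ n).
Proof.
move=> z1; have z1' : cmod z != 1 by rewrite lt_eqF.
rewrite cauchy_step//; last by apply: bmeasCX; exact: bmeasC_conj.
under [X in cauchy_transform _ X _]eq_fun do rewrite -exprS.
by rewrite cauchy_conj_pow// mulr0 addr0.
Qed.

(** Each step produces a factor z and lowers the exponent by one, because conj(zeta) zeta = 1; the
    moment that splits off is zero. *)
Lemma cauchy_pow (R : realType) n (z : R[i]) : cmod z < 1 ->
  cauchy_transform (circle_lebesgue R)
    (fun xi : circle R => (xi : R[i]) ^+ n) z = z ^+ n.
Proof.
move=> z1; have z1' : cmod z != 1 by rewrite lt_eqF.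
elim: n => [|n IH].
  have := cauchy_conj_powE 0 z1.
  under [X in cauchy_transform _ X _]eq_fun do rewrite expr0.
  under [X in cintegral _ X]eq_fun do rewrite expr0.
  by rewrite cint_cst expr0.
rewrite cauchy_step//; last by apply: bmeasCX; exact: bmeasC_circle.
rewrite circle_moment// add0r exprS -IH.
suff -> : (fun xi : circle R => (xi : R[i])^*%C * (xi : R[i]) ^+ n.+1) =
  fun xi : circle R => (xi : R[i]) ^+ n by [].
by apply/funext => x; rewrite exprS mulrA (mulrC _^*%C) conj_circle mul1r.
Qed.

(** * Holomorphic functions as limits of polynomials *)

Definition poly_approx (R : realType) (s : R) (u : R[i] -> R[i]) :=
  forall e : R, 0 < e -> exists p : {poly R[i]},
    forall z, cmod z <= s -> cmod (u z - p.[z]) <= e.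

Lemma poly_approx_lim (R : realType) (s : R) (u : R[i] -> R[i]) :
  (forall e : R, 0 < e -> exists2 v, poly_approx s v &
    forall z, cmod z <= s -> cmod (u z - v z) <= e) -> poly_approx s u.
Proof.
move=> h e e0; have e20 : 0 < e / 2 by rewrite divr_gt0.
have [v av uv] := h _ e20; have [p vp] := av _ e20; exists p => z zs.
rewrite (_ : _ - _ = (u z - v z) + (v z - p.[z])); last by ring.
rewrite (le_trans (cmodD _ _))// [e]splitr lerD//; [exact: uv|exact: vp].
Qed.

Lemma poly_approx_cst (R : realType) (s : R) (c : R[i]) :
  poly_approx s (fun=> c).
Proof.
by move=> e e0; exists c%:P => z _; rewrite hornerC subrr cmod0 ltW.
Qed.

Lemma poly_bound (R : realType) (s : R) (p : {poly R[i]}) :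
  exists2 B : R, 0 < B & forall z, cmod z <= s -> cmod p.[z] <= B.
Proof.
elim/poly_ind: p => [|p c [B B0 pB]].
  by exists 1 => // z _; rewrite horner0 cmod0.
exists (B * Num.max s 0 + cmod c + 1).
  by rewrite ltr_wpDl// addr_ge0 ?cmod_ge0// mulr_ge0 ?(ltW B0)// le_max lexx orbT.
move=> z zs; rewrite hornerMXaddC (le_trans (cmodD _ _))//.
rewrite -[leLHS]addr0 lerD// lerD2r cmodM ler_pM ?cmod_ge0//; first exact: pB.
by rewrite le_max zs.
Qed.

Lemma poly_approx_bound (R : realType) (s : R) (u : R[i] -> R[i]) :
  poly_approx s u ->
  exists2 B : R, 0 < B & forall z, cmod z <= s -> cmod (u z) <= B.
Proof.
move=> /(_ 1 ltr01)[p up]; have [B B0 pB] := poly_bound s p.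
exists (1 + B); first by rewrite addr_gt0.
move=> z zs; rewrite -(subrK p.[z] (u z)) (le_trans (cmodD _ _))//.
by rewrite lerD ?up ?pB.
Qed.

Lemma poly_approxD (R : realType) (s : R) (u v : R[i] -> R[i]) :
  poly_approx s u -> poly_approx s v -> poly_approx s (fun z => u z + v z).
Proof.
move=> au av e e0; have e20 : 0 < e / 2 by rewrite divr_gt0.
have [p up] := au _ e20; have [q vq] := av _ e20; exists (p + q) => z zs.
rewrite hornerD opprD addrACA (le_trans (cmodD _ _))// [e]splitr.
by rewrite lerD ?up ?vq.
Qed.

Lemma poly_approxM (R : realType) (s : R) (u v : R[i] -> R[i]) :
  poly_approx s u -> poly_approx s v -> poly_approx s (fun z => u z * v z).
Proof.
move=> au av e e0; have [B B0 uB] := poly_approx_bound au.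
have [q vq] : exists q : {poly R[i]},
    forall z, cmod z <= s -> cmod (v z - q.[z]) <= e / 2 / B.
  by apply: av; rewrite !divr_gt0.
have [D D0 qD] := poly_bound s q.
(* q is fixed before p: the error allowed for u is measured against the bound D of q. *)
have [p up] : exists p : {poly R[i]},
    forall z, cmod z <= s -> cmod (u z - p.[z]) <= e / 2 / D.
  by apply: au; rewrite !divr_gt0.
exists (p * q) => z zs; rewrite hornerM.
rewrite (_ : _ - _ = u z * (v z - q.[z]) + (u z - p.[z]) * q.[z]); last by ring.
rewrite (le_trans (cmodD _ _))// !cmodM [e]splitr lerD//.
  rewrite -[leRHS](@divfK _ B) ?gt_eqF// mulrC.
  by rewrite ler_pM ?cmod_ge0 ?vq ?uB.
rewrite -[leRHS](@divfK _ D) ?gt_eqF//.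
by rewrite ler_pM ?cmod_ge0 ?up ?qD.
Qed.

Lemma poly_approxN (R : realType) (s : R) (u : R[i] -> R[i]) :
  poly_approx s u -> poly_approx s (fun z => - u z).
Proof.
move=> au; under [X in poly_approx _ X]eq_fun do rewrite -mulN1r.
by apply: poly_approxM => //; exact: poly_approx_cst.
Qed.

Lemma poly_approxX (R : realType) (s : R) (u : R[i] -> R[i]) n :
  poly_approx s u -> poly_approx s (fun z => u z ^+ n).
Proof.
move=> au; elim: n => [|n IH]; first exact: poly_approx_cst.
by under [X in poly_approx _ X]eq_fun do rewrite exprS; exact: poly_approxM.
Qed.

Lemma poly_approx_sum (R : realType) (s : R) (u : nat -> R[i] -> R[i]) n :
  (forall k, poly_approx s (u k)) -> poly_approx s (fun z => \sum_(k < n) u k z).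
Proof.
move=> au; elim: n => [|n IH].
  under [X in poly_approx _ X]eq_fun do rewrite big_ord0.
  exact: poly_approx_cst.
under [X in poly_approx _ X]eq_fun do rewrite big_ord_recr.
exact: poly_approxD.
Qed.

(* Neumann series: for M large, 1 - u / M is bounded by some rho < 1. *)
Lemma poly_approx_inv (R : realType) (s d : R) (u : R[i] -> R[i]) : 0 < d ->
  (forall z, cmod z <= s -> d <= complex.Re (u z)) ->
  poly_approx s u -> poly_approx s (fun z => (u z)^-1).
Proof.
move=> d0 du au; have [B' B0' uB'] := poly_approx_bound au.
(* Adding d forces d < B, even when s < 0 and no z satisfies |z| <= s. *)
pose B := B' + d; have B0 : 0 < B by rewrite addr_gt0.
have uB z : cmod z <= s -> cmod (u z) <= B.
  by move=> /uB' h; rewrite (le_trans h)// lerDl ltW.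
have dB : d < B by rewrite ltrDr.
(* This M minimizes 1 - 2 d / M + B^2 / M^2, the bound for |1 - u / M|^2; the minimum 1 - d^2 / B^2
   is the square of [rho]. *)
pose M := B ^+ 2 / d; have M0 : 0 < M by rewrite divr_gt0// exprn_gt0.
pose v z := 1 - u z / M%:C.
have M0' : M%:C != 0 by rewrite -cmod_gt0 cmod_real gtr0_norm.
pose rho := Num.sqrt (1 - d ^+ 2 / B ^+ 2).
have B20 : 0 < B ^+ 2 by rewrite exprn_gt0.
have r0 : 0 <= 1 - d ^+ 2 / B ^+ 2.
  rewrite subr_ge0 ler_pdivrMr// mul1r ler_pXn2r ?nnegrE//; exact: ltW.
have rho1 : rho < 1.
  by rewrite -sqrtr1 ltr_sqrt// ltrBlDr ltrDl divr_gt0// exprn_gt0.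
have vrho z : cmod z <= s -> cmod (v z) <= rho.
  move=> zs; rewrite /cmod ler_sqrt// -sqr_cmod.
  have -> : cmod (v z) ^+ 2 =
      1 - 2 * complex.Re (u z) / M + cmod (u z) ^+ 2 / M ^+ 2.
    rewrite !sqr_cmod /v -rmorphV ?unitfE ?gt_eqF//= !reimE/=.
    by field; rewrite gt_eqF.
  have h1 : d / M <= complex.Re (u z) / M.
    by rewrite ler_pM2r ?invr_gt0// du.
  have h2 : cmod (u z) ^+ 2 / M ^+ 2 <= B ^+ 2 / M ^+ 2.
    rewrite ler_pM2r ?invr_gt0 ?exprn_gt0// ler_pXn2r ?nnegrE ?cmod_ge0 ?uB//.
    exact: ltW.
  have e1 : d / M = d ^+ 2 / B ^+ 2.
    by rewrite /M; field; rewrite !gt_eqF.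
  have e2 : B ^+ 2 / M ^+ 2 = d ^+ 2 / B ^+ 2.
    by rewrite /M; field; rewrite !gt_eqF.
  by rewrite -mulrA; lra.
have u0 z : cmod z <= s -> u z != 0.
  move=> zs; apply/eqP => uz; have := du _ zs; rewrite uz/= leNgt d0//.
apply: poly_approx_lim => e e0.
(* Stopping the series after N terms leaves exactly v^N / u, and |u| >= d; hence the threshold d
   e. *)
have [N rN] := expr_small (sqrtr_ge0 _) rho1 (mulr_gt0 d0 e0).
exists (fun z => M%:C^-1 * \sum_(k < N) v z ^+ k).
  apply: poly_approxM; first exact: poly_approx_cst.
  apply: (@poly_approx_sum _ _ (fun k z => v z ^+ k)) => k; apply: poly_approxX.
  apply: poly_approxD; first exact: poly_approx_cst.
  by apply: poly_approxN; apply: poly_approxM => //; exact: poly_approx_cst.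
move=> z zs; have uz := u0 _ zs.
have -> : (u z)^-1 - M%:C^-1 * \sum_(k < N) v z ^+ k = v z ^+ N / u z.
  have : 1 - v z ^+ N = (1 - v z) * \sum_(k < N) v z ^+ k.
    by rewrite -[LHS]opprB subrX1 -mulNr opprB.
  have -> : 1 - v z = u z / M%:C by rewrite /v subKr.
  move=> h; apply: (mulfI uz).
  rewrite mulrBr divff// [u z * (M%:C^-1 * _)]mulrA -h [RHS]mulrC divfK//.
  by ring.
rewrite cmodM cmodX cmodV ler_pdivrMr ?cmod_gt0//.
have h : cmod (v z) ^+ N <= rho ^+ N.
  by rewrite lerXn2r ?nnegrE ?cmod_ge0 ?sqrtr_ge0 ?vrho.
rewrite (le_trans h)// (le_trans (ltW rN))// mulrC ler_pM2l//.
by rewrite (le_trans (du _ zs))// (le_trans (ler_norm _))// Re_le_cmod.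
Qed.

(* By Runge's theorem this is holomorphy in the unit disc; used as a definition it
   makes the mean value property and Poisson's formula passages to the limit. *)
Definition holo (R : realType) (u : R[i] -> R[i]) :=
  forall s, s < 1 -> poly_approx s u.

(** The approximant is the Taylor polynomial of [cauchy_iter]. On |z| <= s its remainder is at most
    s^N B / (1 - s), a negative s being replaced by 0. *)
Lemma holo_cauchy (R : realType) (P : probability (circle R) R)
    (f : circle R -> R[i]) : bmeasC f -> holo (cauchy_transform P f).
Proof.
move=> bf s s1 e e0; have bcf := bmeas_cmod bf.
have [M fM] : exists M, forall x, `|cmod (f x)| <= M by case: bcf.
pose B := `|M| + 1; have B0 : 0 < B by rewrite ltr_wpDl.
have fB x : cmod (f x) <= B.
  rewrite (le_trans (ler_norm _))// (le_trans (fM x))// /B.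
  by rewrite (le_trans (ler_norm _))// lerDl.
pose s' := Num.max s 0.
have s'0 : 0 <= s' by rewrite le_max lexx orbT.
have s'1 : s' < 1 by rewrite gt_max s1 ltr01.
have [N sN] : exists N, s' ^+ N < e / (B / (1 - s')).
  by apply: expr_small; rewrite ?divr_gt0 ?subr_gt0.
have [p pf] := cauchy_iter P N bf; exists p => z zs.
have zs' : cmod z <= s' by rewrite le_max zs.
have z1 : cmod z < 1 := le_lt_trans zs' s'1.
rewrite pf ?lt_eqF// addrC addKr cmodM cmodX.
rewrite -[leRHS](@divfK _ (B / (1 - s'))); last first.
  by rewrite gt_eqF// divr_gt0// subr_gt0.
rewrite ler_pM ?exprn_ge0 ?cmod_ge0//.
  by rewrite (le_trans _ (ltW sN))// lerXn2r ?nnegrE ?cmod_ge0.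
apply: (le_trans (@cauchy_bound _ _ _ _ B _ z1 _)).
- by apply: bmeasCM => //; apply: bmeasCX; exact: bmeasC_conj.
- by move=> x; rewrite cmodM cmodX cmodJ cmod_circle expr1n mul1r.
- by rewrite ler_pM2l// lef_pV2 ?posrE ?subr_gt0// lerD2l lerN2.
Qed.

(** * Poisson integrals *)

Definition poisson (R : realType) (z : R[i]) (zeta : circle R) : R :=
  (1 - cmod z ^+ 2) / cmod ((zeta : R[i]) - z) ^+ 2.

Lemma poisson_ge0 (R : realType) (z : R[i]) (zeta : circle R) :
  cmod z < 1 -> 0 <= poisson z zeta.
Proof.
move=> z1; rewrite divr_ge0 ?sqr_ge0// subr_ge0.
by rewrite expr_le1 ?cmod_ge0 ?ltW.
Qed.

Lemma cmod_circle_sub (R : realType) (z : R[i]) (zeta : circle R) :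
  cmod ((zeta : R[i]) - z) = cmod (1 - (zeta : R[i])^*%C * z).
Proof.
rewrite -[RHS]mul1r -{1}(cmod_circle zeta) -cmodM mulrBr mulrA conj_circle.
by rewrite mulr1 mul1r.
Qed.

(** The Herglotz form: with w = conj(zeta) z the kernel is the real part of (1 + w) / (1 - w) = 2 /
    (1 - w) - 1. It reduces Poisson integrals to real parts of Cauchy transforms. *)
Lemma poissonE (R : realType) (z : R[i]) (zeta : circle R) : cmod z != 1 ->
  poisson z zeta = 2 * complex.Re (1 - (zeta : R[i])^*%C * z)^-1 - 1.
Proof.
move=> z1; rewrite /poisson cmod_circle_sub.
have : cmod (1 - (zeta : R[i])^*%C * z) != 0.
  by rewrite cmod_eq0 circle_kernel_neq0.
have -> : cmod z = cmod ((zeta : R[i])^*%C * z).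
  by rewrite cmodM cmodJ cmod_circle mul1r.
move: (_^*%C * z) => w; rewrite -sqrf_eq0 reimE !sqr_cmod !reimE/= sub0r sqrrN.
by move=> h; field.
Qed.

Lemma bmeas_poisson (R : realType) (z : R[i]) : cmod z != 1 ->
  bmeas (poisson z).
Proof.
move=> z1; rewrite (_ : poisson z = fun zeta =>
    2 * complex.Re (1 - (zeta : R[i])^*%C * z)^-1 - 1); last first.
  by apply/funext => x; rewrite poissonE.
apply: bmeasB; last exact: bmeas_cst.
by apply: bmeasM; [exact: bmeas_cst|case: (bmeasC_kernel z1)].
Qed.

Lemma bmeasC_poissonM (R : realType) (z : R[i]) (f : circle R -> R[i]) :
  bmeasC f -> cmod z != 1 -> bmeasC (fun zeta => (poisson z zeta)%:C * f zeta).
Proof.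
by move=> bf z1; apply: bmeasCM => //; apply: bmeasC_real; exact: bmeas_poisson.
Qed.

Lemma poisson_decomp (R : realType) (z : R[i]) (zeta : circle R) :
  cmod z != 1 -> (poisson z zeta)%:C = (1 - (zeta : R[i])^*%C * z)^-1 +
    ((1 - (zeta : R[i])^*%C * z)^-1 - 1)^*%C.
Proof.
move=> z1; rewrite poissonE//; move: (_^-1) => x.
by apply: eq_reim; rewrite !reimE/=; ring.
Qed.

(** By [poisson_decomp] the kernel has two halves. The analytic one reproduces z^n by [cauchy_pow];
    the other contributes the conjugate of the Cauchy transform of conj(xi)^n minus its moment,
    which is 0 by [cauchy_conj_powE]. *)
Lemma poisson_pow (R : realType) n (z : R[i]) : cmod z < 1 ->
  cintegral (circle_lebesgue R)
    (fun xi : circle R => (poisson z xi)%:C * (xi : R[i]) ^+ n) = z ^+ n.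
Proof.
move=> z1; have z1' : cmod z != 1 by rewrite lt_eqF.
have bk := bmeasC_kernel z1'.
have bn : bmeasC (fun xi : circle R => (xi : R[i]) ^+ n).
  by apply: bmeasCX; exact: bmeasC_circle.
have bj : bmeasC (fun xi : circle R => (xi : R[i])^*%C ^+ n).
  by apply: bmeasCX; exact: bmeasC_conj.
have b1 : bmeasC (fun zeta : circle R =>
    (zeta : R[i]) ^+ n / (1 - (zeta : R[i])^*%C * z)) by exact: bmeasCM.
have b2 : bmeasC (fun zeta : circle R =>
    (zeta : R[i])^*%C ^+ n / (1 - (zeta : R[i])^*%C * z)) by exact: bmeasCM.
rewrite (_ : (fun xi : circle R => (poisson z xi)%:C * (xi : R[i]) ^+ n) =
  fun xi : circle R => (xi : R[i]) ^+ n / (1 - (xi : R[i])^*%C * z) +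
   ((xi : R[i])^*%C ^+ n / (1 - (xi : R[i])^*%C * z) - (xi : R[i])^*%C ^+ n)^*%C); last first.
  apply/funext => xi; rewrite poisson_decomp// mulrDl mulrC; congr (_ + _).
  rewrite -{1}(conjcK (_ ^+ n)) rmorphXn/= -rmorphM/=; congr (_^*%C).
  by rewrite mulrBl mul1r mulrC.
rewrite cintD//; last by apply: bmeasCJ; exact: bmeasCB.
rewrite cintJ//; last exact: bmeasCB.
have e1 := cauchy_pow n z1; have e2 := cauchy_conj_powE n z1.
rewrite /cauchy_transform in e1 e2.
by rewrite cintB// e1 e2 subrr conjc0 addr0.
Qed.

Lemma poisson_poly (R : realType) (p : {poly R[i]}) (z : R[i]) : cmod z < 1 ->
  cintegral (circle_lebesgue R)
    (fun xi : circle R => (poisson z xi)%:C * p.[xi : R[i]]) = p.[z].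
Proof.
move=> z1; have z1' : cmod z != 1 by rewrite lt_eqF.
have bi i : bmeasC (fun xi : circle R => (poisson z xi)%:C * (xi : R[i]) ^+ i).
  by apply: bmeasC_poissonM => //; apply: bmeasCX; exact: bmeasC_circle.
rewrite (_ : (fun xi : circle R => (poisson z xi)%:C * p.[xi : R[i]]) =
  fun xi : circle R => \sum_(i < size p) p`_i * ((poisson z xi)%:C * (xi : R[i]) ^+ i)).
  rewrite cint_sum; last by move=> i; apply: bmeasCM => //; exact: bmeasC_cst.
  rewrite horner_coef; apply: eq_bigr => i _; rewrite cintZ//.
  by congr (_ * _); exact: poisson_pow.
apply/funext => xi; rewrite horner_coef mulr_sumr; apply: eq_bigr => i _.
by rewrite mulrCA.
Qed.

Lemma rint_poisson (R : realType) (z : R[i]) : cmod z < 1 ->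
  \int[circle_lebesgue R]_x poisson z x = 1.
Proof.
move=> z1; apply: (@complexI R); rewrite -cint_real.
have := poisson_poly 1%:P z1; rewrite hornerC => h; rewrite -[RHS]h.
by congr cintegral; apply/funext => x; rewrite hornerC mulr1.
Qed.

Lemma bmeasC_poly (R : realType) (p : {poly R[i]}) :
  bmeasC (fun xi : circle R => p.[xi : R[i]]).
Proof.
under [X in bmeasC X]eq_fun do rewrite horner_coef.
apply: bmeasC_sum => i; apply: bmeasCM; first exact: bmeasC_cst.
by apply: bmeasCX; exact: bmeasC_circle.
Qed.

Lemma horner_dilate (R : realType) (p : {poly R[i]}) (s z : R[i]) :
  (p \Po (s *: 'X)).[z] = p.[s * z].
Proof. by rewrite horner_comp hornerZ hornerX. Qed.

Lemma cvg_harmonic_bound (R : realType) (f : nat -> R) (l : R) :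
  (forall n, `|f n - l| <= n.+1%:R^-1) -> f n @[n --> \oo] --> l.
Proof.
move=> h; apply/cvgrPdist_le => e e0.
have /cvgrPdist_le/(_ e e0) := @cvg_harmonic R.
apply: filterS => n; rewrite sub0r normrN ger0_norm ?harmonic_ge0//.
by rewrite distrC; apply: le_trans; exact: h.
Qed.

Lemma cmod_dilate (R : realType) (s : R) (xi : circle R) : 0 <= s ->
  cmod (s%:C * (xi : R[i])) = s.
Proof. by move=> s0; rewrite cmodM cmod_real cmod_circle mulr1 ger0_norm. Qed.

(** Measurability is that of a pointwise limit of polynomials, taken with errors 1 / (n + 1). *)
Lemma bmeasC_poly_approx (R : realType) (s : R) (u : R[i] -> R[i]) : 0 <= s ->
  poly_approx s u -> bmeasC (fun xi : circle R => u (s%:C * (xi : R[i]))).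
Proof.
move=> s0 au; have [B B0 uB] := poly_approx_bound au.
have /choice[p hp] : forall n : nat, exists p : {poly R[i]},
    forall z, cmod z <= s -> cmod (u z - p.[z]) <= n.+1%:R^-1.
  by move=> n; apply: au; rewrite invr_gt0.
have hs (xi : circle R) : cmod (s%:C * (xi : R[i])) <= s by rewrite cmod_dilate.
have bp n : bmeasC (fun xi : circle R => (p n).[s%:C * (xi : R[i])]).
  have := bmeasC_poly (p n \Po (s%:C *: 'X)).
  by under [X in bmeasC X]eq_fun do rewrite horner_dilate.
split; split.
- apply: (@measurable_fun_cvg _ _ _ _
    (fun n (xi : circle R) => complex.Re (p n).[s%:C * (xi : R[i])])) => //.
    by move=> n; have [[]] := bp n.
  move=> xi _; apply: cvg_harmonic_bound => n.
  by rewrite distrC -ReN -ReD (le_trans (Re_le_cmod _))// hp.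
- by exists B => xi; rewrite (le_trans (Re_le_cmod _))// uB.
- apply: (@measurable_fun_cvg _ _ _ _
    (fun n (xi : circle R) => complex.Im (p n).[s%:C * (xi : R[i])])) => //.
    by move=> n; have [_ []] := bp n.
  move=> xi _; apply: cvg_harmonic_bound => n.
  by rewrite distrC -ImN -ImD (le_trans (Im_le_cmod _))// hp.
- by exists B => xi; rewrite (le_trans (Im_le_cmod _))// uB.
Qed.

Lemma cmod_eq_eps (R : realType) (x y : R[i]) (K : R) :
  (forall e, 0 < e -> cmod (x - y) <= e * K) -> x = y.
Proof.
move=> h; apply/eqP; rewrite -subr_eq0 -cmod_eq0 eq_le cmod_ge0 andbT.
apply/ler_addgt0Pl => e e0; rewrite addr0.
have K0 : 0 < `|K| + 1 by rewrite ltr_wpDl.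
have := h _ (divr_gt0 e0 K0); move=> /le_trans; apply.
rewrite mulrAC ler_pdivrMr// ler_pM2l//.
by rewrite (le_trans (ler_norm _))// lerDl.
Qed.

Lemma poisson_poly_approx (R : realType) (s : R) (u : R[i] -> R[i]) (z : R[i]) :
  0 <= s -> poly_approx s u -> cmod z < 1 ->
  cintegral (circle_lebesgue R)
    (fun xi : circle R => (poisson z xi)%:C * u (s%:C * (xi : R[i]))) = u (s%:C * z).
Proof.
move=> s0 au z1; have z1' : cmod z != 1 by rewrite lt_eqF.
have bu := bmeasC_poly_approx s0 au.
(* The factor 2 counts the error of p at s z and the error of p under the integral, where the kernel
   is nonnegative with integral 1. *)
apply: (@cmod_eq_eps _ _ _ 2) => e e0; have [p up] := au _ e0.
have bp : bmeasC (fun xi : circle R => p.[s%:C * (xi : R[i])]).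
  have := bmeasC_poly (p \Po (s%:C *: 'X)).
  by under [X in bmeasC X]eq_fun do rewrite horner_dilate.
have := poisson_poly (p \Po (s%:C *: 'X)) z1; rewrite horner_dilate.
under [X in cintegral _ X]eq_fun do rewrite horner_dilate.
move=> h.
rewrite (_ : _ - _ =
  (cintegral (circle_lebesgue R)
     (fun xi : circle R => (poisson z xi)%:C * u (s%:C * (xi : R[i]))) -
   cintegral (circle_lebesgue R)
     (fun xi : circle R => (poisson z xi)%:C * p.[s%:C * (xi : R[i])])) +
   (p.[s%:C * z] - u (s%:C * z))); last by rewrite h; ring.
rewrite (le_trans (cmodD _ _))// mulr_natr mulr2n lerD//; last first.
  rewrite cmodC; apply: up; rewrite cmodM cmod_real ger0_norm//.
  by rewrite ler_piMr// ltW.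
rewrite -cintB; [|exact: bmeasC_poissonM..].
have bd : bmeasC (fun xi : circle R =>
  (poisson z xi)%:C * (u (s%:C * (xi : R[i])) - p.[s%:C * (xi : R[i])])).
  by apply: bmeasC_poissonM => //; exact: bmeasCB.
under [X in cintegral _ X]eq_fun do rewrite -mulrBr.
rewrite (le_trans (cint_cmod_le _ bd))//.
rewrite -[leRHS]mulr1 -(rint_poisson z1) -rintZ; last exact: bmeas_poisson.
apply: rint_le; first exact: bmeas_cmod.
  by apply: bmeasM; [exact: bmeas_cst|exact: bmeas_poisson].
move=> xi; rewrite cmodM cmod_real ger0_norm ?poisson_ge0// mulrC.
by rewrite ler_wpM2r ?poisson_ge0// up// cmod_dilate.
Qed.

(** * Quadratic means and boundary functions *)

Lemma circle_orthogonal (R : realType) i j :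
  cintegral (circle_lebesgue R)
    (fun xi : circle R => (xi : R[i]) ^+ i * ((xi : R[i]) ^+ (i + j.+1))^*%C) = 0.
Proof.
rewrite -(circle_moment_conj R (ltn0Sn j)); congr cintegral; apply/funext => xi.
by rewrite exprD rmorphM/= mulrA mulJc cmodX cmod_circle !expr1n mul1r rmorphXn.
Qed.

Lemma sqr_cmodD (R : realType) (x y : R[i]) :
  cmod (x + y) ^+ 2 = cmod x ^+ 2 + cmod y ^+ 2 + 2 * complex.Re (x * y^*%C).
Proof. by rewrite !sqr_cmod !reimE; ring. Qed.

Lemma parseval (R : realType) (b : nat -> R[i]) n :
  \int[circle_lebesgue R]_xi
     cmod (\sum_(i < n) b i * (circle_val xi) ^+ i) ^+ 2 =
  \sum_(i < n) cmod (b i) ^+ 2.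
Proof.
have bX k : bmeasC (fun xi : circle R => (xi : R[i]) ^+ k).
  by apply: bmeasCX; exact: bmeasC_circle.
have bX' k : bmeasC (fun xi : circle R => b k * (xi : R[i]) ^+ k).
  by apply: bmeasCM; [exact: bmeasC_cst|exact: bX].
elim: n => [|n IH].
  rewrite big_ord0 -[RHS](rint_cst (circle_lebesgue R)).
  by apply: eq_Rintegral => x _; rewrite big_ord0 cmod0 expr0n.
have bS : bmeasC (fun xi : circle R => \sum_(i < n) b i * (xi : R[i]) ^+ i).
  exact: (@bmeasC_sum _ _ _ _ _ (fun i : 'I_n => _)).
have bP : bmeasC (fun xi : circle R =>
    (\sum_(i < n) b i * (xi : R[i]) ^+ i) * (b n * (xi : R[i]) ^+ n)^*%C).
  by apply: bmeasCM => //; exact: bmeasCJ.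
have E (xi : circle R) : cmod (\sum_(i < n.+1) b i * (xi : R[i]) ^+ i) ^+ 2 =
    (cmod (\sum_(i < n) b i * (xi : R[i]) ^+ i) ^+ 2 + cmod (b n) ^+ 2) +
    2 * complex.Re ((\sum_(i < n) b i * (xi : R[i]) ^+ i) * (b n * (xi : R[i]) ^+ n)^*%C).
  by rewrite big_ord_recr sqr_cmodD (cmodM (b n)) cmodX cmod_circle expr1n mulr1.
under eq_Rintegral do rewrite E.
rewrite rintD; last 2 first.
- by apply: bmeasD; [exact: bmeas_sqr_cmod|exact: bmeas_cst].
- by apply: bmeasM; [exact: bmeas_cst|case: bP].
rewrite rintD; [|exact: bmeas_sqr_cmod|exact: bmeas_cst].
rewrite IH rint_cst big_ord_recr/= rintZ; last by case: bP.
suff -> : \int[circle_lebesgue R]_xi complex.Re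
  ((\sum_(i < n) b i * (circle_val xi) ^+ i) * (b n * (circle_val xi) ^+ n)^*%C) = 0.
  by rewrite mulr0 addr0.
transitivity (complex.Re (cintegral (circle_lebesgue R) (fun xi : circle R =>
  (\sum_(i < n) b i * (xi : R[i]) ^+ i) * (b n * (xi : R[i]) ^+ n)^*%C))) => //.
rewrite (_ : (fun xi : circle R =>
    (\sum_(i < n) b i * (xi : R[i]) ^+ i) * (b n * (xi : R[i]) ^+ n)^*%C) =
  fun xi : circle R => \sum_(i < n) (b i * (b n)^*%C) *
     ((xi : R[i]) ^+ i * ((xi : R[i]) ^+ n)^*%C)); last first.
  apply/funext => xi; rewrite mulr_suml; apply: eq_bigr => i _.
  by rewrite rmorphM/=; ring.
have bXX i : bmeasC (fun xi : circle R => (xi : R[i]) ^+ i * ((xi : R[i]) ^+ n)^*%C).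
  by apply: bmeasCM; [exact: bX|exact: bmeasCJ].
rewrite cint_sum; last by move=> i; apply: bmeasCM; [exact: bmeasC_cst|exact: bXX].
rewrite big1// => i _; rewrite cintZ; last exact: bXX.
have := circle_orthogonal R i (n - i.+1).
by rewrite -addSnnS subnKC// => ->; rewrite mulr0.
Qed.

Lemma bmeasC_poly_dilate (R : realType) (p : {poly R[i]}) (s : R) :
  bmeasC (fun xi : circle R => p.[s%:C * (xi : R[i])]).
Proof.
have := bmeasC_poly (p \Po (s%:C *: 'X)).
by under [X in bmeasC X]eq_fun do rewrite horner_dilate.
Qed.

(* By [parseval] this is (r^n - s^n)^2 + s^(2n) <= r^(2n), coefficient by coefficient. *)
Lemma poly_L2 (R : realType) (p : {poly R[i]}) (s r : R) : 0 <= s -> s <= r ->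
  \int[circle_lebesgue R]_xi cmod (p.[r%:C * circle_val xi] - p.[s%:C * circle_val xi]) ^+ 2
  + \int[circle_lebesgue R]_xi cmod p.[s%:C * circle_val xi] ^+ 2
  <= \int[circle_lebesgue R]_xi cmod p.[r%:C * circle_val xi] ^+ 2.
Proof.
move=> s0 sr; have r0 : 0 <= r := le_trans s0 sr.
have E (t : R) (xi : circle R) : p.[t%:C * (xi : R[i])] =
    \sum_(i < size p) (p`_i * t%:C ^+ i) * (xi : R[i]) ^+ i.
  by rewrite horner_coef; apply: eq_bigr => i _; rewrite exprMn mulrA.
have I (t : R) : \int[circle_lebesgue R]_xi cmod p.[t%:C * circle_val xi] ^+ 2 =
    \sum_(i < size p) cmod (p`_i * t%:C ^+ i) ^+ 2.
  under eq_Rintegral do rewrite E.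
  exact: (parseval (fun i => p`_i * t%:C ^+ i)).
have Irs : \int[circle_lebesgue R]_xi
    cmod (p.[r%:C * circle_val xi] - p.[s%:C * circle_val xi]) ^+ 2 =
    \sum_(i < size p) cmod (p`_i * (r%:C ^+ i - s%:C ^+ i)) ^+ 2.
  under eq_Rintegral do rewrite !E -sumrB.
  under eq_Rintegral do under eq_bigr do rewrite -mulrBl -mulrBr.
  exact: (parseval (fun i => p`_i * (r%:C ^+ i - s%:C ^+ i))).
rewrite Irs !I.
rewrite -big_split/=; apply: ler_sum => i _.
have h : s ^+ i <= r ^+ i by rewrite lerXn2r ?nnegrE.
have s1 : 0 <= s ^+ i by rewrite exprn_ge0.
have cE (c : R[i]) (x : R) : cmod (c * x%:C) ^+ 2 = cmod c ^+ 2 * x ^+ 2.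
  by rewrite cmodM exprMn cmod_real real_normK ?num_real.
rewrite -!rmorphXn -rmorphB/= !cE -mulrDr ler_wpM2l ?sqr_ge0//.
have : 0 <= s ^+ i * (r ^+ i - s ^+ i) by rewrite mulr_ge0// subr_ge0.
by nra.
Qed.

Lemma le_eps (R : realType) (x y K : R) :
  (forall e, 0 < e -> e <= 1 -> x <= y + e * K) -> x <= y.
Proof.
move=> h; apply/ler_addgt0Pl => e e0.
have K0 : 0 < `|K| + e by rewrite ltr_wpDl.
have d0 : 0 < e / (`|K| + e) by rewrite divr_gt0.
have d1 : e / (`|K| + e) <= 1 by rewrite ler_pdivrMr// mul1r lerDr.
have /le_trans := h _ d0 d1; apply; rewrite addrC lerD2r mulrAC ler_pdivrMr//.
by rewrite ler_pM2l// (le_trans (ler_norm _))// lerDl ltW.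
Qed.

(** For e <= 1 the factor |x| + |y| is at most 2 B + 1, which makes the error linear in e. *)
Lemma sqr_cmod_close (R : realType) (x y : R[i]) (e B : R) : e <= 1 ->
  cmod x <= B -> cmod (x - y) <= e ->
  `|cmod x ^+ 2 - cmod y ^+ 2| <= e * (2 * B + 1).
Proof.
move=> e1 xB xy; rewrite subr_sqr normrM.
have e0 : 0 <= e := le_trans (cmod_ge0 _) xy.
have h1 : `|cmod x - cmod y| <= e.
  rewrite ler_norml; apply/andP; split; last exact: le_trans (cmod_dist _ _) xy.
  by rewrite lerNl opprB (le_trans (cmod_dist _ _))// cmodC.
rewrite ler_pM// ger0_norm ?addr_ge0 ?cmod_ge0//.
by move: h1; rewrite ler_norml => /andP[h1 _]; lra.
Qed.

Lemma poly_approx_L2 (R : realType) (u : R[i] -> R[i]) (s r : R) :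
  0 <= s -> s <= r -> poly_approx r u ->
  \int[circle_lebesgue R]_xi cmod (u (r%:C * circle_val xi) - u (s%:C * circle_val xi)) ^+ 2
  + \int[circle_lebesgue R]_xi cmod (u (s%:C * circle_val xi)) ^+ 2
  <= \int[circle_lebesgue R]_xi cmod (u (r%:C * circle_val xi)) ^+ 2.
Proof.
move=> s0 sr au; have r0 : 0 <= r := le_trans s0 sr.
have as_ : poly_approx s u.
  by move=> e /au[p up]; exists p => z zs; apply: up; exact: le_trans sr.
have br := bmeasC_poly_approx r0 au; have bs := bmeasC_poly_approx s0 as_.
have [B B0 uB] := poly_approx_bound au.
have hr (xi : circle R) : cmod (r%:C * (xi : R[i])) <= r by rewrite cmod_dilate.
have hs (xi : circle R) : cmod (s%:C * (xi : R[i])) <= r by rewrite cmod_dilate.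
have I (f g : circle R -> R[i]) (e C : R) : 0 < e -> e <= 1 -> bmeasC f -> bmeasC g ->
    (forall xi, cmod (f xi) <= C) -> (forall xi, cmod (f xi - g xi) <= e) ->
    `|\int[circle_lebesgue R]_xi cmod (f xi) ^+ 2 -
      \int[circle_lebesgue R]_xi cmod (g xi) ^+ 2| <= e * (2 * C + 1).
  move=> e0 e1 bf bg fC fg; have bf2 := bmeas_sqr_cmod bf; have bg2 := bmeas_sqr_cmod bg.
  rewrite -rintB// (le_trans (rint_abs _ _))//; first exact: bmeasB.
  apply: rint_bound; first by apply: bmeas_norm; exact: bmeasB.
  by move=> xi; exact: sqr_cmod_close.
have close (x y z x' y' z' X Y : R) : `|x - x'| <= X -> `|y - y'| <= Y ->
    `|z - z'| <= Y -> x' + y' <= z' -> x + y <= z + (X + 2 * Y).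
  by rewrite !ler_norml => /andP[? ?] /andP[? ?] /andP[? ?] ?; lra.
(* The first term is the error of the squared difference, whose modulus is bounded by 2 B; the
   second collects the errors at the radii r and s. *)
apply: (@le_eps _ _ _ ((2 * (2 * B) + 1) + 2 * (2 * B + 1))) => e e0 e1.
(* The difference of two dilates incurs the approximation error twice, hence e / 2. *)
have e20 : 0 < e / 2 by rewrite divr_gt0.
have [p up] := au _ e20.
have up' z : cmod z <= r -> cmod (u z - p.[z]) <= e.
  by move=> /up h; rewrite (le_trans h)// ler_pdivrMr// ler_peMr ?ltW// ltrDl.
have bpr := bmeasC_poly_dilate p r; have bps := bmeasC_poly_dilate p s.
have I1 := I _ _ e B e0 e1 br bpr (fun xi => uB _ (hr xi)) (fun xi => up' _ (hr xi)).
have I2 := I _ _ e B e0 e1 bs bps (fun xi => uB _ (hs xi)) (fun xi => up' _ (hs xi)).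
have /I I3 := bmeasCB br bs; have {I3} := I3 _ e (2 * B) e0 e1 (bmeasCB bpr bps).
move=> /(_ _ _)/wrap[] => [xi|xi|I3].
- by rewrite (le_trans (cmodB _ _))// mulr_natl mulr2n lerD ?uB.
- rewrite opprD addrACA -opprD (le_trans (cmodB _ _))// [e]splitr.
  by rewrite lerD ?up.
have -> : e * (2 * (2 * B) + 1 + 2 * (2 * B + 1)) =
  e * (2 * (2 * B) + 1) + 2 * (e * (2 * B + 1)) by ring.
exact: close I3 I2 I1 (poly_L2 p s0 sr).
Qed.

(** The sum of the |f (n + 1) - f n| has finite integral, hence is finite almost everywhere, and
    there the telescoping series converges absolutely. *)
Lemma L1_summable_cvg d (T : measurableType d) (R : realType)
    (P : probability T R) (f : nat -> T -> R) (B : R) :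
  (forall n, bmeas (f n)) -> (forall n x, `|f n x| <= B) ->
  (forall n, \int[P]_x `|f n.+1 x - f n x| <= (1 / (2 ^ (n + 1))%:R)) ->
  exists2 F : T -> R, bmeas F & {ae P, forall x, f n x @[n --> \oo] --> F x}.
Proof.
(* The upper limit clipped to [-B, B] is measurable and bounded everywhere, also where the sequence
   diverges. *)
move=> bf fB fI; pose F x := Num.max (- B) (Num.min B (limn_sup (f^~ x))).
have B0 x : 0 <= B := le_trans (normr_ge0 _) (fB 0%N x).
exists F.
  split.
    apply: measurable_maxr => //; apply: measurable_minr => //.
    apply: measurable_fun_limn_sup.
    - by move=> t _; exists B => _ [n _ <-]; rewrite (le_trans (ler_norm _)).
    - move=> t _; exists (- B) => _ [n _ <-].
      by have := fB n t; rewrite ler_norml => /andP[].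
    - by move=> n; case: (bf n).
  exists B => x; rewrite ler_norml /F le_max lexx/= ge_max ge_min lexx/= andbT.
  by have b0 := B0 x; rewrite -subr_ge0 opprK addr_ge0.
have bd n : bmeas (fun x => `|f n.+1 x - f n x|).
  by apply: bmeas_norm; exact: bmeasB.
have md n : measurable_fun setT (fun x => (`|f n.+1 x - f n x|)%:E).
  by apply/measurable_EFinP; case: (bd n).
have S : P.-integrable setT (fun x => \sum_(0 <= n <oo) (`|f n.+1 x - f n x|)%:E)%E.
  apply/integrableP; split.
    by apply: ge0_emeasurable_sum => // n x _ _; rewrite lee_fin.
  have -> : (\int[P]_x `|\sum_(0 <= n <oo) (`|f n.+1 x - f n x|)%:E| =
      \int[P]_x \sum_(0 <= n <oo) (`|f n.+1 x - f n x|)%:E)%E.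
    apply: eq_integral => x _; rewrite gee0_abs//.
    by apply: nneseries_ge0 => n _ _; rewrite lee_fin.
  rewrite integral_nneseries//.
  apply: (@le_lt_trans _ _ (\sum_(0 <= n <oo) (1 / (2 ^ (n + 1))%:R : R)%:E)%E).
    apply: lee_nneseries => [n _ _|n _]; last by rewrite -EFin_rint// lee_fin.
    by apply: integral_ge0 => x _; rewrite lee_fin.
  by have /cvg_lim -> := @cvg_geometric_eseries_half R 1 0; rewrite ?ltry.
have := integrable_ae measurableT S; apply: filterS => x /(_ I) Sx.
have cs : cvgn (series (fun n => f n.+1 x - f n x)).
  apply: normed_cvg; apply: nnseries_is_cvg => [n|]; first exact: normr_ge0.
  by move: Sx; rewrite fin_numElt => /andP[].
have cf : cvgn (f^~ x).
  have : cvgn (fun n => series (fun n => f n.+1 x - f n x) n + f 0%N x).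
    by apply: is_cvgD => //; exact: is_cvg_cst.
  have -> // : (fun n => series (fun n => f n.+1 x - f n x) n + f 0%N x) = f^~ x.
  by apply/funext => n; rewrite [series _](telescopeK (f^~ x)) /= subrK.
suff -> : F x = limn (f^~ x) by exact: cf.
rewrite /F (cvg_limn_supE cf).
have h1 : limn (f^~ x) <= B.
  by apply: limr_le => //; apply: nearW => n; rewrite (le_trans (ler_norm _)).
have h2 : - B <= limn (f^~ x).
  apply: limr_ge => //; apply: nearW => n.
  by have := fB n x; rewrite ler_norml => /andP[].
by rewrite min_r// max_r.
Qed.

(** A substitute for Cauchy-Schwarz: |f| <= f^2 / (2 c) + c / 2 pointwise, and each term integrates
    to at most c / 2. *)
Lemma rint_amgm d (T : measurableType d) (R : realType) (P : probability T R)
    (f : T -> R) (c : R) : bmeas f -> 0 < c -> \int[P]_x f x ^+ 2 <= c ^+ 2 ->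
  \int[P]_x `|f x| <= c.
Proof.
move=> bf c0 fc; have bf2 := bmeasX 2 bf.
have h x : `|f x| <= (2 * c)^-1 * f x ^+ 2 + c / 2.
  rewrite -subr_ge0 -(real_normK (num_real (f x))).
  have -> : (2 * c)^-1 * `|f x| ^+ 2 + c / 2 - `|f x| = (2 * c)^-1 * (`|f x| - c) ^+ 2.
    by field; rewrite gt_eqF.
  by rewrite mulr_ge0 ?sqr_ge0// invr_ge0 mulr_ge0// ltW.
have bZ : bmeas (fun x => (2 * c)^-1 * f x ^+ 2).
  by apply: bmeasM => //; exact: bmeas_cst.
apply: (@le_trans _ _ (\int[P]_x ((2 * c)^-1 * f x ^+ 2 + c / 2))).
  apply: rint_le => //; first exact: bmeas_norm.
  by apply: bmeasD => //; exact: bmeas_cst.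
rewrite rintD//; last exact: bmeas_cst.
rewrite rint_cst rintZ//.
have h2 : (2 * c)^-1 * \int[P]_x f x ^+ 2 <= (2 * c)^-1 * c ^+ 2.
  by rewrite ler_pM2l// invr_gt0 mulr_gt0.
have e2 : (2 * c)^-1 * c ^+ 2 = c / 2 by field; rewrite gt_eqF.
by lra.
Qed.

(* By [poly_approx_L2] the quadratic means increase with the radius and control the
   L2 distances between dilates; being bounded, they converge. *)
Lemma holo_boundary (R : realType) (u : R[i] -> R[i]) (B : R) : holo u ->
  (forall z, cmod z < 1 -> cmod (u z) <= B) ->
  exists (s : nat -> R) (U : circle R -> R[i]),
    [/\ forall n, 0 <= s n < 1, s n @[n --> \oo] --> (1 : R), bmeasC U &
      {ae circle_lebesgue R, forall xi : circle R,
        complex.Re (u ((s n)%:C * (xi : R[i]))) @[n --> \oo] --> complex.Re (U xi) /\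
        complex.Im (u ((s n)%:C * (xi : R[i]))) @[n --> \oo] --> complex.Im (U xi)}].
Proof.
move=> hu uB; pose m := circle_lebesgue R.
pose A (s : R) := \int[m]_xi cmod (u (s%:C * circle_val xi)) ^+ 2.
have bu s : 0 <= s -> s < 1 -> bmeasC (fun xi : circle R => u (s%:C * (xi : R[i]))).
  by move=> s0 s1; apply: bmeasC_poly_approx => //; exact: hu.
have uB' s (xi : circle R) : 0 <= s -> s < 1 -> cmod (u (s%:C * (xi : R[i]))) <= B.
  by move=> s0 s1; apply: uB; rewrite cmod_dilate.
have AB s : 0 <= s -> s < 1 -> A s <= B ^+ 2.
  move=> s0 s1; apply: rint_bound; first exact: bmeas_sqr_cmod (bu s s0 s1).
  by move=> xi; rewrite lerXn2r ?nnegrE ?cmod_ge0 ?uB'// (le_trans (cmod_ge0 _) (uB' s xi s0 s1)).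
have dA s r : 0 <= s -> s <= r -> r < 1 ->
    \int[m]_xi cmod (u (r%:C * circle_val xi) - u (s%:C * circle_val xi)) ^+ 2 <= A r - A s.
  by move=> s0 sr r1; rewrite lerBrDr; exact: poly_approx_L2 (hu _ r1).
have Amono s r : 0 <= s -> s <= r -> r < 1 -> A s <= A r.
  move=> s0 sr r1; rewrite -subr_ge0 (le_trans _ (dA _ _ s0 sr r1))//.
  by apply: Rintegral_ge0 => x _; exact: sqr_ge0.
pose E := [set A s | s in [set s : R | 0 <= s < 1]].
have sE : has_sup E.
  split; first by exists (A 0), 0; rewrite //= lexx ltr01.
  by exists (B ^+ 2) => _ [s /andP[s0 s1] <-]; exact: AB.
(* Summable weights. Radii at which A is within (c n)^2 of its supremum put consecutive dilates at
   squared L2 distance at most (c n)^2, hence at L1 distance at most c n by [rint_amgm]. *)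
pose c (n : nat) : R := 1 / (2 ^ (n + 1))%:R.
have c0 n : 0 < c n by rewrite divr_gt0// ltr0n expn_gt0.
have cn n : c n.+1 <= c n.
  by rewrite ler_pM2l// lef_pV2 ?posrE ?ltr0n ?expn_gt0// ler_nat leq_exp2l.
have /choice[s hs] : forall n : nat, exists s : R,
    [/\ 0 <= s, s < 1, 1 - n.+1%:R^-1 <= s & sup E - c n ^+ 2 < A s].
  move=> n; have [_ [t /andP[t0 t1] <-] At] := sup_adherent (exprn_gt0 2 (c0 n)) sE.
  have n1 : 1 - n.+1%:R^-1 < 1 :> R by rewrite ltrBlDr ltrDl invr_gt0.
  (* The maximum drives the radii to 1; A stays near its supremum because it is nondecreasing. *)
  exists (Num.max t (1 - n.+1%:R^-1)); split.
  - by rewrite le_max t0.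
  - by rewrite gt_max t1.
  - by rewrite le_max lexx orbT.
  - by apply: lt_le_trans At (Amono _ _ t0 _ _); rewrite ?le_max ?lexx// gt_max t1 n1.
have s0 n : 0 <= s n by case: (hs n).
have s1 n : s n < 1 by case: (hs n).
have As n : A (s n) <= sup E.
  by apply: ub_le_sup; [case: sE|exists (s n) => //=; rewrite s0 s1].
have D n : \int[m]_xi cmod (u ((s n.+1)%:C * circle_val xi) -
    u ((s n)%:C * circle_val xi)) ^+ 2 <= c n ^+ 2.
  have [_ _ _ h1] := hs n; have [_ _ _ h2] := hs n.+1.
  have h3 : c n.+1 ^+ 2 <= c n ^+ 2 by rewrite lerXn2r ?cn// nnegrE ltW.
  (* The radii need not increase. When they decrease, the two dilates exchange roles and c n.+1 <= c
     n preserves the bound. *)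
  have [sn|sn] := leP (s n) (s n.+1).
    rewrite (le_trans (dA _ _ (s0 n) sn (s1 _)))// lerBlDr (le_trans (As _))//.
    by rewrite -lerBlDl ltW.
  under eq_Rintegral do rewrite cmodC.
  rewrite (le_trans (dA _ _ (s0 n.+1) (ltW sn) (s1 _)))// lerBlDr (le_trans (As _))//.
  by rewrite -lerBlDl (le_trans _ (ltW h2))// lerD2l lerN2.
have bd n : bmeasC (fun xi : circle R =>
    u ((s n.+1)%:C * (xi : R[i])) - u ((s n)%:C * (xi : R[i]))).
  by apply: bmeasCB; exact: bu.
have D1 n : \int[m]_xi cmod (u ((s n.+1)%:C * circle_val xi) -
    u ((s n)%:C * circle_val xi)) <= c n.
  have := rint_amgm (bmeas_cmod (bd n)) (c0 n) (D n).
  by under eq_Rintegral do rewrite ger0_norm ?cmod_ge0//.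
have [|n xi|n|F1 bF1 cF1] := @L1_summable_cvg _ _ _ m
  (fun n xi => complex.Re (u ((s n)%:C * circle_val xi))) B.
- by move=> n; case: (bu _ (s0 n) (s1 n)).
- exact: le_trans (Re_le_cmod _) (uB' _ _ (s0 n) (s1 n)).
- rewrite (le_trans _ (D1 n))//; apply: rint_le.
  + by apply: bmeas_norm; under [X in bmeas X]eq_fun do rewrite -ReN -ReD; case: (bd n).
  + exact: bmeas_cmod (bd n).
  + by move=> xi; rewrite -ReN -ReD Re_le_cmod.
have [|n xi|n|F2 bF2 cF2] := @L1_summable_cvg _ _ _ m
  (fun n xi => complex.Im (u ((s n)%:C * circle_val xi))) B.
- by move=> n; case: (bu _ (s0 n) (s1 n)).
- exact: le_trans (Im_le_cmod _) (uB' _ _ (s0 n) (s1 n)).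
- rewrite (le_trans _ (D1 n))//; apply: rint_le.
  + by apply: bmeas_norm; under [X in bmeas X]eq_fun do rewrite -ImN -ImD; case: (bd n).
  + exact: bmeas_cmod (bd n).
  + by move=> xi; rewrite -ImN -ImD Im_le_cmod.
exists s, (fun xi => F1 xi +i* F2 xi); split => //.
- by move=> n; rewrite s0 s1.
- apply: cvg_harmonic_bound => n; have [_ _ h _] := hs n.
  rewrite ler0_norm ?subr_le0 ?(ltW (s1 n))// opprB.
  by rewrite lerBlDr addrC -lerBlDr.
- by apply: filterS2 cF1 cF2 => xi /= h1 h2; split.
Qed.

(** * Lebesgue points on the circle *)

(** Near 0 the mean value theorem compares sin w with w through cos 1; on the rest of the interval
    the sine has a positive minimum by compactness. *)
Lemma sin_ge_linear (R : realType) (b : R) : 0 < b -> b < pi ->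
  exists2 k : R, 0 < k & forall w, 0 <= w -> w <= b -> k * w <= sin w.
Proof.
move=> b0 bpi; pose a := Num.min b 1.
have a0 : 0 < a by rewrite lt_min b0 ltr01.
have ab : a <= b by rewrite ge_min lexx.
have [c /itvP cab cmin] : exists2 c : R, c \in `[a, b] &
    forall t, t \in `[a, b] -> sin c <= sin t.
  apply: EVT_min => //; apply: continuous_subspaceT => x.
  exact: continuous_sin.
have sc0 : 0 < sin c.
  by apply: sin_gt0_pi; rewrite (lt_le_trans a0) ?cab//= (le_lt_trans _ bpi) ?cab.
have b10 : 0 < cos (1 : R) by exact: cos1_gt0.
exists (Num.min (cos 1) (sin c / b)).
  by rewrite lt_min b10 divr_gt0.
move=> w w0 wb; have [wa|aw] := leP w a; last first.
  apply: (@le_trans _ _ (sin c / b * w)).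
    by rewrite ler_wpM2r// ge_min lexx orbT.
  rewrite (le_trans _ (cmin w _)) ?in_itv/= ?(ltW aw)//.
  by rewrite -mulrA ler_piMr ?(ltW sc0)// mulrC ler_pdivrMr// mul1r.
have [->|wn0] := eqVneq w 0; first by rewrite mulr0 sin0.
have {}w0 : 0 < w by rewrite lt_neqAle eq_sym wn0.
have [x|x /itvP x0w] := @MVT _ (@sin R) (@cos R) 0 w w0 (fun x _ => is_derive_sin x).
  by apply: continuous_subspaceT => y; exact: continuous_sin.
rewrite sin0 !subr0 => ->; rewrite ler_pM2r//.
apply: (@le_trans _ _ (cos 1)); first by rewrite ge_min lexx.
have wpi : w <= 1 by rewrite (le_trans wa)// ge_min lexx orbT.
have pi1 : (1 : R) <= pi by rewrite (le_trans _ (pi_ge2 R))// ler1n.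
have x1 : x < 1 by rewrite (lt_le_trans _ wpi) ?x0w.
rewrite ltW// ltr_cos// in_itv/= ?ler01//.
by rewrite x0w/= (le_trans (ltW x1)).
Qed.

Lemma cmod_circle_expi_sub (R : realType) (x y : R) :
  cmod (circle_val (circle_expi x) - circle_val (circle_expi y)) =
  2 * `|sin ((x - y) / 2)|.
Proof.
apply/eqP; rewrite -(eqrXn2 (_ : 0 < 2)%N) ?cmod_ge0 ?mulr_ge0//; apply/eqP.
rewrite sqr_cmod !reimE/= exprMn real_normK ?num_real//.
have e : x - y = ((x - y) / 2) *+ 2 by rewrite -mulr_natr divfK.
have h1 := cos_mulr2n ((x - y) / 2); rewrite -e cosB in h1.
have h2 := cos2Dsin2 x; have h3 := cos2Dsin2 y; have h4 := cos2Dsin2 ((x - y) / 2).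
rewrite -[_ *+ 2]mulr_natr in h1.
move: h1 h2 h3 h4; move: (cos _) (sin _) (cos y) (sin y) (cos x) (sin x).
move=> c s cy sy cx sx h1 h2 h3 h4.
have -> : s ^+ 2 = 1 - c ^+ 2 by rewrite -h4; ring.
have -> : c ^+ 2 = (cx * cy + sx * sy + 1) / 2 by rewrite h1; field.
have -> : (cx - cy) ^+ 2 + (sx - sy) ^+ 2 =
  (cx ^+ 2 + sx ^+ 2) + (cy ^+ 2 + sy ^+ 2) - 2 * (cx * cy + sx * sy) by ring.
by rewrite h2 h3; field.
Qed.

(** A chord is twice the sine of half the angle, and half of |x - t| stays at most b < pi because t
    is interior. The constant depends on t and must degenerate as t approaches 0 or 2 pi, which have
    the same image. *)
Lemma circle_expi_dist (R : realType) (t : R) : 0 < t -> t < 2 * pi ->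
  exists2 k : R, 0 < k & forall x, 0 <= x -> x <= 2 * pi ->
    k * `|x - t| <= cmod (circle_val (circle_expi x) - circle_val (circle_expi t)).
Proof.
move=> t0 t2; pose b := Num.max (t / 2) (pi - t / 2).
have b0 : 0 < b by rewrite lt_max divr_gt0.
have bpi : b < pi.
  by rewrite gt_max ltr_pdivrMr// mulrC t2/= ltrBlDr ltrDl divr_gt0.
have [k k0 hk] := sin_ge_linear b0 bpi; exists k => // x x0 x2.
have h : `|x - t| / 2 <= b.
  rewrite le_max; apply/orP; case: (leP t x) => tx; [right|left].
    by rewrite ger0_norm ?subr_ge0//; lra.
  by rewrite ltr0_norm ?subr_lt0//; lra.
have w0 : 0 <= `|x - t| / 2 by rewrite divr_ge0.
have := hk _ w0 h; rewrite cmod_circle_expi_sub => {}hk.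
have -> : `|sin ((x - t) / 2)| = sin (`|x - t| / 2).
  have s0 : 0 <= sin (`|x - t| / 2).
    by rewrite (le_trans _ hk)// mulr_ge0// ltW.
  case: (leP 0 (x - t)) => xt.
    by move: s0; rewrite (ger0_norm xt) => s0; rewrite ger0_norm.
  move: s0; rewrite (ltr0_norm xt) => s0.
  by rewrite -[in LHS](opprK (x - t)) mulNr sinN normrN ger0_norm.
by lra.
Qed.

Lemma circle_lebesgueE (R : realType) (A : set (circle R)) : measurable A ->
  circle_lebesgue R A = (((2 * pi)^-1)%:E *
    lebesgue_measure (`[0%R, (2 * pi)%R]%classic `&` @circle_expi R @^-1` A))%E.
Proof.
move=> mA; have mA' : measurable (@circle_expi R @^-1` A).
  by rewrite -[X in measurable X]setTI; exact: measurable_circle_expi.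
have := @integral_circleE R (fun x => (\1_A x)%:E).
rewrite integral_indic// setIT => ->; last 2 first.
- by apply/measurable_EFinP; exact: measurable_indic.
- by move=> x; rewrite lee_fin.
congr (_ * _)%E; rewrite (eq_integral (fun t => (\1_(@circle_expi R @^-1` A) t)%:E))//.
by rewrite integral_indic// setIC.
Qed.

Lemma circle_expi_compact (R : realType) (K : set R) : compact K ->
  compact (@circle_expi R @` K).
Proof.
move=> cK; apply: continuous_compact => //; apply: continuous_subspaceT.
exact: continuous_circle_expi.
Qed.

Lemma circle_regularity_inner (R : realType) (E : set (circle R)) :
  measurable E -> (0 < circle_lebesgue R E)%E ->
  exists C : set (circle R), [/\ compact C, C `<=` E & (0 < circle_lebesgue R C)%E].
Proof.
move=> mE E0; pose D := `[0%R, (2 * pi : R)%R]%classic `&` @circle_expi R @^-1` E.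
have mE' : measurable (@circle_expi R @^-1` E).
  by rewrite -[X in measurable X]setTI; exact: measurable_circle_expi.
have mD : measurable D by apply: measurableI.
have D0 : (0 < lebesgue_measure D)%E.
  rewrite lt0e measure_ge0 andbT; apply/eqP => D0; move: E0.
  by rewrite circle_lebesgueE// [X in (_ * X)%E]D0 mule0 ltxx.
have Doo : (lebesgue_measure D < +oo)%E.
  apply: (@le_lt_trans _ _ (lebesgue_measure `[0%R, (2 * pi : R)%R]%classic)).
    by apply: le_measure; rewrite ?inE//; exact: subIsetl.
  by rewrite /= lebesgue_measure_itv/=; case: ifP => _; rewrite ltry.
have fD : 0 < fine (lebesgue_measure D) by rewrite fine_gt0// D0 Doo.
have [K [cK KD DK]] := lebesgue_regularity_inner mD Doo fD.
rewrite fineK ?ge0_fin_numE// in DK.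
have mK := compact_measurable cK.
exists (@circle_expi R @` K); split.
- exact: circle_expi_compact.
- by move=> _ [t Kt <-]; have [] := KD _ Kt.
- rewrite circle_lebesgueE; last first.
    by apply: compact_circle_measurable; apply: circle_expi_compact.
  rewrite mule_gt0// ?lte_fin ?invr_gt0 ?pi2_gt0//.
  apply: (@lt_le_trans _ _ (lebesgue_measure K)); last first.
    apply: le_measure; rewrite ?inE//.
      apply: measurableI => //; rewrite -[X in measurable X]setTI.
      apply: measurable_circle_expi => //.
      by apply: compact_circle_measurable; apply: circle_expi_compact.
    by move=> t Kt; split; [case: (KD _ Kt)|exists t].
  rewrite lt0e measure_ge0 andbT; apply/eqP => K0; move: DK.
  by rewrite measureD// setIidr// [X in (_ - X)%E]K0 sube0 ltxx.
Qed.

(* The image in the circle of a null set of the line need not be visibly measurable: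
   its complement is exhausted by images of compact sets instead. *)
Lemma circle_ae_line (R : realType) (Q : circle R -> Prop) :
  {ae lebesgue_measure, forall t : R, 0 < t < 2 * pi -> Q (circle_expi t)} ->
  {ae circle_lebesgue R, forall xi, Q xi}.
Proof.
move=> [N [mN N0 QN]].
pose I := `]0%R, (2 * pi : R)%R[%classic; pose D := I `\` N.
have mI : measurable I by exact: measurable_itv.
have mD : measurable D by exact: measurableD.
have Doo : (lebesgue_measure D < +oo)%E.
  apply: (@le_lt_trans _ _ (lebesgue_measure I)).
    by apply: le_measure; rewrite ?inE//; exact: subDsetl.
  by rewrite /= lebesgue_measure_itv/=; case: ifP => _; rewrite ltry.
have /choice[K hK] : forall n : nat, exists K : set R,
    [/\ compact K, K `<=` D & (lebesgue_measure (D `\` K) < (n.+1%:R^-1)%:E)%E].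
  by move=> n; apply: lebesgue_regularity_inner => //; rewrite invr_gt0.
pose A := \bigcup_n (@circle_expi R @` (K n)).
have mA : measurable A.
  apply: bigcupT_measurable => n; have [cK _ _] := hK n.
  by apply: compact_circle_measurable; apply: circle_expi_compact.
exists (~` A); split; first exact: measurableC.
- rewrite circle_lebesgueE; last exact: measurableC.
  set S := (X in lebesgue_measure X).
  have mS : measurable S.
    apply: measurableI => //; rewrite -[X in measurable X]setTI.
    by apply: measurable_circle_expi => //; exact: measurableC.
  suff -> : lebesgue_measure S = 0%E by rewrite mule0.
  apply/eqP; rewrite eq_le measure_ge0 andbT; apply/lee_addgt0Pr => e e0.
  rewrite add0e; have [n ne] : exists n : nat, n.+1%:R^-1 < e.
    have /cvgrPdist_lt/(_ e e0) := @cvg_harmonic R.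
    move=> [n _ /(_ n (leqnn _))]/=; rewrite sub0r normrN ger0_norm; first by exists n.
    by rewrite invr_ge0.
  have [cK KD DK] := hK n; have mK := compact_measurable cK.
  (* The parameters that miss A are covered by the two endpoints, N, and the part of D missed by K
     n; only the last can have positive measure, and that measure is below 1 / (n + 1). *)
  apply: (@le_trans _ _ (lebesgue_measure (([set 0%R; 2 * pi] `|` N) `|` (D `\` K n)))).
    apply: le_measure; rewrite ?inE//.
      by apply: measurableU; [apply: measurableU => //; exact: measurableU|exact: measurableD].
    move=> t [/= t02 At]; have [Nt|Nt] := pselect (N t); first by left; right.
    have [->|tn0] := eqVneq t 0; first by left; left; left.
    have [->|tn2] := eqVneq t (2 * pi); first by left; left; right.
    right; split; last by move=> Kt; apply: At; exists n => //; exists t.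
    split => //; move: t02; rewrite /I/= !in_itv/= => /andP[? ?].
    by rewrite !lt_neqAle eq_sym tn0 tn2; apply/andP.
  apply: (le_trans (measureU2 _ _ _)) => //.
  + by apply: measurableU => //; exact: measurableU.
  + exact: measurableD.
  rewrite -[leRHS]add0e leeD//; last by rewrite (le_trans (ltW DK))// lee_fin ltW.
  apply: (le_trans (measureU2 _ _ _)) => //; first exact: measurableU.
  rewrite [X in (_ + X)%E]N0 adde0; apply: (le_trans (measureU2 _ _ _)) => //.
  by rewrite [X in (X + _)%E]lebesgue_measure_set1 add0e [leLHS]lebesgue_measure_set1.
- move=> xi /= Qxi [n _ [t Kt txi]]; apply: Qxi; rewrite -txi.
  have [_ KD _] := hK n; have [It Nt] := KD _ Kt.
  have : ~ ~ (0 < t < 2 * pi -> Q (circle_expi t)) by move=> h; apply: Nt; exact: QN.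
  by move/contrapT; apply; move: It; rewrite /I/= in_itv.
Qed.

Definition circle_ball_indic (R : realType) (xi : circle R) (rho : R) :
    circle R -> R :=
  \1_[set zeta : circle R | cmod ((zeta : R[i]) - (xi : R[i])) < rho].

Lemma bmeas_circle_ball_indic (R : realType) (xi : circle R) (rho : R) :
  bmeas (circle_ball_indic xi rho).
Proof.
apply: bmeas_indic; apply: measurable_circle_open.
rewrite openE => x /= xr; apply/circle_nbhsP.
exists (rho - cmod (circle_val x - circle_val xi)); first by rewrite subr_gt0.
move=> y yx /=.
rewrite (_ : _ - _ = (circle_val y - circle_val x) + (circle_val x - circle_val xi)).
  by rewrite (le_lt_trans (cmodD _ _))// -ltrBrDr.
by ring.
Qed.

(** The bound is in terms of rho instead of the measure of the arc of chordal radius rho, which is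
    comparable to rho. *)
Definition circle_lebesgue_pt (R : realType) (V : circle R -> R) (xi : circle R) :=
  forall eta : R, 0 < eta -> exists2 rho0 : R, 0 < rho0 &
    forall rho, 0 < rho -> rho < rho0 ->
      \int[circle_lebesgue R]_zeta
        (circle_ball_indic xi rho zeta * `|V zeta - V xi|) <= eta * rho.

Lemma locally_integrable_circle (R : realType) (V : circle R -> R) :
  bmeas V -> locally_integrable [set: R] (V \o @circle_expi R).
Proof.
move=> [mV [M VM]].
have mv : measurable_fun setT (V \o @circle_expi R).
  by apply: measurableT_comp => //; exact: measurable_circle_expi.
split => //; first exact: openT.
move=> K _ cK; have mK := compact_measurable cK.
have /integrableP[_] : lebesgue_measure.-integrable K (EFin \o (V \o @circle_expi R)).
  apply: measurable_bounded_integrable => //.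
  - exact: compact_finite_measure.
  - exact: measurable_funTS.
  - exists M; split; first exact: num_real.
    by move=> x Mx y _ /=; exact: le_trans (VM _) (ltW Mx).
exact.
Qed.

(** An arc of chordal radius rho around [circle_expi t] lies, in the parameter, within rho / k of t.
    The factor k is absorbed by asking the average on the line to be below eta k. *)
Lemma circle_lebesgue_pt_line (R : realType) (V : circle R -> R) (t : R) :
  bmeas V -> 0 < t < 2 * pi -> lebesgue_pt (V \o @circle_expi R) t ->
  circle_lebesgue_pt V (circle_expi t).
Proof.
move=> bV /andP[t0 t2] Lt eta eta0.
have [k k0 hk] := circle_expi_dist t0 t2.
have : \forall r \near (0 : R)^'+,
    (davg (V \o @circle_expi R) t r < (eta * k)%:E)%E.
  apply: (Lt [set x | (x < (eta * k)%:E)%E]); apply: open_nbhs_nbhs.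
  split; first exact: open_ereal_lt_ereal.
  by rewrite /= lte_fin mulr_gt0.
move=> /nbhs_ballP[r0 /= r00 hr]; exists (k * r0); first exact: mulr_gt0.
move=> rho rho0 rhor; pose r := rho / k.
have r_gt0 : 0 < r by rewrite divr_gt0.
have rr0 : r < r0 by rewrite ltr_pdivrMr// mulrC.
have {hr} : (davg (V \o @circle_expi R) t r < (eta * k)%:E)%E.
  by apply: hr => //=; rewrite /ball/= sub0r normrN gtr0_norm.
rewrite /davg /iavg lebesgue_measure_ball ?(ltW r_gt0)// inver.
rewrite gt_eqF ?mulrn_wgt0// => /ltW; rewrite lee_pdivrMl ?mulrn_wgt0// => h.
have bV' : bmeas (fun zeta => circle_ball_indic (circle_expi t) rho zeta *
    `|V zeta - V (circle_expi t)|).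
  apply: bmeasM; first exact: bmeas_circle_ball_indic.
  by apply: bmeas_norm; apply: bmeasB => //; exact: bmeas_cst.
rewrite -lee_fin EFin_rint// integral_circleE; last 2 first.
- by apply/measurable_EFinP; case: bV'.
- by move=> x; rewrite lee_fin mulr_ge0.
have mv : measurable_fun setT (V \o @circle_expi R).
  by apply: measurableT_comp; [case: bV|exact: measurable_circle_expi].
have mb : measurable_fun setT (fun y : R => `|((center ((V \o @circle_expi R) t) \o
   (V \o @circle_expi R)) y)%:E|%E).
  apply: measurableT_comp => //; apply/measurable_EFinP.
  by apply: measurable_funB => //; exact: measurable_cst.
have {}h : (\int[lebesgue_measure]_(x in `[0%R, (2 * pi)%R])
    (circle_ball_indic (circle_expi t) rho (circle_expi x) *
     `|V (circle_expi x) - V (circle_expi t)|)%:E <= (r *+ 2)%:E * (eta * k)%:E)%E.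
  apply: le_trans h; rewrite integral_mkcond [leRHS]integral_mkcond.
  apply: ge0_le_integral => //.
  - move=> x _; rewrite patchE; case: ifP => // _.
    by rewrite lee_fin mulr_ge0.
  - apply/(measurable_restrictT _ _).1 => //.
    apply/measurable_EFinP; apply: measurable_funTS.
    apply: (@measurableT_comp _ _ _ _ _ _ (fun zeta => circle_ball_indic (circle_expi t) rho zeta *
      `|V zeta - V (circle_expi t)|)); [by case: bV'|exact: measurable_circle_expi].
  - apply/(measurable_restrictT _ _).1; first exact: measurable_ball.
    exact: measurable_funTS.
  - move=> x _; rewrite !patchE; case: ifPn => [|_]; last first.
      by case: ifP => _; [exact: abse_ge0|exact: lexx].
    rewrite inE/= in_itv/= => /andP[x0 x2]; rewrite /circle_ball_indic indicE.
    case: (boolP (_ \in _)) => [|_]; last first.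
      by rewrite mul0r; case: ifP => _; rewrite lee_fin.
    rewrite inE/= => xt; rewrite mul1r mem_set//.
    rewrite /ball/= distrC /r ltr_pdivlMr// mulrC.
    exact: le_lt_trans (hk _ x0 x2) xt.
rewrite lee_pdivrMl ?pi2_gt0//; apply: (le_trans h).
rewrite -!EFinM lee_fin /r -mulr_natl.
rewrite (_ : 2 * (rho / k) * (eta * k) = 2 * (eta * rho)); last first.
  by field; rewrite gt_eqF.
rewrite ler_pM2r ?mulr_gt0// ler_peMr//.
by rewrite (le_trans _ (pi_ge2 R))// ler1n.
Qed.

Lemma circle_lebesgue_pt_ae (R : realType) (V : circle R -> R) : bmeas V ->
  {ae circle_lebesgue R, forall xi, circle_lebesgue_pt V xi}.
Proof.
move=> bV; apply: circle_ae_line.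
have := lebesgue_differentiation (locally_integrable_circle bV).
apply: (@filterS _ _ (ae_filter_ringOfSetsType lebesgue_measure)) => t Lt t02.
exact: circle_lebesgue_pt_line.
Qed.

Lemma poisson_le_near (R : realType) (z : R[i]) (zeta : circle R) :
  cmod z < 1 -> poisson z zeta <= 2 / (1 - cmod z).
Proof.
move=> z1; have d0 : 0 < 1 - cmod z by rewrite subr_gt0.
have h : 1 - cmod z <= cmod ((zeta : R[i]) - z).
  by rewrite -{1}(cmod_circle zeta) cmod_dist.
have h0 := lt_le_trans d0 h.
rewrite /poisson ler_pdivrMr ?exprn_gt0//.
apply: (@le_trans _ _ (2 / (1 - cmod z) * (1 - cmod z) ^+ 2)); last first.
  by rewrite ler_wpM2l ?divr_ge0 ?(ltW d0)// lerXn2r ?nnegrE ?(ltW d0) ?(ltW h0).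
rewrite expr2 mulrA divfK ?gt_eqF// -[X in X - _](expr1n _ 2) subr_sqr mulrC.
rewrite ler_pM2r//; have := ltW z1; lra.
Qed.

(** Let d = 1 - |z| and let q be the distance from zeta to xi. As q >= M d >= 2 a d, zeta is at
    least q / 2 away from z, so the kernel at z is at most 8 d / q^2. The radial point at depth M d
    is at most 2 q away from zeta, so its kernel is at least M d / (4 q^2). The quotient of the two
    bounds is 32 / M. *)
Lemma poisson_le_far (R : realType) (z : R[i]) (xi zeta : circle R) (a M : R) :
  cmod z < 1 -> 2 * a <= M -> 0 < M -> cmod (z - (xi : R[i])) < a * (1 - cmod z) ->
  M * (1 - cmod z) < 1 -> M * (1 - cmod z) <= cmod ((zeta : R[i]) - (xi : R[i])) ->
  poisson z zeta <=
    32 / M * poisson ((1 - M * (1 - cmod z))%:C * (xi : R[i])) zeta.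
Proof.
move=> z1 aM M0 za Md1; set d := 1 - cmod z; set q := cmod (_ - _) => Mdq.
have d0 : 0 < d by rewrite subr_gt0.
have Md0 : 0 < M * d by rewrite mulr_gt0.
have q0 : 0 < q := lt_le_trans Md0 Mdq.
have adq : a * d <= q / 2.
  by rewrite ler_pdivlMr// (le_trans _ Mdq)// mulrAC ler_pM2r// mulrC.
have zq : q / 2 <= cmod ((zeta : R[i]) - z).
  have := cmodD ((zeta : R[i]) - z) (z - (xi : R[i])); rewrite addrA subrK -/q.
  by move: za adq; rewrite -/d; move: (cmod _) (cmod _) => x y; lra.
have h1 : poisson z zeta <= 8 * d / q ^+ 2.
  have -> : 8 * d / q ^+ 2 = 2 * d / (q / 2) ^+ 2 by field; rewrite gt_eqF.
  have q20 : 0 < q / 2 by rewrite divr_gt0.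
  apply: ler_pM.
  - by rewrite subr_ge0 expr_le1 ?cmod_ge0 ?ltW.
  - by rewrite invr_ge0 sqr_ge0.
  - rewrite -[X in X - _](expr1n _ 2) subr_sqr -/d mulrC ler_pM2r//.
    by rewrite /d in d0; lra.
  - rewrite lef_pV2 ?posrE ?exprn_gt0 ?(lt_le_trans q20)//.
    by rewrite lerXn2r ?nnegrE ?(ltW q20)// (le_trans (ltW q20)).
set r := 1 - M * d; have r0 : 0 < r by rewrite subr_gt0.
have rE : cmod (r%:C * (xi : R[i])) = r by rewrite cmod_dilate// ltW.
have r1 : r < 1 by rewrite /r ltrBlDr ltrDl.
have wq : cmod ((zeta : R[i]) - r%:C * (xi : R[i])) <= 2 * q.
  rewrite (_ : _ - _ = ((zeta : R[i]) - (xi : R[i])) + (M * d)%:C * (xi : R[i])); last first.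
    by rewrite /r rmorphB/=; ring.
  rewrite (le_trans (cmodD _ _))// cmod_dilate ?(ltW Md0)// -/q.
  by rewrite mulr_natl mulr2n lerD2l.
have wq0 : 0 < cmod ((zeta : R[i]) - r%:C * (xi : R[i])).
  rewrite cmod_gt0 subr_eq0; apply/eqP => /(congr1 (@cmod R)).
  by rewrite rE cmod_circle => r1'; rewrite -r1' ltxx in r1.
have h2 : M * d / (4 * q ^+ 2) <= poisson (r%:C * (xi : R[i])) zeta.
  have -> : 4 * q ^+ 2 = (2 * q) ^+ 2 by ring.
  rewrite /poisson rE; apply: ler_pM.
  - exact: ltW.
  - by rewrite invr_ge0 sqr_ge0.
  - rewrite -[X in X - _](expr1n _ 2) subr_sqr {1}/r subKr ler_peMr//.
      exact: ltW.
    by rewrite lerDl ltW.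
  - rewrite lef_pV2 ?posrE ?exprn_gt0 ?mulr_gt0//.
    by rewrite lerXn2r ?nnegrE ?(ltW wq0)// mulr_ge0// ltW.
apply: (le_trans h1).
have -> : 8 * d / q ^+ 2 = 32 / M * (M * d / (4 * q ^+ 2)).
  by field; rewrite !gt_eqF.
by rewrite ler_pM2l// divr_gt0.
Qed.

(* Near xi the kernel is at most 2 / (1 - |z|) and the Lebesgue point property
   applies; at distance M (1 - |z|) or more it is at most 32 / M times another
   Poisson kernel, of integral 1. *)
Lemma poisson_nontangential (R : realType) (V : circle R -> R) (xi : circle R) :
  bmeas V -> circle_lebesgue_pt V xi ->
  forall a : R, 1 < a -> forall e : R, 0 < e -> exists2 d : R, 0 < d &
    forall z : R[i], cmod z < 1 -> cmod (z - (xi : R[i])) < a * (1 - cmod z) ->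
      cmod (z - (xi : R[i])) < d ->
      `|\int[circle_lebesgue R]_zeta (poisson z zeta * V zeta) - V xi| < e.
Proof.
move=> bV LV a a1 e e0; have [mV [B0 VB0]] := bV.
pose B := `|B0| + 1; have B_gt0 : 0 < B by rewrite ltr_wpDl.
have VB x : `|V x| <= B.
  by rewrite (le_trans (VB0 x))// (le_trans (ler_norm _))// lerDl.
have a0 : 0 < a := lt_trans ltr01 a1.
have c0 : 0 < 256 :> R by rewrite ltr0n.
have Be0 : 0 < 256 * B / e := divr_gt0 (mulr_gt0 c0 B_gt0) e0.
(* M is at least 2 a, as [poisson_le_far] requires, and large enough for the far part, 32 / M times
   the bound 2 B of |V zeta - V xi|, to be at most e / 4. *)
pose M := 2 * a + 256 * B / e.
have a20 : 0 < 2 * a by apply: mulr_gt0.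
have M0 : 0 < M by exact: addr_gt0.
have aM : 2 * a <= M by rewrite lerDl ltW.
have BM : 64 * B / M <= e / 4.
  rewrite ler_pdivrMr// /M (mulrDr (e / 4)).
  have -> : e / 4 * (256 * B / e) = 64 * B by field; rewrite gt_eqF.
  by rewrite lerDr mulr_ge0 ?divr_ge0 ?mulr_ge0 ?(ltW e0) ?(ltW a0).
(* This eta makes the near part, (2 / d) eta (M d), equal to e / 4. *)
have eta0 : 0 < e / (8 * M) by rewrite divr_gt0// mulr_gt0.
have [rho0 rho00 hrho] := LV _ eta0.
(* Since 1 - |z| <= |z - xi|, this radius makes M (1 - |z|) smaller than both rho0 and 1. *)
exists (Num.min rho0 1 / M); first by rewrite divr_gt0// lt_min rho00 ltr01.
move=> z z1 za zd; pose d := 1 - cmod z.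
have d0 : 0 < d by rewrite subr_gt0.
have dz : d <= cmod (z - (xi : R[i])).
  by rewrite cmodC /d -{1}(cmod_circle xi) cmod_dist.
have Md : M * d < Num.min rho0 1.
  by rewrite mulrC -ltr_pdivlMr// (le_lt_trans dz).
have [Mdr Md1] : M * d < rho0 /\ M * d < 1 by move: Md; rewrite lt_min => /andP.
have Md0 : 0 < M * d by rewrite mulr_gt0.
have z1' : cmod z != 1 by rewrite lt_eqF.
pose w := (1 - M * d)%:C * (xi : R[i]).
have w1 : cmod w < 1.
  by rewrite cmod_dilate ?subr_ge0 ?(ltW Md1)// ltrBlDr ltrDl.
have w1' : cmod w != 1 by rewrite lt_eqF.
have bP := bmeas_poisson z1'; have bW := bmeas_poisson w1'.
have bI := bmeas_circle_ball_indic xi (M * d).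
have bVx : bmeas (fun zeta => `|V zeta - V xi|).
  by apply: bmeas_norm; apply: bmeasB => //; exact: bmeas_cst.
have bIV : bmeas (fun zeta => circle_ball_indic xi (M * d) zeta * `|V zeta - V xi|).
  exact: bmeasM.
have -> : \int[circle_lebesgue R]_zeta (poisson z zeta * V zeta) - V xi =
    \int[circle_lebesgue R]_zeta (poisson z zeta * (V zeta - V xi)).
  under [RHS]eq_Rintegral do rewrite mulrBr (mulrC _ (V xi)).
  rewrite rintB; [|exact: bmeasM|by apply: bmeasM => //; exact: bmeas_cst].
  by rewrite rintZ// rint_poisson// mulr1.
have bPV : bmeas (fun zeta => poisson z zeta * (V zeta - V xi)).
  by apply: bmeasM => //; apply: bmeasB => //; exact: bmeas_cst.
apply: (le_lt_trans (rint_abs _ bPV)).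
apply: (@le_lt_trans _ _ (\int[circle_lebesgue R]_zeta
  (2 / d * (circle_ball_indic xi (M * d) zeta * `|V zeta - V xi|) +
   64 * B / M * poisson w zeta))).
  apply: rint_le; first exact: bmeas_norm.
    by apply: bmeasD; apply: bmeasM => //; exact: bmeas_cst.
  move=> zeta; rewrite normrM ger0_norm ?poisson_ge0//.
  rewrite /circle_ball_indic indicE; case: (boolP (_ \in _)) => [_|].
    rewrite mul1r -[leLHS]addr0 lerD//.
      by rewrite ler_wpM2r// poisson_le_near.
    rewrite mulr_ge0 ?poisson_ge0// divr_ge0 ?mulr_ge0//; exact: ltW.
  rewrite notin_setE/= => /negP; rewrite -leNgt => Mdz.
  rewrite mul0r mulr0 add0r.
  have := poisson_le_far z1 aM M0 za Md1 Mdz; rewrite -/d -/w => hp.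
  have -> : 64 * B / M * poisson w zeta = 32 / M * poisson w zeta * (2 * B).
    by field; rewrite gt_eqF.
  rewrite ler_pM ?poisson_ge0// (le_trans (ler_normB _ _))//.
  by rewrite mulr_natl mulr2n lerD.
rewrite rintD; last 2 first.
- by apply: bmeasM => //; exact: bmeas_cst.
- by apply: bmeasM => //; exact: bmeas_cst.
rewrite (rintZ _ _ bIV) (rintZ _ _ bW) rint_poisson// mulr1.
have hI := hrho _ Md0 Mdr.
have h2 : 2 / d * \int[circle_lebesgue R]_zeta
    (circle_ball_indic xi (M * d) zeta * `|V zeta - V xi|) <= e / 4.
  apply: (@le_trans _ _ (2 / d * (e / (8 * M) * (M * d)))).
    by rewrite ler_wpM2l// divr_ge0// ltW.
  by rewrite le_eqVlt; apply/orP; left; apply/eqP; field; rewrite !gt_eqF.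
have : e / 4 + e / 4 < e by rewrite -[ltRHS]mulr1; lra.
by apply: le_lt_trans; exact: lerD.
Qed.

(** * Fatou's theorem for bounded holomorphic functions *)

Lemma poly_lipschitz (R : realType) (p : {poly R[i]}) :
  exists2 L : R, 0 < L & forall z w, cmod z <= 1 -> cmod w <= 1 ->
    cmod (p.[z] - p.[w]) <= L * cmod (z - w).
Proof.
elim/poly_ind: p => [|p c [L L0 pL]].
  exists 1 => // z w _ _; rewrite !horner0 subrr cmod0 mul1r; exact: cmod_ge0.
have [B B0 pB] := poly_bound 1 p.
exists (B + L); first by rewrite addr_gt0.
move=> z w z1 w1; rewrite !hornerMXaddC.
rewrite (_ : _ - _ = p.[z] * (z - w) + (p.[z] - p.[w]) * w); last by ring.
rewrite (le_trans (cmodD _ _))// !cmodM mulrDl lerD//.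
  by rewrite ler_wpM2r ?cmod_ge0// pB.
rewrite -[leRHS]mulr1 ler_pM ?cmod_ge0//; exact: pL.
Qed.

Lemma holo_continuous (R : realType) (u : R[i] -> R[i]) (z : R[i]) :
  holo u -> cmod z < 1 -> forall e : R, 0 < e -> exists2 d : R, 0 < d &
    forall w, cmod (w - z) < d -> cmod (u w - u z) < e.
Proof.
move=> hu z1 e e0; pose s := (1 + cmod z) / 2.
have s1 : s < 1 by rewrite ltr_pdivrMr// mul1r; lra.
have zs : cmod z < s by rewrite ltr_pdivlMr//; lra.
have e40 : 0 < e / 4 by rewrite divr_gt0.
have [p up] := hu _ s1 _ e40; have [L L0 pL] := poly_lipschitz p.
exists (Num.min (s - cmod z) (e / 4 / L)).
  by rewrite lt_min subr_gt0 zs divr_gt0.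
move=> w; rewrite lt_min => /andP[ws wL].
have ws' : cmod w < s.
  by rewrite -(subrK z w) (le_lt_trans (cmodD _ _))// -ltrBrDr.
rewrite (_ : _ - _ = (u w - p.[w]) + (p.[w] - p.[z]) - (u z - p.[z])); last by ring.
rewrite (le_lt_trans (cmodB _ _))//.
apply: (@le_lt_trans _ _ (e / 4 + e / 4 + e / 4)); last by lra.
rewrite lerD ?up ?(ltW zs)//.
rewrite (le_trans (cmodD _ _))// lerD ?up ?(ltW ws')//.
rewrite (le_trans (pL _ _ (ltW (lt_trans ws' s1)) (ltW z1)))// mulrC.
by rewrite -ler_pdivlMr// ltW.
Qed.

Lemma holo_radial_cvg (R : realType) (u : R[i] -> R[i]) (z : R[i])
    (s : nat -> R) : holo u -> cmod z < 1 -> s n @[n --> \oo] --> (1 : R) ->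
  forall e : R, 0 < e -> \forall n \near \oo, cmod (u ((s n)%:C * z) - u z) < e.
Proof.
move=> hu z1 s1 e e0; have [d d0 ud] := holo_continuous hu z1 e0.
have /cvgrPdist_lt/(_ d d0) := s1; apply: filterS => n /= sn; apply: ud.
rewrite (_ : _ - _ = (s n - 1)%:C * z); last by rewrite rmorphB/=; ring.
rewrite cmodM cmod_real distrC (le_lt_trans _ sn)//.
by rewrite ler_piMr// ltW.
Qed.

Lemma cvg_Re_cmod (R : realType) (f : nat -> R[i]) (l : R[i]) :
  (forall e : R, 0 < e -> \forall n \near \oo, cmod (f n - l) < e) ->
  complex.Re (f n) @[n --> \oo] --> complex.Re l.
Proof.
move=> h; apply/cvgrPdist_lt => e e0; have := h e e0.
apply: filterS => n; apply: le_lt_trans.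
by rewrite distrC -ReN -ReD Re_le_cmod.
Qed.

Lemma cvg_Im_cmod (R : realType) (f : nat -> R[i]) (l : R[i]) :
  (forall e : R, 0 < e -> \forall n \near \oo, cmod (f n - l) < e) ->
  complex.Im (f n) @[n --> \oo] --> complex.Im l.
Proof.
move=> h; apply/cvgrPdist_lt => e e0; have := h e e0.
apply: filterS => n; apply: le_lt_trans.
by rewrite distrC -ImN -ImD Im_le_cmod.
Qed.

Lemma poisson_limit_unique (R : realType) (f : nat -> circle R -> R)
    (V : circle R -> R) (z : R[i]) (B l : R) : cmod z < 1 ->
  (forall n, bmeas (f n)) -> bmeas V -> (forall n xi, `|f n xi| <= B) ->
  {ae circle_lebesgue R, forall xi, f n xi @[n --> \oo] --> V xi} ->
  \int[circle_lebesgue R]_xi (poisson z xi * f n xi) @[n --> \oo] --> l ->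
  l = \int[circle_lebesgue R]_xi (poisson z xi * V xi).
Proof.
move=> z1 bf bV fB cf cl; have z1' : cmod z != 1 by rewrite lt_eqF.
have bP := bmeas_poisson z1'; have [mP [M PM]] := bP.
apply: cvg_unique cl _ => //.
apply: (@rint_dominated _ _ _ _ _ _ (M * B)).
- by move=> n; have [] := bmeasM bP (bf n).
- by have [] := bmeasM bP bV.
- by move=> n x; rewrite normrM ler_pM.
- by apply: filterS cf => x cx; apply: cvgMr.
Qed.

(** Poisson's formula holds for every dilate of u. As the radius tends to 1, the value at z
    converges by continuity and the integral by dominated convergence. *)
Lemma holo_poisson (R : realType) (u : R[i] -> R[i]) (B : R) (s : nat -> R)
    (U : circle R -> R[i]) : holo u ->
  (forall z, cmod z < 1 -> cmod (u z) <= B) ->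
  (forall n, 0 <= s n < 1) -> s n @[n --> \oo] --> (1 : R) -> bmeasC U ->
  {ae circle_lebesgue R, forall xi : circle R,
    complex.Re (u ((s n)%:C * (xi : R[i]))) @[n --> \oo] --> complex.Re (U xi) /\
    complex.Im (u ((s n)%:C * (xi : R[i]))) @[n --> \oo] --> complex.Im (U xi)} ->
  forall z, cmod z < 1 -> u z =
    (\int[circle_lebesgue R]_xi (poisson z xi * complex.Re (U xi))) +i*
    (\int[circle_lebesgue R]_xi (poisson z xi * complex.Im (U xi))).
Proof.
move=> hu uB s01 s1 [bU1 bU2] cu z z1.
have s0 n : 0 <= s n by case/andP: (s01 n).
have sl n : s n < 1 by case/andP: (s01 n).
have bu n : bmeasC (fun xi : circle R => u ((s n)%:C * (xi : R[i]))).
  by apply: bmeasC_poly_approx => //; exact: hu.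
have uB' n (xi : circle R) : cmod (u ((s n)%:C * (xi : R[i]))) <= B.
  by apply: uB; rewrite cmod_dilate.
have pu n := poisson_poly_approx (s0 n) (hu _ (sl n)) z1.
apply: eq_reim => /=.
  apply: (@poisson_limit_unique _
    (fun n (xi : circle R) => complex.Re (u ((s n)%:C * (xi : R[i])))) _ _ B) => //.
  - by move=> n; case: (bu n).
  - by move=> n xi; rewrite (le_trans (Re_le_cmod _)).
  - by apply: filterS cu => xi [].
  - rewrite (_ : (fun n => _) = fun n => complex.Re (u ((s n)%:C * z))).
      by apply: cvg_Re_cmod; exact: holo_radial_cvg.
    apply/funext => n; rewrite -pu /cintegral/=; apply: eq_Rintegral => x _.
    by rewrite reimE/= mul0r subr0.
apply: (@poisson_limit_unique _
    (fun n (xi : circle R) => complex.Im (u ((s n)%:C * (xi : R[i])))) _ _ B) => //.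
- by move=> n; case: (bu n).
- by move=> n xi; rewrite (le_trans (Im_le_cmod _)).
- by apply: filterS cu => xi [].
- rewrite (_ : (fun n => _) = fun n => complex.Im (u ((s n)%:C * z))).
    by apply: cvg_Im_cmod; exact: holo_radial_cvg.
  apply/funext => n; rewrite -pu /cintegral/=; apply: eq_Rintegral => x _.
  by rewrite reimE/= mul0r addr0.
Qed.

Lemma holo_fatou (R : realType) (u : R[i] -> R[i]) (B : R) : holo u ->
  (forall z, cmod z < 1 -> cmod (u z) <= B) ->
  exists2 U : circle R -> R[i], bmeasC U &
    {ae circle_lebesgue R, forall xi, nontangential_limit (@disc R) u xi (U xi)}.
Proof.
move=> hu uB; have [s [U [s01 s1 bU cu]]] := holo_boundary hu uB.
exists U => //; have uE := holo_poisson hu uB s01 s1 bU cu.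
have [bU1 bU2] := bU.
apply: filterS2 (circle_lebesgue_pt_ae bU1) (circle_lebesgue_pt_ae bU2).
move=> xi L1 L2; apply/nontangential_limitP => a a1 e e0.
have e20 : 0 < e / 2 by rewrite divr_gt0.
have [d1 d10 h1] := poisson_nontangential bU1 L1 a1 e20.
have [d2 d20 h2] := poisson_nontangential bU2 L2 a1 e20.
exists (Num.min d1 d2); first by rewrite lt_min d10.
move=> z /discP z1; rewrite ger0_norm ?subr_ge0 ?(ltW z1)// => za.
rewrite lt_min => /andP[zd1 zd2]; rewrite (le_lt_trans (cmod_le_reim _))//.
rewrite [e]splitr ReD ReN ImD ImN (uE _ z1).
by apply: ltrD; [exact: h1|exact: h2].
Qed.

Lemma nontangential_radial (R : realType) (u : R[i] -> R[i]) (xi : circle R)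
    (l : R[i]) (s : nat -> R) : (forall n, 0 <= s n < 1) ->
  s n @[n --> \oo] --> (1 : R) -> nontangential_limit (@disc R) u xi l ->
  forall e : R, 0 < e ->
    \forall n \near \oo, cmod (u ((s n)%:C * (xi : R[i])) - l) < e.
Proof.
move=> s01 s1 /nontangential_limitP/(_ 2 (ltr1n _ _)) ul e e0.
have [d d0 dh] := ul e e0.
have /cvgrPdist_lt/(_ d d0) := s1; apply: filterS => n /= sn.
have /andP[s0 sl] := s01 n.
have h : cmod ((s n)%:C * (xi : R[i]) - (xi : R[i])) = 1 - s n.
  rewrite (_ : _ - _ = (s n - 1)%:C * (xi : R[i])); last first.
    by rewrite rmorphB/=; ring.
  by rewrite cmodM cmod_real cmod_circle mulr1 distrC ger0_norm// subr_ge0 ltW.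
apply: dh.
- by apply/discP; rewrite cmod_dilate.
- by rewrite h cmod_dilate// ger0_norm ?subr_ge0 ?(ltW sl)// ltr_pMl ?subr_gt0// ltr1n.
- by rewrite h -[ltLHS]ger0_norm ?subr_ge0 ?(ltW sl).
Qed.

(** * Uniqueness of boundary values *)

Lemma poisson_cauchy (R : realType) (P : probability (circle R) R)
    (f : circle R -> R) (z : R[i]) : bmeas f -> cmod z != 1 ->
  \int[P]_x (poisson z x * f x) =
  2 * complex.Re (cauchy_transform P (fun x => (f x)%:C) z) - \int[P]_x f x.
Proof.
move=> bf z1; have [bk _] := bmeasC_kernel z1.
rewrite /cauchy_transform /cintegral/= -rintZ; last first.
  have [] // := bmeasC_cauchy (bmeasC_real bf) z1.
rewrite -rintB//; last first.
  apply: bmeasM; first exact: bmeas_cst.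
  by have [] := bmeasC_cauchy (bmeasC_real bf) z1.
apply: eq_Rintegral => x _; rewrite poissonE// ReM/= mul0r subr0.
by ring.
Qed.

(** Once 1 - s < e / 2, the points of C are at least e / 2 away from s xi, and the kernel on C is at
    most 8 (1 - s) / e^2. *)
Lemma poisson_off_compact (R : realType) (C : set (circle R)) (xi : circle R)
    (s : nat -> R) : compact C -> ~ C xi -> (forall n, 0 <= s n < 1) ->
  s n @[n --> \oo] --> (1 : R) ->
  \int[circle_lebesgue R]_x (poisson ((s n)%:C * circle_val xi) x * \1_C x)
    @[n --> \oo] --> (0 : R).
Proof.
move=> cC Cxi s01 s1; have mC := compact_circle_measurable cC.
have [e e0 Ce] := compact_circle_dist cC Cxi.
apply/cvgrPdist_lt => eps eps0.
have d0 : 0 < Num.min (e / 2) (eps * e ^+ 2 / 16).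
  by rewrite lt_min !divr_gt0// mulr_gt0// exprn_gt0.
have /cvgrPdist_lt/(_ _ d0) := s1; apply: filterS => n /=.
have /andP[sn0 sn1] := s01 n.
have t0 : 0 < 1 - s n by rewrite subr_gt0.
rewrite ger0_norm ?(ltW t0)// lt_min => /andP[se seps].
have z1 : cmod ((s n)%:C * circle_val xi) < 1 by rewrite cmod_dilate.
have z1' : cmod ((s n)%:C * circle_val xi) != 1 by rewrite lt_eqF.
rewrite sub0r normrN ger0_norm; last first.
  by apply: Rintegral_ge0 => x _; rewrite mulr_ge0 ?poisson_ge0.
apply: (@le_lt_trans _ _ (8 * (1 - s n) / e ^+ 2)); last first.
  rewrite ltr_pdivrMr ?exprn_gt0//.
  have : 0 < eps * e ^+ 2 by rewrite mulr_gt0// exprn_gt0.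
  by move: seps; rewrite ltr_pdivlMr//; lra.
apply: rint_bound.
  by apply: bmeasM; [exact: bmeas_poisson|exact: bmeas_indic].
move=> x; rewrite indicE; case: (boolP (x \in C)) => [|_]; last first.
  by rewrite mulr0 divr_ge0 ?exprn_ge0 ?mulr_ge0 ?(ltW t0) ?(ltW e0).
rewrite inE mulr1 => /Ce ex.
have h : e / 2 <= cmod (circle_val x - (s n)%:C * circle_val xi).
  have := cmod_dist (circle_val x - circle_val xi) ((s n - 1)%:C * circle_val xi).
  rewrite (_ : _ - _ - _ = circle_val x - (s n)%:C * circle_val xi); last first.
    by rewrite rmorphB/=; ring.
  rewrite cmodM cmod_real cmod_circle mulr1 distrC (ger0_norm (ltW t0)).
  by apply: le_trans; lra.
have e20 : 0 < e / 2 by rewrite divr_gt0.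
rewrite /poisson cmod_dilate//.
have -> : 8 * (1 - s n) / e ^+ 2 = 2 * (1 - s n) / (e / 2) ^+ 2.
  by field; rewrite gt_eqF.
apply: ler_pM.
- by rewrite subr_ge0 expr_le1// ltW.
- by rewrite invr_ge0 sqr_ge0.
- rewrite -[X in X - _](expr1n _ 2) subr_sqr mulrC ler_pM2r//.
  by lra.
- by rewrite lef_pV2 ?posrE ?exprn_gt0 ?(lt_le_trans e20 h)// lerXn2r ?nnegrE ?cmod_ge0 ?(ltW e20).
Qed.

Lemma poisson_indic_le1 (R : realType) (C : set (circle R)) (z : R[i]) :
  measurable C -> cmod z < 1 ->
  0 <= \int[circle_lebesgue R]_x (poisson z x * \1_C x) <= 1.
Proof.
move=> mC z1; have z1' : cmod z != 1 by rewrite lt_eqF.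
apply/andP; split.
  by apply: Rintegral_ge0 => x _; rewrite mulr_ge0 ?poisson_ge0.
rewrite -(rint_poisson z1); apply: rint_le.
- by apply: bmeasM; [exact: bmeas_poisson|exact: bmeas_indic].
- exact: bmeas_poisson.
- move=> x; rewrite indicE; case: (_ \in _); rewrite ?mulr1 ?mulr0//.
  exact: poisson_ge0.
Qed.

Lemma holoM (R : realType) (u v : R[i] -> R[i]) :
  holo u -> holo v -> holo (fun z => u z * v z).
Proof. by move=> hu hv s s1; apply: poly_approxM; [exact: hu|exact: hv]. Qed.

Lemma holoD (R : realType) (u v : R[i] -> R[i]) :
  holo u -> holo v -> holo (fun z => u z + v z).
Proof. by move=> hu hv s s1; apply: poly_approxD; [exact: hu|exact: hv]. Qed.

Lemma holoX (R : realType) (u : R[i] -> R[i]) n :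
  holo u -> holo (fun z => u z ^+ n).
Proof. by move=> hu s s1; apply: poly_approxX; exact: hu. Qed.

Lemma holo_cst (R : realType) (c : R[i]) : holo (fun _ : R[i] => c).
Proof. by move=> s s1; exact: poly_approx_cst. Qed.

Lemma holo_mean (R : realType) (u : R[i] -> R[i]) (s : R) : holo u ->
  0 <= s -> s < 1 ->
  cintegral (circle_lebesgue R) (fun xi : circle R => u (s%:C * circle_val xi)) = u 0.
Proof.
move=> hu s0 s1; have c01 : cmod (0 : R[i]) < 1 by rewrite cmod0.
have := poisson_poly_approx s0 (hu _ s1) c01; rewrite mulr0 => <-.
congr cintegral; apply/funext => xi; rewrite /poisson subr0 cmod_circle cmod0.
by rewrite expr0n/= subr0 expr1n invr1 mulr1 mul1r.
Qed.

Lemma expr_unbounded (R : realType) (q x B : R) : 1 < q -> 0 < x ->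
  (forall n, x * q ^+ n <= B) -> False.
Proof.
move=> q1 x0 h; have q0 : 0 < q := lt_trans ltr01 q1.
have B0 : 0 < B by rewrite (lt_le_trans x0)//; have := h 0%N; rewrite expr0 mulr1.
have [N hN] : exists N, q^-1 ^+ N < x / B.
  by apply: expr_small; rewrite ?invr_ge0 ?(ltW q0) ?divr_gt0 ?invf_lt1.
move: hN; rewrite exprVn ltr_pdivlMr// mulrC ltr_pdivrMr ?exprn_gt0//.
by rewrite ltNge h.
Qed.

Lemma cvgX_real (R : realType) (f : nat -> R) (l : R) n :
  f k @[k --> \oo] --> l -> f k ^+ n @[k --> \oo] --> l ^+ n.
Proof.
move=> fl; elim: n => [|n IH].
  by under eq_fun do rewrite expr0; rewrite expr0; exact: cvg_cst.
by under eq_fun do rewrite exprS; rewrite exprS; exact: cvgM.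
Qed.

(* With H the Herglotz integral of 1_C, Q = (2 + H) / (2 - H) satisfies
   |Q|^2 <= 1 + 8 Re H, hence is unimodular at most off C at the boundary,
   while Q 0 > 1 when C is not null. Since u vanishes on C, the mean value
   property for u Q^(2n) bounds |u 0| |Q 0|^(2n) uniformly in n. *)
Lemma holo_uniqueness (R : realType) (u : R[i] -> R[i]) (B : R)
    (C : set (circle R)) (s : nat -> R) : holo u ->
  (forall z, cmod z < 1 -> cmod (u z) <= B) -> u 0 != 0 -> compact C ->
  (forall n, 0 <= s n < 1) -> s n @[n --> \oo] --> (1 : R) ->
  (forall xi : circle R, C xi -> forall e : R, 0 < e ->
    \forall n \near \oo, cmod (u ((s n)%:C * circle_val xi)) < e) ->
  circle_lebesgue R C = 0%E.
Proof.
move=> hu uB u0 cC s01 s1 uC; have mC := compact_circle_measurable cC.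
set m := circle_lebesgue R.
have bC : bmeas (\1_C : circle R -> R) by exact: bmeas_indic.
pose c := fine (m C).
have mCfin : m C \is a fin_num by exact: fin_num_measure.
have cint1 : \int[m]_x \1_C x = c by rewrite rint_indic.
apply: contrapT => mC0.
have c0 : 0 < c.
  by rewrite fine_gt0// lt0e measure_ge0 andbT -ge0_fin_numE// mCfin andbT; apply/eqP.
have c1 : c <= 1 by rewrite -lee_fin fineK// probability_le1.
pose H z := 2 * cauchy_transform m (fun x => (\1_C x)%:C) z - c%:C.
have hH : holo H.
  apply: holoD; last exact: holo_cst.
  apply: holoM; first exact: holo_cst.
  by apply: holo_cauchy; exact: bmeasC_real.
have ReH z : cmod z < 1 -> complex.Re (H z) = \int[m]_x (poisson z x * \1_C x).
  move=> z1; rewrite poisson_cauchy ?lt_eqF// cint1 /H !reimE/= ?mul0r ?subr0.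
  by rewrite ?addr0 ?oppr0 mul0r subr0.
have H0 : H 0 = c%:C.
  rewrite /H /cauchy_transform (_ : (fun xi : circle R => _) = fun x => (\1_C x)%:C).
    by rewrite cint_real cint1; apply: eq_reim; rewrite !reimE/=; ring.
  by apply/funext => x; rewrite mulr0 subr0 divr1.
(* As 0 <= Re H <= 1, the shift by 2 keeps the denominator at modulus at least 1, and |2 + H|^2 - |2
   - H|^2 = 8 Re H. *)
pose Q z := (2 + H z) * (2 - H z)^-1.
have Re2H z : cmod z < 1 -> 1 <= complex.Re (2 - H z).
  move=> z1; rewrite ReD ReN ReH//.
  by have /andP[_] := poisson_indic_le1 mC z1; rewrite -/m/=; lra.
have hQ : holo Q.
  apply: holoM; first by apply: holoD => //; exact: holo_cst.
  move=> r r1; apply: (@poly_approx_inv _ _ 1) => // [z zr|].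
    by apply: Re2H; exact: le_lt_trans r1.
  apply: poly_approxD; first exact: poly_approx_cst.
  by apply: poly_approxN; exact: hH.
have Q2 z : cmod z < 1 -> cmod (Q z) ^+ 2 <= 1 + 8 * complex.Re (H z).
  move=> z1; have h1 := Re2H _ z1; have := poisson_indic_le1 mC z1.
  rewrite -/m -ReH// => /andP[p0 p1].
  have h2 : 1 <= cmod (2 - H z) ^+ 2.
    rewrite -[leLHS](expr1n _ 2) lerXn2r ?nnegrE ?cmod_ge0//.
    by rewrite (le_trans h1)// (le_trans (ler_norm _))// Re_le_cmod.
  rewrite /Q cmodM cmodV exprMn exprVn ler_pdivrMr; last exact: lt_le_trans h2.
  have -> : cmod (2 + H z) ^+ 2 = cmod (2 - H z) ^+ 2 + 8 * complex.Re (H z).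
    by move: (H z) => w; rewrite !sqr_cmod !reimE/=; ring.
  move: (cmod _ ^+ 2) h2 (complex.Re _) p0 => A hA r r0.
  rewrite -subr_ge0 (_ : _ - _ = 8 * r * (A - 1)); last by ring.
  by rewrite !mulr_ge0// subr_ge0.
pose q := (2 + c) / (2 - c).
have q1 : 1 < q by rewrite ltr_pdivlMr; lra.
have Q0 : Q 0 = q%:C.
  by rewrite /Q H0 /q rmorphM fmorphV rmorphB rmorphD /= !rmorph_nat.
have s0 n : 0 <= s n by case/andP: (s01 n).
have sl n : s n < 1 by case/andP: (s01 n).
have B0 : 0 <= B by rewrite (le_trans (cmod_ge0 (u 0)))// uB// cmod0.
apply: (@expr_unbounded _ (q ^+ 2) (cmod (u 0)) B).
- by rewrite exprn_egt1.
- by rewrite cmod_gt0.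
move=> n.
pose p k (xi : circle R) := 1 + 8 * complex.Re (H ((s k)%:C * circle_val xi)).
have bu k : bmeasC (fun xi : circle R => u ((s k)%:C * circle_val xi)).
  by apply: bmeasC_poly_approx => //; exact: hu.
have bp k : bmeas (p k).
  apply: bmeasD; first exact: bmeas_cst.
  apply: bmeasM; first exact: bmeas_cst.
  by have [] := bmeasC_poly_approx (s0 k) (hH _ (sl k)).
have pbound k xi : 1 <= p k xi <= 9.
  have z1 : cmod ((s k)%:C * circle_val xi) < 1 by rewrite cmod_dilate.
  rewrite /p ReH//; have /andP[? ?] := poisson_indic_le1 mC z1.
  by apply/andP; split; rewrite /m; lra.
(* A majorant of |u Q^(2n)|. On C the power is bounded crudely by 9^n, as p <= 1 + 8, and u tends to
   0; off C, |u| is bounded by B and p tends to 1. *)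
pose g k (xi : circle R) := \1_C xi * (cmod (u ((s k)%:C * circle_val xi)) * 9 ^+ n)
  + B * (\1_(~` C) xi * p k xi ^+ n).
have mCC : measurable (~` C) by exact: measurableC.
have bg k : bmeas (g k).
  apply: bmeasD; apply: bmeasM.
  - exact: bC.
  - by apply: bmeasM; [exact: bmeas_cmod (bu k)|exact: bmeas_cst].
  - exact: bmeas_cst.
  - by apply: bmeasM; [exact: bmeas_indic|exact: bmeasX].
have step k : cmod (u 0) * (q ^+ 2) ^+ n <= \int[m]_xi g k xi.
  have hG : holo (fun z => u z * Q z ^+ (2 * n)) by apply: holoM => //; exact: holoX.
  have bG := bmeasC_poly_approx (s0 k) (hG _ (sl k)).
  have := holo_mean hG (s0 k) (sl k); rewrite Q0 => h.
  have -> : cmod (u 0) * (q ^+ 2) ^+ n = cmod (u 0 * q%:C ^+ (2 * n)).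
    by rewrite cmodM cmodX cmod_real gtr0_norm ?exprM// (lt_trans ltr01).
  rewrite -h (le_trans (cint_cmod_le _ bG))//; apply: rint_le => //.
    exact: bmeas_cmod.
  move=> xi; have z1 : cmod ((s k)%:C * circle_val xi) < 1 by rewrite cmod_dilate.
  have /andP[p1 p9] := pbound k xi.
  have p0 : 0 <= p k xi by rewrite (le_trans _ p1).
  have hq : cmod (Q ((s k)%:C * circle_val xi)) ^+ (2 * n) <= p k xi ^+ n.
    by rewrite exprM lerXn2r ?nnegrE ?sqr_ge0// Q2.
  rewrite cmodM cmodX /g !indicE; case: (boolP (xi \in C)) => xiC.
    have -> : (xi \in ~` C) = false.
      by apply: memNset => /=; apply; exact: set_mem.
    rewrite mul1r mul0r mulr0 addr0 ler_pM ?cmod_ge0 ?exprn_ge0 ?cmod_ge0//.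
    by rewrite (le_trans hq)// lerXn2r ?nnegrE.
  have -> : (xi \in ~` C) = true.
    by apply: mem_set => /=; move: xiC; rewrite notin_setE.
  rewrite mul0r add0r mul1r ler_pM ?cmod_ge0 ?exprn_ge0 ?cmod_ge0//.
  exact: uB.
have lim : \int[m]_xi g k xi @[k --> \oo] --> \int[m]_xi (B * \1_(~` C) xi).
  apply: (@rint_dominated _ _ _ _ _ _ (B * 9 ^+ n + B * 9 ^+ n)).
  - by move=> k; case: (bg k).
  - suff [] : bmeas (fun xi : circle R => B * \1_(~` C) xi) by [].
    by apply: bmeasM; [exact: bmeas_cst|exact: bmeas_indic].
  - move=> k xi; have /andP[p1 p9] := pbound k xi.
    have p0 : 0 <= p k xi by rewrite (le_trans _ p1).
    have p9n : p k xi ^+ n <= 9 ^+ n by rewrite lerXn2r ?nnegrE.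
    have z1 : cmod ((s k)%:C * circle_val xi) < 1 by rewrite cmod_dilate.
    have i01 (A : set (circle R)) : 0 <= (\1_A xi : R) <= 1.
      by rewrite indicE; case: (_ \in _); rewrite lexx ler01.
    have /andP[i0 i1] := i01 C; have /andP[j0 j1] := i01 (~` C).
    have x0 : 0 <= cmod (u ((s k)%:C * circle_val xi)) * 9 ^+ n.
      by rewrite mulr_ge0 ?cmod_ge0 ?exprn_ge0.
    rewrite ger0_norm ?addr_ge0 ?mulr_ge0 ?exprn_ge0 ?cmod_ge0//.
    rewrite lerD//.
      rewrite (le_trans (ler_piMl x0 i1))// ler_wpM2r ?exprn_ge0//.
      exact: uB.
    by rewrite ler_wpM2l// (le_trans _ p9n)// ler_piMl// exprn_ge0.
  - apply: aeW => xi; have [Cxi|Cxi] := pselect (C xi).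
      have e1 : \1_C xi = 1 :> R by rewrite indicE mem_set.
      have e2 : \1_(~` C) xi = 0 :> R by rewrite indicE memNset//=; apply.
      rewrite e2 mulr0.
      rewrite (_ : (fun k => g k xi) = fun k => cmod (u ((s k)%:C * circle_val xi)) * 9 ^+ n); last first.
        by apply/funext => k; rewrite /g e1 e2 mul1r mul0r mulr0 addr0.
      rewrite -(mul0r (9 ^+ n)); apply: cvgMl.
      apply/cvgrPdist_lt => e e0; have := uC _ Cxi e e0.
      by apply: filterS => k; rewrite sub0r normrN ger0_norm ?cmod_ge0.
    have e1 : \1_C xi = 0 :> R by rewrite indicE memNset.
    have e2 : \1_(~` C) xi = 1 :> R by rewrite indicE mem_set.
    rewrite e2 mulr1.
    rewrite (_ : (fun k => g k xi) = fun k => B * p k xi ^+ n); last first.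
      by apply/funext => k; rewrite /g e1 e2 mul1r mul0r add0r.
    rewrite -[X in _ --> X]mulr1; apply: cvgMr.
    rewrite -[X in _ --> X](expr1n _ n); apply: (@cvgX_real _ (p^~ xi)).
    rewrite -[X in _ --> X]addr0; apply: cvgD; first exact: cvg_cst.
    rewrite -[X in _ --> X](mulr0 8); apply: cvgMr.
    rewrite (_ : (fun k => _) = fun k =>
      \int[m]_x (poisson ((s k)%:C * circle_val xi) x * \1_C x)).
      exact: poisson_off_compact.
    by apply/funext => k; rewrite ReH// cmod_dilate.
have limB : \int[m]_xi (B * \1_(~` C) xi) <= B.
  apply: rint_bound; first by apply: bmeasM; [exact: bmeas_cst|exact: bmeas_indic].
  move=> xi; rewrite indicE; case: (_ \in _); rewrite ?mulr1 ?mulr0//.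
apply: le_trans limB; rewrite -(cvg_lim _ lim)//.
apply: limr_ge; first by apply/cvg_ex; eexists; exact: lim.
exact: nearW.
Qed.

(** * The Poisson integral of a measure *)

(** The sum is delta times the integer part of y / delta. *)
Lemma layer_sum (R : realType) (delta y : R) n : 0 < delta -> 0 <= y ->
  y <= n%:R * delta ->
  y - delta <= \sum_(i < n) delta * (i.+1%:R * delta <= y)%R%:R <= y.
Proof.
move=> d0 y0.
have full k : k%:R * delta <= y ->
    \sum_(i < k) delta * (i.+1%:R * delta <= y)%R%:R = k%:R * delta.
  move=> ky; rewrite (eq_bigr (fun=> delta)) => [|i _].
    by rewrite sumr_const card_ord mulr_natl.
  rewrite (_ : (_ <= y) = true) ?mulr1//; apply: le_trans ky.
  by rewrite ler_pM2r// ler_nat ltn_ord.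
have ub k : \sum_(i < k) delta * (i.+1%:R * delta <= y)%R%:R <= y.
  elim: k => [|k IH]; first by rewrite big_ord0.
  have [ky|ky] := leP (k.+1%:R * delta) y; first by rewrite full.
  by rewrite big_ord_recr/= (lt_geF ky) mulr0 addr0.
move=> yn; rewrite ub andbT; elim: n yn => [|n IH] yn.
  by rewrite big_ord0; move: yn; rewrite mul0r; lra.
rewrite big_ord_recr/=; have [ny|ny] := leP (n%:R * delta) y.
  rewrite full//; move: yn; rewrite -natr1 mulrDl mul1r => yn.
  have : 0 <= delta * ((n%:R + 1) * delta <= y)%R%:R by rewrite mulr_ge0// ltW.
  by rewrite mulrDl mul1r; lra.
by rewrite (le_trans (IH (ltW ny)))// lerDl mulr_ge0// ltW.
Qed.

(** The hypothesis on sets says that the measure of density k with respect to Q is at most P.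
    Slicing f into level sets of height delta passes this to functions, at the cost of delta times a
    bound of k. *)
Lemma rint_density_le d (T : measurableType d) (R : realType)
    (P Q : probability T R) (k f : T -> R) : bmeas k -> (forall x, 0 <= k x) ->
  bmeas f -> (forall x, 0 <= f x) ->
  (forall A, measurable A -> \int[Q]_x (\1_A x * k x) <= fine (P A)) ->
  \int[Q]_x (f x * k x) <= \int[P]_x f x.
Proof.
move=> bk k0 bf f0 kP; have [mk [B0 kB0]] := bk; have [mf [M0 fM0]] := bf.
pose B := `|B0| + 1; have B_gt0 : 0 < B by rewrite ltr_wpDl.
have kB x : k x <= B.
  rewrite (le_trans (ler_norm _))// (le_trans (kB0 x))//.
  by rewrite (le_trans (ler_norm _))// lerDl.
pose M := `|M0| + 1; have M_gt0 : 0 < M by rewrite ltr_wpDl.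
have fM x : f x <= M.
  rewrite (le_trans (ler_norm _))// (le_trans (fM0 x))//.
  by rewrite (le_trans (ler_norm _))// lerDl.
apply/ler_addgt0Pl => e e0.
have MBe : 0 < e / (M * B) by rewrite divr_gt0// mulr_gt0.
have [n ne] : exists n : nat, n.+1%:R^-1 < e / (M * B).
  have /cvgrPdist_lt/(_ _ MBe) := @cvg_harmonic R.
  move=> [n _ /(_ n (leqnn _))]/=; rewrite sub0r normrN ger0_norm; first by exists n.
  by rewrite invr_ge0.
pose delta := M / n.+1%:R; have d0 : 0 < delta by rewrite divr_gt0.
have dB : delta * B <= e.
  move: ne; rewrite ltr_pdivlMr ?mulr_gt0// => /ltW.
  by apply: le_trans; rewrite /delta mulrAC mulrC.
pose A (i : nat) := [set x | i.+1%:R * delta <= f x].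
have mA i : measurable (A i).
  have := mf measurableT _ (measurable_itv `[i.+1%:R * delta, +oo[).
  rewrite setTI; congr measurable; apply/seteqP.
  by split => x /=; rewrite in_itv/= andbT.
pose S x := \sum_(i < n.+1) delta * \1_(A i) x.
have SE x : S x = \sum_(i < n.+1) delta * (i.+1%:R * delta <= f x)%R%:R.
  apply: eq_bigr => i _; rewrite indicE; congr (_ * (nat_of_bool _)%:R).
  by apply/idP/idP; rewrite inE.
have bA i : bmeas (\1_(A i) : T -> R) by exact: bmeas_indic.
have bdA i : bmeas (fun x => delta * \1_(A i) x).
  by apply: bmeasM => //; exact: bmeas_cst.
have bS : bmeas S by exact: (@bmeas_sum _ _ _ _ _ (fun i : 'I_n.+1 => _)).
have Sf x : f x - delta <= S x <= f x.
  rewrite SE; apply: layer_sum => //; rewrite /delta mulrC divfK//.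
have bSk : bmeas (fun x => S x * k x) by exact: bmeasM.
have h1 : \int[Q]_x (f x * k x) <= \int[Q]_x (e + S x * k x).
  apply: rint_le; [exact: bmeasM|by apply: bmeasD => //; exact: bmeas_cst|].
  move=> x; have /andP[Sx _] := Sf x; rewrite -lerBlDr -mulrBl.
  apply: (@le_trans _ _ (delta * k x)); first by rewrite ler_wpM2r//; lra.
  by rewrite (le_trans _ dB)// ler_wpM2l// ltW.
rewrite (le_trans h1)// rintD//; last exact: bmeas_cst.
rewrite rint_cst lerD2l.
have h2 : \int[P]_x S x <= \int[P]_x f x.
  by apply: rint_le => // x; have /andP[] := Sf x.
apply: le_trans h2.
have intS (P' : probability T R) (g : T -> R) : bmeas g ->
    \int[P']_x (S x * g x) = \sum_(i < n.+1) delta * \int[P']_x (\1_(A i) x * g x).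
  move=> bg; have bAg i : bmeas (fun x => \1_(A i) x * g x) by exact: bmeasM.
  have aux N : \int[P']_x ((\sum_(i < N) delta * \1_(A i) x) * g x) =
      \sum_(i < N) delta * \int[P']_x (\1_(A i) x * g x).
    elim: N => [|N IH].
      rewrite big_ord0 -[RHS](rint_cst P'); apply: eq_Rintegral => x _.
      by rewrite big_ord0 mul0r.
    rewrite big_ord_recr/= -IH -rintZ// -rintD.
    - by apply: eq_Rintegral => x _; rewrite big_ord_recr/= mulrDl mulrA.
    - by apply: bmeasM => //; exact: (@bmeas_sum _ _ _ _ _ (fun i : 'I_N => _)).
    - by apply: bmeasM => //; exact: bmeas_cst.
  exact: aux.
rewrite intS//; under [leRHS]eq_Rintegral do rewrite -[S _]mulr1.
rewrite (intS P (fun=> 1)); last exact: bmeas_cst.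
apply: ler_sum => i _; rewrite ler_pM2l//.
under [leRHS]eq_Rintegral do rewrite mulr1.
by rewrite rint_indic// kP.
Qed.

Lemma poisson_sym (R : realType) (s : R) (xi zeta : circle R) : 0 <= s ->
  poisson (s%:C * (xi : R[i])) zeta = poisson (s%:C * (zeta : R[i])) xi.
Proof.
move=> s0; rewrite /poisson !cmod_dilate//; congr (_ / _).
have := cmod_circle xi; have := cmod_circle zeta.
move=> /(congr1 (fun x => x ^+ 2)) + /(congr1 (fun x => x ^+ 2)).
rewrite !sqr_cmod !reimE/=; move: (complex.Re _) (complex.Im _) => a b.
move: (complex.Re _) (complex.Im _) => c d; rewrite expr1n => h1 h2.
rewrite !mul0r !subr0 !addr0; apply/eqP; rewrite -subr_eq0.
rewrite (_ : _ - _ = (1 - s ^+ 2) * ((a ^+ 2 + b ^+ 2) - (c ^+ 2 + d ^+ 2))).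
  by rewrite h1 h2 subrr mulr0.
by ring.
Qed.

(** Measurability in xi comes from [poisson_cauchy]: up to constants the function is the real part
    of a holomorphic function restricted to the circle of radius s. *)
Lemma bmeas_poisson_int (R : realType) (P : probability (circle R) R)
    (f : circle R -> R) (s : R) : bmeas f -> 0 <= s -> s < 1 ->
  bmeas (fun xi : circle R => \int[P]_zeta (poisson (s%:C * (xi : R[i])) zeta * f zeta)).
Proof.
move=> bf s0 s1.
rewrite (_ : (fun xi => _) = fun xi : circle R => 2 * complex.Re (cauchy_transform P
  (fun x => (f x)%:C) (s%:C * (xi : R[i]))) - \int[P]_x f x); last first.
  by apply/funext => xi; rewrite poisson_cauchy// cmod_dilate// lt_eqF.
apply: bmeasB; last exact: bmeas_cst.
apply: bmeasM; first exact: bmeas_cst.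
have hf : holo (cauchy_transform P (fun x => (f x)%:C)).
  by apply: holo_cauchy; exact: bmeasC_real.
by have [] := bmeasC_poly_approx s0 (hf _ s1).
Qed.

(** Joint measurability serves the exchange of integrals in [poisson_duality]; for dilated points of
    the circle the numerator is constant. *)
Lemma measurable_poisson2 (R : realType) (s : R) : 0 <= s ->
  measurable_fun setT
    (fun p : circle R * circle R => poisson (s%:C * circle_val p.1) p.2).
Proof.
move=> s0; rewrite /poisson.
have [[mr _] [mi _]] := @bmeasC_circle R.
under [X in measurable_fun _ X]eq_fun do rewrite cmod_dilate// sqr_cmod !reimE/= !mul0r.
apply: measurable_funM; first exact: measurable_cst.
apply: measurable_fun_inv_ge0; first by move=> x; rewrite addr_ge0 ?sqr_ge0.
apply: measurable_funD; apply: measurable_funX; apply: measurable_funB.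
- exact: (measurableT_comp mr measurable_snd).
- apply: measurable_funB; last exact: measurable_cst.
  apply: measurable_funM; first exact: measurable_cst.
  exact: (measurableT_comp mr measurable_fst).
- exact: (measurableT_comp mi measurable_snd).
- apply: measurable_funD; last exact: measurable_cst.
  apply: measurable_funM; first exact: measurable_cst.
  exact: (measurableT_comp mi measurable_fst).
Qed.

(** Tonelli's theorem, together with the symmetry of the kernel in its two points of the circle. *)
Lemma poisson_duality (R : realType) (P : probability (circle R) R)
    (C : set (circle R)) (s : R) : measurable C -> 0 <= s -> s < 1 ->
  \int[circle_lebesgue R]_xi (\1_C xi *
     \int[P]_zeta poisson (s%:C * circle_val xi) zeta) =
  \int[P]_zeta (\int[circle_lebesgue R]_xi
     (poisson (s%:C * circle_val zeta) xi * \1_C xi)).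
Proof.
move=> mC s0 s1; set m := circle_lebesgue R.
have bC : bmeas (\1_C : circle R -> R) by exact: bmeas_indic.
have z1 (xi : circle R) : cmod (s%:C * (xi : R[i])) < 1 by rewrite cmod_dilate.
have z1' (xi : circle R) : cmod (s%:C * (xi : R[i])) != 1 by rewrite lt_eqF.
have b1 : bmeas (fun xi : circle R => \int[P]_zeta poisson (s%:C * (xi : R[i])) zeta).
  have := bmeas_poisson_int P (@bmeas_cst _ _ _ 1) s0 s1.
  by under [X in bmeas X]eq_fun do under eq_Rintegral do rewrite mulr1.
have b2 : bmeas (fun zeta : circle R =>
    \int[m]_xi (poisson (s%:C * (zeta : R[i])) xi * \1_C xi)).
  exact: bmeas_poisson_int.
have bPC (zeta : circle R) : bmeas (fun xi => poisson (s%:C * (zeta : R[i])) xi * \1_C xi).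
  by apply: bmeasM => //; exact: bmeas_poisson.
apply: EFin_inj; rewrite EFin_rint; last exact: bmeasM.
rewrite EFin_rint//.
pose F (p : circle R * circle R) : \bar R :=
  (\1_C p.1 * poisson (s%:C * circle_val p.1) p.2)%:E.
transitivity (\int[m]_xi \int[P]_zeta F (xi, zeta))%E.
  apply: eq_integral => xi _; rewrite /F/= -rintZ; last exact: bmeas_poisson.
  rewrite EFin_rint//.
  by apply: bmeasM; [exact: bmeas_cst|exact: bmeas_poisson].
rewrite fubini_tonelli.
- apply: eq_integral => zeta _; rewrite EFin_rint//; apply: eq_integral => xi _.
  by rewrite /F/= poisson_sym// mulrC.
- apply/measurable_EFinP; apply: measurable_funM; last exact: measurable_poisson2.
  by apply: (measurableT_comp _ measurable_fst); case: bC.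
- by move=> p; rewrite lee_fin mulr_ge0 ?poisson_ge0.
Qed.

(* By duality the left-hand side integrates the Poisson integral of 1_C against P,
   and that integral tends to 0 pointwise off C. *)
Lemma poisson_dual_limit (R : realType) (P : probability (circle R) R)
    (C : set (circle R)) (s : nat -> R) (e : R) : compact C ->
  (forall n, 0 <= s n < 1) -> s n @[n --> \oo] --> (1 : R) -> 0 < e ->
  \forall n \near \oo, \int[circle_lebesgue R]_xi (\1_C xi *
     \int[P]_zeta poisson ((s n)%:C * circle_val xi) zeta) <= fine (P C) + e.
Proof.
move=> cC s01 s1 e0; have mC := compact_circle_measurable cC.
set m := circle_lebesgue R.
have s0 n : 0 <= s n by case/andP: (s01 n).
have sl n : s n < 1 by case/andP: (s01 n).
have bC : bmeas (\1_C : circle R -> R) by exact: bmeas_indic.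
have mCC : measurable (~` C) by exact: measurableC.
have bCC : bmeas (\1_(~` C) : circle R -> R) by exact: bmeas_indic.
pose q n (zeta : circle R) := \int[m]_xi (poisson ((s n)%:C * circle_val zeta) xi * \1_C xi).
have bq n : bmeas (q n) by exact: bmeas_poisson_int.
have q01 n zeta : 0 <= q n zeta <= 1.
  by apply: poisson_indic_le1 => //; rewrite cmod_dilate.
(* On C the Poisson integral of the indicator is replaced by its upper bound 1: its convergence
   there is in general only Lebesgue-almost everywhere, and P may be singular. *)
pose g n zeta := \1_C zeta + \1_(~` C) zeta * q n zeta.
have bg n : bmeas (g n) by apply: bmeasD => //; exact: bmeasM.
have qg n zeta : q n zeta <= g n zeta.
  have /andP[h0 h1] := q01 n zeta; rewrite /g; have [Cz|Cz] := pselect (C zeta).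
    have e2 : \1_(~` C) zeta = 0 :> R by rewrite indicE memNset//=; apply.
    by rewrite e2 mul0r addr0 indicE mem_set.
  by rewrite !indicE memNset// mem_set// mul1r add0r.
have i01 (A : set (circle R)) (x : circle R) : 0 <= (\1_A x : R) <= 1.
  by rewrite indicE; case: (_ \in _); rewrite lexx ler01.
have lim : \int[P]_zeta g n zeta @[n --> \oo] --> \int[P]_zeta \1_C zeta.
  apply: (@rint_dominated _ _ _ _ _ _ 2).
  - by move=> n; case: (bg n).
  - by case: bC.
  - move=> n x; have /andP[h0 h1] := q01 n x; have /andP[? ?] := i01 C x.
    have /andP[? ?] := i01 (~` C) x.
    rewrite ger0_norm ?addr_ge0 ?mulr_ge0// -[leRHS]/(1 + 1) lerD//.
    by rewrite mulr_ile1.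
  - apply: aeW => x; have [Cx|Cx] := pselect (C x).
      rewrite (_ : (fun n => g n x) = fun=> \1_C x); first exact: cvg_cst.
      have e2 : \1_(~` C) x = 0 :> R by rewrite indicE memNset//=; apply.
      by apply/funext => n; rewrite /g e2 mul0r addr0.
    rewrite (_ : (fun n => g n x) = fun n => q n x); last first.
      by apply/funext => n; rewrite /g !indicE memNset// mem_set// mul1r add0r.
    rewrite indicE memNset//; exact: poisson_off_compact.
rewrite rint_indic// in lim.
have /cvgrPdist_lt/(_ e e0) := lim; apply: filterS => n /=.
rewrite ltr_norml => /andP[h _].
rewrite poisson_duality// -/m.
have : \int[P]_zeta q n zeta <= \int[P]_zeta g n zeta by exact: rint_le.
by move: h; rewrite /q; move: (fine _) (\int[P]_zeta g n zeta) => x y; lra.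
Qed.

(** * Identification of the radial limit with the density *)

Lemma circle_null_compact (R : realType) (E : set (circle R)) : measurable E ->
  (forall C, compact C -> C `<=` E -> circle_lebesgue R C = 0%E) ->
  circle_lebesgue R E = 0%E.
Proof.
move=> mE h; apply: contrapT => E0.
have [|C [cC CE]] := @circle_regularity_inner R E mE.
  by rewrite lt0e measure_ge0 andbT; apply/eqP.
by rewrite (h _ cC CE) ltxx.
Qed.

Lemma measurable_ltr_fun d (T : measurableType d) (R : realType) (f g : T -> R) :
  measurable_fun setT f -> measurable_fun setT g ->
  measurable [set x | f x < g x].
Proof.
move=> mf mg.
have mfg : measurable_fun setT (fun x => f x < g x) by exact: measurable_fun_ltr.
have := mfg measurableT [set true] I; rewrite setTI.
by congr measurable; apply/seteqP; split => x /=.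
Qed.

Lemma cvg_minr_cst (R : realType) (f : nat -> R) (l T : R) :
  f n @[n --> \oo] --> l -> Num.min (f n) T @[n --> \oo] --> Num.min l T.
Proof.
move=> fl; rewrite minr_absE; under eq_fun do rewrite minr_absE.
apply: cvgMl; apply: cvgB; first by apply: cvgD => //; exact: cvg_cst.
by apply: cvg_norm; apply: cvgB => //; exact: cvg_cst.
Qed.

(* Testing on compact subsets of the exceptional set spares any regularity of mu;
   the bound h < T keeps all integrands bounded. *)
Lemma density_upper_eps (R : realType) (mu : probability (circle R) R)
    (h L : circle R -> R) (s : nat -> R) (e T : R) : is_ac_density mu h ->
  measurable_fun setT L ->
  (forall n, 0 <= s n < 1) -> s n @[n --> \oo] --> (1 : R) ->
  {ae circle_lebesgue R, forall xi : circle R,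
    \int[mu]_zeta poisson ((s n)%:C * (xi : R[i])) zeta @[n --> \oo] --> L xi} ->
  0 < e -> {ae circle_lebesgue R, forall xi : circle R, h xi < T -> L xi <= h xi + e}.
Proof.
move=> [h0 ih [nu [N [mN nuN mN0]] muE]] mL s01 s1 cL e0.
set m := circle_lebesgue R.
have mh : measurable_fun setT h by apply/measurable_EFinP; case/integrableP: ih.
have [Z [mZ Z0 LZ]] := cL.
have s0 n : 0 <= s n by case/andP: (s01 n).
have sl n : s n < 1 by case/andP: (s01 n).
(* Removing N leaves no singular mass: on subsets of E, [mu] is h times Lebesgue measure. *)
pose E := ([set x | h x + e < L x] `&` [set x | h x < T]) `&` (~` N `&` ~` Z).
have mE : measurable E.
  apply: measurableI; apply: measurableI.
  - apply: measurable_ltr_fun => //.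
    by apply: measurable_funD => //; exact: measurable_cst.
  - by apply: measurable_ltr_fun => //; exact: measurable_cst.
  - exact: measurableC.
  - exact: measurableC.
have mE0 : m E = 0%E.
  apply: circle_null_compact => // C cC CE; have mC := compact_circle_measurable cC.
  have bC : bmeas (\1_C : circle R -> R) by exact: bmeas_indic.
  have hT x : C x -> h x <= T by move=> /CE[[_ /= /ltW]].
  have bh : bmeas (fun x => \1_C x * h x).
    split; first by apply: measurable_funM => //; case: bC.
    exists `|T| => x; have [Cx|Cx] := pselect (C x).
      rewrite indicE mem_set// mul1r ger0_norm// (le_trans (hT _ Cx))//.
      exact: ler_norm.
    by rewrite indicE memNset// mul0r normr0.
  have muC : fine (mu C) = \int[m]_x (\1_C x * h x).
    have nuC : nu C = 0%E.
      apply: (subset_measure0 mC _ _ nuN); first exact: measurableC.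
      by move=> x /CE[_ []].
    apply: EFin_inj; rewrite fineK ?fin_num_measure// muE// nuC adde0 EFin_rint//.
    rewrite integral_mkcond; apply: eq_integral => x _; rewrite patchE indicE.
    by case: ifP => _; rewrite ?mul1r ?mul0r.
  pose p n (xi : circle R) := \int[mu]_zeta poisson ((s n)%:C * (xi : R[i])) zeta.
  have bp n : bmeas (p n).
    have := bmeas_poisson_int mu (@bmeas_cst _ _ _ 1) (s0 n) (sl n).
    by under [X in bmeas X]eq_fun do under eq_Rintegral do rewrite mulr1.
  have p0 n xi : 0 <= p n xi.
    by apply: Rintegral_ge0 => x _; rewrite poisson_ge0// cmod_dilate.
  (* Truncation at this level allows dominated convergence although L may be unbounded, and min(L,
     T') still dominates h + e on C because h < T there. *)
  pose T' := `|T| + e.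
  have T'0 : 0 <= T' by rewrite addr_ge0// ltW.
  pose g n xi := \1_C xi * Num.min (p n xi) T'.
  pose G xi := \1_C xi * Num.min (L xi) T'.
  have mm n : measurable_fun setT (fun xi => Num.min (p n xi) T').
    by apply: measurable_minr => //; case: (bp n).
  have gb n xi : `|g n xi| <= T'.
    rewrite /g indicE; case: (_ \in _); rewrite ?mul0r ?normr0// mul1r.
    by rewrite ger0_norm ?le_min ?p0 ?T'0// ge_min lexx orbT.
  have mg n : measurable_fun setT (g n) by apply: measurable_funM => //; case: bC.
  have bg n : bmeas (g n) by split => //; exists T'.
  have mG : measurable_fun setT G.
    by apply: measurable_funM; [case: bC|exact: measurable_minr].
  have cG : {ae m, forall xi, g n xi @[n --> \oo] --> G xi}.
    by apply: filterS cL => xi cxi; apply: cvgMr; exact: cvg_minr_cst.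
  have GE xi : \1_C xi * h xi + e * \1_C xi <= G xi.
    rewrite /G; have [Cx|Cx] := pselect (C xi).
      rewrite !indicE mem_set// !mul1r mulr1 le_min.
      have [[/= hL hT'] _] := CE _ Cx; rewrite (ltW hL)/= lerD2r.
      by rewrite (le_trans (ltW hT'))// ler_norm.
    by rewrite !indicE memNset// !mul0r mulr0 addr0.
  have G0 xi : 0 <= G xi.
    apply: le_trans (GE xi); rewrite addr_ge0 ?mulr_ge0//; exact: ltW.
  have bG : bmeas G.
    split => //; exists T' => xi; rewrite ger0_norm// /G indicE.
    by case: (_ \in _); rewrite ?mul1r ?mul0r// ge_min lexx orbT.
  have lim := rint_dominated mg mG gb cG.
  have Gle : \int[m]_xi G xi <= fine (mu C).
    apply/ler_addgt0Pl => eps eps0.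
    rewrite addrC -(cvg_lim _ lim)//; apply: limr_le.
      by apply/cvg_ex; eexists; exact: lim.
    apply: filterS (poisson_dual_limit mu cC s01 s1 eps0) => n.
    apply: le_trans; apply: rint_le => //; first exact: bmeasM bC (bp n).
    by move=> xi; rewrite /g ler_wpM2l// ge_min lexx.
  have : \int[m]_xi (\1_C xi * h xi + e * \1_C xi) <= \int[m]_xi G xi.
    apply: rint_le => //; apply: bmeasD => //.
    by apply: bmeasM => //; exact: bmeas_cst.
  rewrite rintD//; last by apply: bmeasM => //; exact: bmeas_cst.
  rewrite rintZ// rint_indic// -muC => hle.
  have : e * fine (m C) <= 0 by rewrite /m; lra.
  rewrite pmulr_rle0// => mC0; apply/eqP; rewrite eq_le measure_ge0 andbT.
  by rewrite -(@fineK _ (m C)) ?fin_num_measure// lee_fin.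
exists (E `|` (N `|` Z)); split.
- by apply: measurableU => //; exact: measurableU.
- apply/eqP; rewrite eq_le measure_ge0 andbT.
  apply: (le_trans (measureU2 _ _ _)) => //; first exact: measurableU.
  rewrite [X in (X + _)%E]mE0 add0e; apply: (le_trans (measureU2 _ _ _)) => //.
  by rewrite [X in (X + _)%E]mN0 add0e [leLHS]Z0.
- move=> xi /= nL; have [Nx|Nx] := pselect (N xi); first by right; left.
  have [Zx|Zx] := pselect (Z xi); first by right; right.
  left; split => //; have [hx|hx] := pselect (h xi < T); last first.
    by exfalso; apply: nL.
  by split => //=; rewrite ltNge; apply/negP => hle; apply: nL.
Qed.

Lemma poisson_radial (R : realType) (V : circle R -> R) (xi : circle R)
    (s : nat -> R) : bmeas V -> circle_lebesgue_pt V xi ->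
  (forall n, 0 <= s n < 1) -> s n @[n --> \oo] --> (1 : R) ->
  \int[circle_lebesgue R]_zeta (poisson ((s n)%:C * (xi : R[i])) zeta * V zeta)
    @[n --> \oo] --> V xi.
Proof.
move=> bV LV s01 s1; apply/cvgrPdist_lt => e e0.
have [d d0 dh] := poisson_nontangential bV LV (ltr1n R 2) e0.
have /cvgrPdist_lt/(_ d d0) := s1; apply: filterS => n /= sn.
have /andP[s0 sl] := s01 n; rewrite distrC.
have h : cmod ((s n)%:C * (xi : R[i]) - (xi : R[i])) = 1 - s n.
  rewrite (_ : _ - _ = (s n - 1)%:C * (xi : R[i])); last first.
    by rewrite rmorphB/=; ring.
  by rewrite cmodM cmod_real cmod_circle mulr1 distrC ger0_norm// subr_ge0 ltW.
apply: dh; rewrite ?h ?cmod_dilate//.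
- by rewrite ltr_pMl ?subr_gt0// ltr1n.
- by rewrite -[ltLHS]ger0_norm ?subr_ge0 ?(ltW sl).
Qed.

(** The measure of density min(h, T) is at most [mu], since the singular part is nonnegative, so the
    Poisson integrals compare. The truncation makes the density bounded, and [poisson_radial]
    applies to it at almost every point. *)
Lemma density_lower (R : realType) (mu : probability (circle R) R)
    (h L : circle R -> R) (s : nat -> R) (T : R) : is_ac_density mu h ->
  (forall n, 0 <= s n < 1) -> s n @[n --> \oo] --> (1 : R) ->
  {ae circle_lebesgue R, forall xi : circle R,
    \int[mu]_zeta poisson ((s n)%:C * (xi : R[i])) zeta @[n --> \oo] --> L xi} ->
  0 <= T -> {ae circle_lebesgue R, forall xi : circle R, Num.min (h xi) T <= L xi}.
Proof.
move=> [h0 ih [nu _ muE]] s01 s1 cL T0.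
have mh : measurable_fun setT h by apply/measurable_EFinP; case/integrableP: ih.
pose k xi := Num.min (h xi) T.
have k0 xi : 0 <= k xi by rewrite le_min h0.
have bk : bmeas k.
  split; first by apply: measurable_minr => //; exact: measurable_cst.
  by exists T => xi; rewrite ger0_norm// ge_min lexx orbT.
have kmu A : measurable A -> \int[circle_lebesgue R]_x (\1_A x * k x) <= fine (mu A).
  move=> mA; have bAk : bmeas (fun x => \1_A x * k x).
    by apply: bmeasM => //; exact: bmeas_indic.
  rewrite -lee_fin EFin_rint// fineK ?fin_num_measure// muE//.
  rewrite -[leLHS]adde0 leeD// [leRHS]integral_mkcond; apply: ge0_le_integral => //.
  - by move=> x _; rewrite lee_fin mulr_ge0.
  - by apply/measurable_EFinP; case: bAk.
  - apply/(measurable_restrictT _ _).1 => //; apply/measurable_EFinP.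
    exact: measurable_funTS.
  - move=> x _; rewrite patchE indicE; case: ifP => _; last by rewrite mul0r.
    by rewrite mul1r lee_fin ge_min lexx.
apply: filterS2 cL (circle_lebesgue_pt_ae bk) => xi cxi Lxi.
have ck := poisson_radial bk Lxi s01 s1.
rewrite -/(k xi) -(cvg_lim _ ck)// -(cvg_lim _ cxi)//; apply: ler_lim.
- by apply/cvg_ex; eexists; exact: ck.
- by apply/cvg_ex; eexists; exact: cxi.
apply: nearW => n; have /andP[s0 sl] := s01 n.
have z1 : cmod ((s n)%:C * circle_val xi) < 1 by rewrite cmod_dilate.
apply: rint_density_le => //; first by apply: bmeas_poisson; rewrite lt_eqF.
by move=> x; exact: poisson_ge0.
Qed.

Lemma fatou_density (R : realType) (mu : probability (circle R) R)
    (h L : circle R -> R) (s : nat -> R) : is_ac_density mu h ->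
  measurable_fun setT L ->
  (forall n, 0 <= s n < 1) -> s n @[n --> \oo] --> (1 : R) ->
  {ae circle_lebesgue R, forall xi : circle R,
    \int[mu]_zeta poisson ((s n)%:C * (xi : R[i])) zeta @[n --> \oo] --> L xi} ->
  {ae circle_lebesgue R, forall xi : circle R, L xi = h xi}.
Proof.
move=> hh mL s01 s1 cL.
have up (j : nat) : {ae circle_lebesgue R, forall xi : circle R,
    h xi < j%:R -> L xi <= h xi + j.+1%:R^-1}.
  by apply: density_upper_eps hh mL s01 s1 cL _; rewrite invr_gt0.
have lo (j : nat) : {ae circle_lebesgue R, forall xi : circle R,
    Num.min (h xi) j%:R <= L xi} by exact: density_lower hh s01 s1 cL _.
have [h0 _ _] := hh.
apply: filterS2 (ae_foralln up) (ae_foralln lo) => xi upx lox.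
apply/eqP; rewrite eq_le; apply/andP; split.
  apply/ler_addgt0Pr => e e0.
  (* One index that exceeds h xi, as the upper bound requires, and makes 1 / (j + 1) at most e. *)
  pose j := maxn (Num.truncn (h xi)).+1 (Num.truncn e^-1).+1.
  have hj : h xi < j%:R.
    by rewrite (lt_le_trans (truncnS_gt _))// ler_nat leq_maxl.
  have ej : j.+1%:R^-1 <= e.
    rewrite -[leRHS]invrK lef_pV2 ?posrE ?invr_gt0//.
    rewrite (le_trans (ltW (truncnS_gt _)))// ler_nat.
    by rewrite (leq_trans _ (leqnSn _))// leq_maxr.
  by rewrite (le_trans (upx _ hj))// lerD2l.
have := lox (Num.truncn (h xi)).+1; rewrite min_l//.
exact/ltW/truncnS_gt.
Qed.

(** * Boundary values of the Cauchy transform *)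

Lemma radii (R : realType) : exists2 s : nat -> R,
  (forall n, 0 <= s n < 1) & s n @[n --> \oo] --> (1 : R).
Proof.
exists (fun n => 1 - n.+1%:R^-1) => [n|].
  rewrite ltrBlDr ltrDl invr_gt0 ltr0n andbT subr_ge0.
  by rewrite invf_le1 ?ler1n.
apply: cvg_harmonic_bound => n.
by rewrite addrC addKr normrN ger0_norm ?invr_ge0.
Qed.

Lemma measurable_eq_cst d (T : measurableType d) (R : realType) (f : T -> R) (c : R) :
  measurable_fun setT f -> measurable [set x | f x = c].
Proof.
move=> mf; have := mf measurableT _ (measurable_set1 c).
by rewrite setTI.
Qed.

(** A compact set of zeros of U that avoids the exceptional null set meets the hypotheses of
    [holo_uniqueness] at each of its points, so it is null; inner regularity extends this to the
    whole zero set. *)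
Lemma holo_boundary_neq0 (R : realType) (u : R[i] -> R[i]) (B : R)
    (U : circle R -> R[i]) : holo u ->
  (forall z, cmod z < 1 -> cmod (u z) <= B) -> u 0 != 0 -> bmeasC U ->
  {ae circle_lebesgue R, forall xi, nontangential_limit (@disc R) u xi (U xi)} ->
  {ae circle_lebesgue R, forall xi, U xi != 0}.
Proof.
move=> hu uB u0 [[mr _] [mi _]] [Z [mZ Z0 UZ]].
have [s s01 s1] := radii R.
pose E := ([set x | complex.Re (U x) = 0] `&` [set x | complex.Im (U x) = 0]) `&` ~` Z.
have mE : measurable E.
  apply: measurableI; last exact: measurableC.
  by apply: measurableI; exact: measurable_eq_cst.
have E0 : circle_lebesgue R E = 0%E.
  apply: circle_null_compact => // C cC CE.
  apply: (holo_uniqueness hu uB u0 cC s01 s1) => xi Cxi e e0.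
  have [[/= Ur Ui] nZ] := CE _ Cxi.
  have Uxi : nontangential_limit (@disc R) u xi (U xi).
    by apply: contrapT => h; apply: nZ; exact: UZ.
  have := nontangential_radial s01 s1 Uxi e0; apply: filterS => n.
  by rewrite (_ : U xi = 0) ?subr0//; exact: eq_reim.
exists (E `|` Z); split; first exact: measurableU.
- apply/eqP; rewrite eq_le measure_ge0 andbT.
  apply: (le_trans (measureU2 _ _ _)) => //.
  by rewrite [X in (X + _)%E]E0 add0e [leLHS]Z0.
- move=> xi /= /negP; rewrite negbK => /eqP U0.
  have [Zx|Zx] := pselect (Z xi); [by right|left].
  by split => //; rewrite /= U0.
Qed.

Lemma cauchy_mass (R : realType) (P : probability (circle R) R) (z : R[i]) :
  cmod z != 1 -> \int[P]_x poisson z x =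
    2 * complex.Re (cauchy_transform P (fun=> 1) z) - 1.
Proof.
move=> z1; have := poisson_cauchy P (@bmeas_cst _ _ _ 1) z1.
under eq_Rintegral do rewrite mulr1.
by rewrite rint_cst.
Qed.

Lemma Re_cauchy_ge (R : realType) (P : probability (circle R) R) (z : R[i]) :
  cmod z < 1 -> 2^-1 <= complex.Re (cauchy_transform P (fun=> 1) z).
Proof.
move=> z1; have := cauchy_mass P (_ : cmod z != 1); rewrite lt_eqF// => /(_ isT) h.
have : 0 <= \int[P]_x poisson z x.
  by apply: Rintegral_ge0 => x _; exact: poisson_ge0.
by rewrite h; lra.
Qed.

Lemma cmod_cauchy_ge (R : realType) (P : probability (circle R) R) (z : R[i]) :
  cmod z < 1 -> 2^-1 <= cmod (cauchy_transform P (fun=> 1) z).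
Proof.
move=> z1; rewrite (le_trans (Re_cauchy_ge P z1))//.
by rewrite (le_trans (ler_norm _))// Re_le_cmod.
Qed.

Lemma cauchy_neq0 (R : realType) (P : probability (circle R) R) (z : R[i]) :
  cmod z < 1 -> cauchy_transform P (fun=> 1) z != 0.
Proof.
by move=> z1; rewrite -cmod_gt0 (lt_le_trans _ (cmod_cauchy_ge P z1))// invr_gt0.
Qed.

Lemma bmeasC1 (R : realType) : bmeasC (fun _ : circle R => 1 : R[i]).
Proof. exact: bmeasC_cst. Qed.

Lemma cauchy_conjE (R : realType) (P : probability (circle R) R) (z : R[i]) :
  cmod z != 1 -> cauchy_transform P (fun=> 1) z =
    1 + z * cauchy_transform P (fun zeta : circle R => (zeta : R[i])^*%C) z.
Proof.
move=> z1; rewrite cauchy_step//; last exact: bmeasC1.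
rewrite cint_cst; congr (_ + _ * _); congr cauchy_transform.
by apply/funext => x; rewrite mulr1.
Qed.

Lemma cauchy_at0 (R : realType) (P : probability (circle R) R)
    (f : circle R -> R[i]) : cauchy_transform P f 0 = cintegral P f.
Proof.
by congr cintegral; apply/funext => x; rewrite mulr0 subr0 divr1.
Qed.

Lemma cauchy_reflect (R : realType) (P : probability (circle R) R) (z : R[i]) :
  1 < cmod z -> cauchy_transform P (fun=> 1) z =
    1 - (cauchy_transform P (fun=> 1) (z^*%C)^-1)^*%C.
Proof.
move=> z1; have z0 : z != 0 by rewrite -cmod_gt0 (lt_trans ltr01).
have w1 : cmod (z^*%C)^-1 != 1.
  by rewrite cmodV cmodJ lt_eqF// invf_lt1// (lt_trans ltr01).
have bw := bmeasC_cauchy (@bmeasC1 R) w1.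
rewrite /cauchy_transform -cintJ// -[X in X - _](cint_cst P) -cintB; last 2 first.
- exact: bmeasC1.
- exact: bmeasCJ.
congr cintegral; apply/funext => x; rewrite !mul1r conjc_inv.
rewrite rmorphB rmorph1 rmorphM fmorphV/= !conjcK.
have x0 := conj_circle x.
have xn0 : circle_val x != 0 by rewrite -cmod_gt0 cmod_circle.
have -> : (circle_val x)^*%C = (circle_val x)^-1.
  by apply: (mulfI xn0); rewrite conj_circle divff.
have zx : z - circle_val x != 0.
  rewrite subr_eq0; apply/eqP => zx.
  by move: z1; rewrite zx cmod_circle ltxx.
have zx' : circle_val x - z != 0 by rewrite -opprB oppr_eq0.
by field; rewrite z0 xn0 zx zx'.
Qed.

(** The reflection of z to 1 / conj(z) divides both |z - xi| and the distance of z to the circle by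
    |z|: exterior Stolz regions go into interior ones of the same aperture. *)
Lemma nontangential_reflect (R : realType) (P : probability (circle R) R)
    (xi : circle R) (l : R[i]) :
  nontangential_limit (@disc R) (cauchy_transform P (fun=> 1)) xi l ->
  nontangential_limit (@exterior R) (cauchy_transform P (fun=> 1)) xi (1 - l^*%C).
Proof.
move=> /nontangential_limitP hl; apply/nontangential_limitP => a a1 e e0.
have [d d0 dh] := hl a a1 e e0; exists d => // z /exteriorP z1.
have z0 : 0 < cmod z := lt_trans ltr01 z1.
have zn0 : z != 0 by rewrite -cmod_gt0.
rewrite ltr0_norm ?subr_lt0// opprB => za zd.
have w1 : cmod (z^*%C)^-1 < 1 by rewrite cmodV cmodJ invf_lt1.
have wd : cmod ((z^*%C)^-1 - (xi : R[i])) = cmod (z - (xi : R[i])) / cmod z.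
  rewrite -cmodJ rmorphB/= conjc_inv conjcK.
  have -> : z^-1 - (xi : R[i])^*%C = - (z - (xi : R[i])) * ((xi : R[i])^*%C / z).
    have := conj_circle xi => x1.
    rewrite (_ : - (z - (xi : R[i])) * ((xi : R[i])^*%C / z) =
      ((xi : R[i]) * (xi : R[i])^*%C) / z - (xi : R[i])^*%C * (z / z)); last by ring.
    by rewrite x1 divff// mulr1 mul1r.
  by rewrite !cmodM cmodN cmodJ cmod_circle cmodV mul1r.
rewrite cauchy_reflect//.
rewrite (_ : _ - _ - _ = - (cauchy_transform P (fun=> 1) (z^*%C)^-1 - l)^*%C).
  rewrite cmodN cmodJ; apply: dh.
  - by apply/discP.
  - rewrite wd ger0_norm ?subr_ge0 ?(ltW w1)// cmodV cmodJ.
    rewrite ltr_pdivrMr// -mulrA mulrBl mul1r mulVf ?gt_eqF//.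
  - rewrite wd (le_lt_trans _ zd)// ler_piMr ?cmod_ge0// invf_le1// ltW//.
by rewrite rmorphB/=; ring.
Qed.

Lemma cvg_within_id (R : realType) (D : set R[i]) (z0 : R[i]) :
  z @[z --> within D (nbhs z0)] --> z0.
Proof. by apply: cvg_within_filter; exact: cvg_id. Qed.

Lemma normalized_nontangential (R : realType) (P : probability (circle R) R)
    (D : set R[i]) (xi : circle R) (k : R[i]) : (forall z, D z -> cmod z != 1) ->
  nontangential_limit D (cauchy_transform P (fun=> 1)) xi k -> k != 0 ->
  nontangential_limit D
    (normalized_cauchy_transform P (fun zeta : circle R => (zeta : R[i])^*%C)) xi
    ((k - 1) / (xi : R[i]) / k).
Proof.
move=> D1 hk k0 a a1; have := hk a a1; set G := within _ _ => Kk.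
have x0 : (xi : R[i]) != 0 by rewrite -cmod_gt0 cmod_circle.
have near0 : \forall z \near G, (cauchy_transform P (fun=> 1) z - 1) / z
    / cauchy_transform P (fun=> 1) z =
  normalized_cauchy_transform P (fun zeta : circle R => (zeta : R[i])^*%C) z.
  (* Within distance 1 of xi the point z is not 0, so division by z is legitimate. *)
  rewrite near_withinE; apply/nbhs_cmodP; exists 1 => // z zx [Dz _].
  have z0 : z != 0.
    apply/eqP => z0; move: zx; rewrite z0 sub0r cmodN cmod_circle ltxx//.
  rewrite /normalized_cauchy_transform; congr (_ / _).
  by rewrite cauchy_conjE ?D1// addrC addKr mulrC mulKf.
have GF : Filter G by exact: within_filter.
apply: (cvg_trans (near_eq_cvg near0)).
apply: cvgM; last exact: (cvgV k0 Kk).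
apply: cvgM; first by apply: (cvgD Kk); exact: cvg_cst.
exact: (cvgV x0 (@cvg_within_id _ _ _)).
Qed.

(** * Boundary values of 1/K *)

Lemma holo_inv_cauchy (R : realType) (P : probability (circle R) R) :
  holo (fun z => (cauchy_transform P (fun=> 1) z)^-1).
Proof.
move=> s s1; apply: (@poly_approx_inv _ _ 2^-1) => // [z zs|].
  by apply: Re_cauchy_ge; exact: le_lt_trans s1.
exact: holo_cauchy (@bmeasC1 R) _ s1.
Qed.

Lemma inv_cauchy_bound (R : realType) (P : probability (circle R) R) (z : R[i]) :
  cmod z < 1 -> cmod (cauchy_transform P (fun=> 1) z)^-1 <= 2.
Proof.
move=> z1; rewrite cmodV -[leRHS]invrK lef_pV2 ?posrE ?invr_gt0//.
  exact: cmod_cauchy_ge.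
by rewrite cmod_gt0 cauchy_neq0.
Qed.

(** Each vanishing moment lets [cauchy_step] extract one more factor z; the moment of order 0
    accounts for the 1 subtracted. *)
Lemma cauchy_sub1_factor (R : realType) (P : probability (circle R) R) n (z : R[i]) :
  (forall k, (0 < k)%N -> (k < n)%N ->
    cintegral P (fun x : circle R => (x : R[i])^*%C ^+ k) = 0) ->
  (0 < n)%N -> cmod z != 1 -> cauchy_transform P (fun=> 1) z - 1 =
    z ^+ n * cauchy_transform P (fun x : circle R => (x : R[i])^*%C ^+ n) z.
Proof.
move=> c0 n0 z1; elim: n n0 c0 => // n IH _ c0.
have bc k : bmeasC (fun x : circle R => (x : R[i])^*%C ^+ k).
  by apply: bmeasCX; exact: bmeasC_conj.
have E k : (fun x : circle R => (x : R[i])^*%C * (x : R[i])^*%C ^+ k) =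
    fun x : circle R => (x : R[i])^*%C ^+ k.+1.
  by apply/funext => x; rewrite exprS.
case: n IH c0 => [_ _|n IH c0].
  rewrite cauchy_conjE// addrC addKr expr1.
  suff -> : (fun x : circle R => (x : R[i])^*%C ^+ 1) = fun x : circle R => (x : R[i])^*%C by [].
  by apply/funext => x; rewrite expr1.
rewrite IH//; last by move=> k k0 kn; apply: c0 => //; exact: ltnW.
rewrite cauchy_step//.
by rewrite c0// add0r E mulrA -exprSr.
Qed.

(* Either all moments of P vanish and K P = 1 in the disc, or
   K P - 1 = z^n K_n with K_n 0 <> 0; the quotient (1 - 1 / K P) / z^n is then
   bounded and does not vanish at 0. *)
Lemma inv_cauchy_boundary_neq1 (R : realType) (P : probability (circle R) R)
    (F : circle R -> R[i]) : bmeasC F ->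
  {ae circle_lebesgue R, forall xi, nontangential_limit (@disc R)
    (fun z => (cauchy_transform P (fun=> 1) z)^-1) xi (F xi)} ->
  (forall z, cmod z < 1 -> cauchy_transform P (fun=> 1) z = 1) \/
  {ae circle_lebesgue R, forall xi, F xi != 1}.
Proof.
move=> bF hF; set K := cauchy_transform P (fun=> 1).
have bc k : bmeasC (fun x : circle R => (x : R[i])^*%C ^+ k).
  by apply: bmeasCX; exact: bmeasC_conj.
have nc k (x : circle R) : cmod ((x : R[i])^*%C ^+ k) <= 1.
  by rewrite cmodX cmodJ cmod_circle expr1n.
pose c k := cintegral P (fun x : circle R => (x : R[i])^*%C ^+ k).
have [c0|/existsNP[k /not_implyP[k0 ck]]] := pselect (forall k, (0 < k)%N -> c k = 0).
  left=> z z1; have z1' : cmod z != 1 by rewrite lt_eqF.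
  apply/eqP; rewrite -subr_eq0 -cmod_eq0 eq_le cmod_ge0 andbT.
  apply: (@le0_expr _ _ (cmod z) (cmod z / (1 - cmod z))) => // [|k]; first exact: cmod_ge0.
  rewrite /K (@cauchy_sub1_factor _ _ k.+1)// => [|j j0 _]; last exact: c0.
  rewrite cmodM cmodX exprSr -mulrA ler_wpM2l ?exprn_ge0 ?cmod_ge0//.
  rewrite ler_wpM2l ?cmod_ge0// -[leRHS]mul1r; exact: cauchy_bound.
right.
have exc : exists k, (0 < k)%N && (c k != 0).
  by exists k; rewrite k0; apply/eqP.
case: (ex_minnP exc) => n /andP[n0 cn] nmin.
pose Kn := cauchy_transform P (fun x : circle R => (x : R[i])^*%C ^+ n).
pose g z := Kn z * (K z)^-1.
have KE z : cmod z != 1 -> K z - 1 = z ^+ n * Kn z.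
  move=> z1; apply: cauchy_sub1_factor => // j j0 jn.
  apply/eqP; apply/negPn/negP => cj; have := nmin j; rewrite j0 cj => /(_ isT).
  by rewrite leqNgt jn.
have gE z : cmod z < 1 -> 1 - (K z)^-1 = z ^+ n * g z.
  move=> z1; rewrite /g mulrA -KE ?lt_eqF// mulrBl mul1r divff//.
  exact: cauchy_neq0.
have hg : holo g by apply: holoM; [exact: holo_cauchy|exact: holo_inv_cauchy].
have g0 : g 0 != 0.
  rewrite /g /K /Kn !cauchy_at0 mulf_neq0// invr_neq0// cint_cst.
  exact: oner_neq0.
have gB z : cmod z < 1 -> cmod (g z) <= 4 * 2 ^+ n.
  (* For |z| <= 1/2 both factors of g are at most 2; beyond, |1 - 1 / K| <= 3 and 1 / |z|^n <=
     2^n. *)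
  move=> z1; have [zs|zs] := leP (cmod z) 2^-1.
    rewrite (@le_trans _ _ 4)//; last by rewrite ler_peMr// exprn_ege1// ler1n.
    rewrite /g cmodM -[leRHS]/((2 * 2)%:R) natrM ler_pM ?cmod_ge0//; last first.
      exact: inv_cauchy_bound.
    rewrite (le_trans (cauchy_bound P (bc n) z1 (nc n)))// mul1r.
    by rewrite -[leRHS]invrK lef_pV2 ?posrE ?subr_gt0 ?invr_gt0//; lra.
  have zn : 0 < cmod z ^+ n by rewrite exprn_gt0// (lt_trans _ zs)// invr_gt0.
  rewrite -(ler_pM2l zn) -cmodX -cmodM -gE//.
  rewrite (le_trans (cmodB _ _))// cmod1.
  apply: (@le_trans _ _ 4); first by have := inv_cauchy_bound P z1; rewrite -/K; lra.
  rewrite mulrCA cmodX -exprMn ler_peMr// exprn_ege1//.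
  by move: zs; rewrite -(@ltr_pM2r _ 2)// mulVf// => /ltW.
have [G bG hG] := holo_fatou hg gB.
have G0 := holo_boundary_neq0 hg gB g0 bG hG.
have [s s01 s1] := radii R.
have G0' : {ae circle_lebesgue R, forall xi, G xi != 0 /\
    nontangential_limit (@disc R) g xi (G xi)}.
  by apply: filterS2 G0 hG => xi.
apply: filterS2 G0' hF => xi [Gxi gxi] Fxi.
(* If F xi = 1, then z^n g = 1 - 1 / K tends to 0 along the radius, and so does g, since |z| is
   eventually above 1/2; this contradicts G xi <> 0. *)
apply/eqP => F1; move/eqP: Gxi; apply.
apply: (@cmod_eq_eps _ _ _ (2 ^+ n + 1 + 2 ^+ n)) => e e0; rewrite subr0.
have h1 := nontangential_radial s01 s1 gxi e0.
have h2 := nontangential_radial s01 s1 Fxi e0.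
have h3 : \forall m \near \oo, 2^-1 < s m.
  have /cvgrPdist_lt/(_ 2^-1) := s1; rewrite invr_gt0 => /(_ (ltr0n _ _)).
  apply: filterS => m; rewrite ltr_norml => /andP[_ ?]; lra.
have [m [[gm Fm] sm]] : exists m, (cmod (g ((s m)%:C * (xi : R[i])) - G xi) < e /\
   cmod ((K ((s m)%:C * (xi : R[i])))^-1 - F xi) < e) /\ 2^-1 < s m.
  by apply: (@filter_ex _ \oo); apply: filterI => //; exact: filterI.
have /andP[sm0 sm1] := s01 m.
have z1 : cmod ((s m)%:C * circle_val xi) < 1 by rewrite cmod_dilate.
have sn : 0 < s m ^+ n by rewrite exprn_gt0// (lt_trans _ sm)// invr_gt0.
have gsmall : cmod (g ((s m)%:C * (xi : R[i]))) <= e * 2 ^+ n.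
  rewrite -(ler_pM2l sn).
  have -> : s m ^+ n * cmod (g ((s m)%:C * (xi : R[i]))) =
      cmod (1 - (K ((s m)%:C * (xi : R[i])))^-1).
    by rewrite gE// cmodM cmodX cmod_dilate.
  rewrite cmodC -F1 (le_trans (ltW Fm))// mulrCA -exprMn ler_peMr ?(ltW e0)//.
  rewrite exprn_ege1//; move: sm.
  by rewrite -(@ltr_pM2r _ 2)// mulVf// => /ltW.
rewrite -(subKr (g ((s m)%:C * (xi : R[i]))) (G xi)) (le_trans (cmodB _ _))//.
rewrite !mulrDr mulr1; have := exprn_ge0 n (ler0n R 2) => p0.
have : 0 <= e * 2 ^+ n by rewrite mulr_ge0// ltW.
by move: gsmall (ltW gm); lra.
Qed.

Lemma holo_inv_nontangential (R : realType) (D : set R[i]) (u : R[i] -> R[i])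
    (xi : circle R) (l : R[i]) : l != 0 ->
  nontangential_limit D (fun z => (u z)^-1) xi l ->
  nontangential_limit D u xi l^-1.
Proof.
move=> l0 hl a a1; have := hl a a1; set G := within _ _ => cl.
have GF : Filter G by exact: within_filter.
have e : (fun z => ((u z)^-1)^-1) = u by apply/funext => z; rewrite invrK.
suff : (fun z => ((u z)^-1)^-1) z @[z --> G] --> l^-1 by rewrite e.
exact: (cvgV l0 cl).
Qed.

Lemma nontangential_eq (R : realType) (D : set R[i]) (u v : R[i] -> R[i])
    (xi : circle R) (l : R[i]) :
  (forall z, D z -> cmod (z - (xi : R[i])) < 1 -> u z = v z) ->
  nontangential_limit D u xi l -> nontangential_limit D v xi l.
Proof.
move=> uv /nontangential_limitP hl; apply/nontangential_limitP => a a1 e e0.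
have [d d0 dh] := hl a a1 e e0; exists (Num.min d 1).
  by rewrite lt_min d0 ltr01.
by move=> z Dz za; rewrite lt_min => /andP[zd zd1]; rewrite -uv//; exact: dh.
Qed.

Lemma nontangential_cst (R : realType) (D : set R[i]) (xi : circle R) (l : R[i]) :
  nontangential_limit D (fun=> l) xi l.
Proof. by move=> a _; exact: cvg_cst. Qed.

Theorem theorem5p7 (R : realType) (mu : probability (circle R) R)
    (h : circle R -> R) (hh : is_ac_density mu h) :
  {ae circle_lebesgue R, forall xi : circle R,
    exists Kp Km Cp Cm : R[i],
      [/\ nontangential_limit (@exterior R)
            (cauchy_transform mu (fun=> 1)) xi Kp,
          nontangential_limit (@disc R)
            (cauchy_transform mu (fun=> 1)) xi Km,
          nontangential_limit (@exterior R)
            (normalized_cauchy_transform mu (fun zeta : circle R => zeta^*)) xi Cp,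
          nontangential_limit (@disc R)
            (normalized_cauchy_transform mu (fun zeta : circle R => zeta^*)) xi Cm &
          Cm - Cp = 1 / ((xi : R[i]) * Kp * Km) * (h xi)%:C]}.
Proof.
set K := cauchy_transform mu (fun=> 1).
have hF := holo_inv_cauchy mu; have FB := @inv_cauchy_bound _ mu.
have [F bF cF] := holo_fatou hF FB.
have F0 : {ae circle_lebesgue R, forall xi, F xi != 0}.
  apply: holo_boundary_neq0 hF FB _ bF cF.
  by rewrite cauchy_at0 cint_cst invr1 oner_neq0.
have [s s01 s1] := radii R.
(* 1 / F is the boundary value of K, so by [cauchy_mass] this is the radial limit of the Poisson
   integral of [mu]. *)
pose L xi := 2 * complex.Re (F xi)^-1 - 1.
have mL : measurable_fun setT L.
  apply: measurable_funB; last exact: measurable_cst.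
  apply: measurable_funM; first exact: measurable_cst.
  under [X in measurable_fun _ X]eq_fun do rewrite ReV.
  apply: measurable_funM; first by case: bF => [[]].
  apply: measurable_fun_inv_ge0; first by move=> x; exact: sqr_ge0.
  by case: (bmeas_sqr_cmod bF).
have cK : {ae circle_lebesgue R, forall xi, F xi != 0 /\
    nontangential_limit (@disc R) K xi (F xi)^-1}.
  apply: filterS2 F0 cF => xi Fxi cFxi; split; first exact: Fxi.
  exact: (holo_inv_nontangential Fxi cFxi).
have cL : {ae circle_lebesgue R, forall xi : circle R,
    \int[mu]_zeta poisson ((s n)%:C * (xi : R[i])) zeta @[n --> \oo] --> L xi}.
  apply: filterS cK => xi [_ cKxi].
  rewrite (_ : (fun n => _) = fun n => 2 * complex.Re (K ((s n)%:C * (xi : R[i]))) - 1).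
    apply: cvgB; last exact: cvg_cst.
    apply: cvgMr; apply: cvg_Re_cmod; exact: nontangential_radial cKxi.
  apply/funext => n; rewrite cauchy_mass//.
  by have /andP[s0 sl] := s01 n; rewrite cmod_dilate// lt_eqF.
have Lh := fatou_density hh mL s01 s1 cL.
have disc1 (z : R[i]) : disc z -> cmod z != 1 by move=> /discP z1; rewrite lt_eqF.
have ext1 (z : R[i]) : exterior z -> cmod z != 1.
  by move=> /exteriorP z1; rewrite gt_eqF.
have [K1|Fn1] := inv_cauchy_boundary_neq1 bF cF.
  (* K is 1 inside and 0 outside. Inside, the transform of conj(xi) vanishes because K = 1 + z times
     it; outside, the normalized transform is a quotient by 0. *)
  apply: aeW => xi; exists 0, 1, 0, 0.
  have Kext (z : R[i]) : exterior z -> K z = 0.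
    move=> /exteriorP z1; rewrite /K cauchy_reflect// K1 ?conjc1 ?subrr//.
    by rewrite cmodV cmodJ invf_lt1// (lt_trans ltr01).
  split.
  - apply: (@nontangential_eq R _ (fun=> 0)); last exact: nontangential_cst.
    move=> z Dz _.
    by rewrite -/K Kext.
  - apply: (@nontangential_eq R _ (fun=> 1)); last exact: nontangential_cst.
    move=> z /discP z1 _.
    by rewrite /K K1.
  - apply: (@nontangential_eq R _ (fun=> 0)); last exact: nontangential_cst.
    move=> z Dz _.
    by rewrite /normalized_cauchy_transform -/K Kext// invr0 mulr0.
  - apply: (@nontangential_eq R _ (fun=> 0)); last exact: nontangential_cst.
    move=> z Dz zx.
    have z0 : z != 0.
      by apply/eqP => z0; move: zx; rewrite z0 sub0r cmodN cmod_circle ltxx.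
    have /discP z1 := Dz; have := cauchy_conjE mu (disc1 _ Dz).
    rewrite K1// -[X in X = _]addr0 => /addrI/esym/eqP.
    rewrite mulf_eq0 (negbTE z0)/= => /eqP e0.
    by rewrite /normalized_cauchy_transform e0 mul0r.
  - by rewrite subrr mulr0 mul0r invr0 mulr0 mul0r.
apply: filterS3 cK Fn1 Lh => xi [Fxi cKxi] F1 Lxi.
set k := (F xi)^-1 in cKxi; have k0 : k != 0 by rewrite invr_neq0.
(* This keeps the exterior limit 1 - conj(k) away from 0. *)
have k1 : k != 1.
  by apply: contra F1; rewrite /k -{2}[F xi]invrK => /eqP ->; rewrite invr1.
have kp0 : 1 - k^*%C != 0.
  by rewrite subr_eq0 eq_sym -(inj_eq (can_inj (@conjcK R))) conjcK conjc1.
have cKp := nontangential_reflect cKxi.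
exists (1 - k^*%C), k, ((1 - k^*%C - 1) / (xi : R[i]) / (1 - k^*%C)),
  ((k - 1) / (xi : R[i]) / k); split.
- exact: cKp.
- exact: cKxi.
- exact: (normalized_nontangential ext1 cKp kp0).
- exact: (normalized_nontangential disc1 cKxi k0).
have x0 : (xi : R[i]) != 0 by rewrite -cmod_gt0 cmod_circle.
(* With this value both sides are rational in xi, k and conj(k), equal to (k + conj(k) - 1) / (xi k
   (1 - conj(k))). *)
have -> : (h xi)%:C = k + k^*%C - 1.
  by rewrite -Lxi /L -/k; apply: eq_reim; rewrite !reimE/=; ring.
by field; rewrite x0 k0 kp0.
Qed.
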